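(* Let $A$ be an $N\times N$ integer matrix with $\det(A)\ne0$ and with either $\rho(A)>0$ or $\ell(A)>0$, and let $\varphi_A$ be the associated monomial map. Then there is a constant $C(A)$ such that $$\hat h_{\varphi_A}(P)\le C(A)\,h(P)\quad\text{for all }P\in\mathbb{G}_m^N(\overline{\mathbb{Q}}).$$ In particular, the canonical height $\hat h_{\varphi_A}(P)$ is finite.
   Context: For an $N\times N$ integer matrix $A=(a_{ij})$ with $\det A\ne0$, the monomial map $\varphi_A:\mathbb{G}_m^N\to\mathbb{G}_m^N$ is $\varphi_A(X_1,\dots,X_N)=\bigl(\prod_j X_j^{a_{1j}},\dots,\prod_j X_j^{a_{Nj}}\bigr)$; via $\mathbb{G}_m^N\subset\mathbb{P}^N$ it induces a dominant rational map of $\mathbb{P}^N$. $\rho(A)$ is the spectral radius of $A$ (largest absolute value of a complex eigenvalue), and $\ell(A)+1$ is the size of the largest Jordan block of $A$ among blocks whose eigenvalue has absolute value $\rho(A)$. The degree of a rational map of $\mathbb{P}^N$ is the common degree of homogeneous coordinate polynomials without common factor; $\delta_{\varphi_A}=\lim_{n\to\infty}(\deg\varphi_A^n)^{1/n}$, and $\ell_{\varphi_A}=\inf\{\ell\ge0:\sup_{n\ge1}\deg(\varphi_A^n)/(n^{\ell}\delta_{\varphi_A}^n)<\infty\}$. It is known that $\delta_{\varphi_A}=\rho(A)$ and $\ell_{\varphi_A}=\ell(A)$. With $h$ the absolute logarithmic Weil height on $\mathbb{P}^N(\overline{\mathbb{Q}})$ (restricted to $\mathbb{G}_m^N(\overline{\mathbb{Q}})$),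 the canonical height is $\hat h_{\varphi_A}(P)=\limsup_{n\to\infty}n^{-\ell_{\varphi_A}}\delta_{\varphi_A}^{-n}h(\varphi_A^n(P))$. *)

(* Defs.v *)
From HB Require Import structures.
From mathcomp Require Import all_boot all_order all_algebra all_field.
From mathcomp Require Import all_classical all_reals all_analysis.
From mathcomp Require Import complex.
From mathcomp Require Import -(notations) mpoly.

Set Implicit Arguments.
Unset Strict Implicit.
Unset Printing Implicit Defensive.

Import Order.TTheory GRing.Theory Num.Theory.
Import numFieldNormedType.Exports.

Local Open Scope classical_set_scope.
Local Open Scope ring_scope.

Section SpectralData.
Variables (R : realType) (N : nat).
Implicit Types A : 'M[int]_N.

Local Notation C := R[i].
Local Notation cmod := (@ComplexField.Normc.normc R).

Definition complex_mx A : 'M[C]_N := map_mx intr A.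

Definition spectral_radius A : R :=
  sup [set cmod a | a in [set a : C | eigenvalue (complex_mx A) a]].

Definition jordan_block (k : nat) (a : C) : 'M[C]_k :=
  \matrix_(i, j) (a *+ (i == j) + (i.+1 == j)%:R).

(* The change of basis is given by two rectangular matrices that are inverse *)
(* to each other, which forces [\sum_i p i = N].                             *)
Definition is_jordan_form (M : 'M[C]_N) (b : nat) (p : 'I_b -> nat)
    (a : 'I_b -> C) : Prop :=
  (forall i, (0 < p i)%N) /\
  exists (S : 'M[C]_(N, \sum_i p i)) (T : 'M[C]_(\sum_i p i, N)),
    [/\ S *m T = 1%:M, T *m S = 1%:M &
        M = S *m (\mxdiag_i jordan_block (p i) (a i)) *m T].

Definition jordan_index A : nat :=
  xget 0%N [set l | exists b (p : 'I_b -> nat) (a : 'I_b -> C),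
    is_jordan_form (complex_mx A) p a /\
    l.+1 = (\max_(i < b | cmod (a i) == spectral_radius A) p i)%N].

End SpectralData.

Section WeilHeight.
Variable R : realType.

Definition is_absolute_value (L : fieldType) (v : L -> R) : Prop :=
  [/\ forall x, 0 <= v x,
      forall x, v x = 0 <-> x = 0,
      forall x y, v (x * y) = v x * v y &
      forall x y, v (x + y) <= v x + v y].

Definition padic_abs (p : nat) (x : rat) : R :=
  if x == 0 then 0
  else p%:R ^ ((logn p `|denq x|%N)%:Z - (logn p `|numq x|%N)%:Z).

(* Absolute values are normalized to extend a standard one of rat, so that   *)
(* each place of K is represented by exactly one function.                   *)
Definition places (K : fieldExtType rat) : set (K -> R) :=
  [set v | is_absolute_value v /\
    ((forall q : rat, v (ratr q) = ratr `|q|) \/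
     (exists2 p, prime p & forall q : rat, v (ratr q) = padic_abs p q))].

Definition is_completion (K : fieldExtType rat) (v : K -> R)
    (L : fieldType) (w : L -> R) (i : {rmorphism K -> L}) : Prop :=
  [/\ is_absolute_value w,
      forall x, w (i x) = v x,
      forall (y : L) (e : R), 0 < e -> exists x, w (y - i x) < e &
      forall u : nat -> L,
        (forall e : R, 0 < e -> exists n0, forall m n,
           (n0 <= m)%N -> (n0 <= n)%N -> w (u m - u n) < e) ->
        exists l, forall e : R, 0 < e -> exists n0, forall n,
           (n0 <= n)%N -> w (u n - l) < e].

(* Q_v is the closure of the rationals in the completion K_v, and [K_v : Q_v] *)
(* is the size of a basis of K_v over Q_v.                                    *)
Definition local_degree (K : fieldExtType rat) (v : K -> R) : nat :=
  xget 0%N [set d | exists (L : fieldType) (w : L -> R)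
                           (i : {rmorphism K -> L}) (b : 'I_d -> L),
    is_completion v w i /\
    let Qv := [set z : L | forall e : R, 0 < e ->
                 exists q : rat, w (z - i (ratr q)) < e] in
    forall y : L, exists! c : {ffun 'I_d -> L},
      (forall j, Qv (c j)) /\ y = \sum_j c j * b j].

Definition height_over (K : fieldExtType rat) (n : nat) (x : 'rV[K]_n) : R :=
  (\sum_(v \in @places K)
     (local_degree v)%:R * ln (\big[Num.max/0]_(i < n) v (x 0 i)))
  / (\dim {:K})%:R.

(* By the degree formula \sum_(w | v) [L_w : Q_v] = [L : K] [K_v : Q_v], the   *)
(* value of [height_over] is the same for every number field containing the   *)
(* coordinates; the infimum, over a one-element set, picks this value.        *)
Definition weil_height (n : nat) (x : 'rV[algC]_n) : R :=
  inf [set r | exists (K : fieldExtType rat) (iota : {rmorphism K -> algC})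
                      (y : 'rV[K]_n),
         map_mx iota y = x /\ r = height_over y].

End WeilHeight.

Definition in_torus (N : nat) (P : 'rV[algC]_N) : Prop :=
  forall j, P 0 j != 0.

Definition proj_coords (N : nat) (P : 'rV[algC]_N) : 'rV[algC]_(1 + N) :=
  row_mx 1 P.

Definition monomial_map (N : nat) (A : 'M[int]_N) (P : 'rV[algC]_N) :
    'rV[algC]_N :=
  \row_i \prod_j P 0 j ^ A i j.

Section Degree.
Variable N : nat.
Implicit Types f : 'rV[algC]_N -> 'rV[algC]_N.

(* Homogeneous coordinate polynomials of degree d, without common factor, for *)
(* the rational self-map of P^N that restricts to f on the torus, which is    *)
(* Zariski dense. The scalar c is 0 at points where all the F i vanish. The   *)
(* units of the polynomial ring are the nonzero constants.                    *)
Definition is_homogeneous_presentation f (d : nat)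
    (F : 'I_(1 + N) -> mpoly (1 + N) algC) : Prop :=
  [/\ forall i, F i \is ishomog1 d mdeg,
      forall g, (forall i, exists q, F i = q * g) -> g \is a GRing.unit &
      forall P, in_torus P -> exists c : algC, forall i,
        meval (fun j => proj_coords P 0 j) (F i)
          = c * proj_coords (f P) 0 i].

Definition map_degree f : nat :=
  xget 0%N [set d | exists F, is_homogeneous_presentation f d F].

End Degree.

Section CanonicalHeight.
Variables (R : realType) (N : nat).
Implicit Types f : 'rV[algC]_N -> 'rV[algC]_N.

Definition dynamical_degree f : R :=
  limn (fun n => (map_degree (iter n f))%:R `^ n%:R^-1).

Definition degree_growth_exponent f : R :=
  inf [set l : R | 0 <= l /\
    (ereal_sup [set ((map_degree (iter n f))%:R
                       / (n%:R `^ l * dynamical_degree f ^+ n))%:E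
               | n in [set n | (1 <= n)%N]] < +oo)%E].

Definition torus_height (P : 'rV[algC]_N) : R := weil_height R (proj_coords P).

Definition canonical_height f (P : 'rV[algC]_N) : \bar R :=
  limn_esup (fun n =>
    (n%:R `^ (- degree_growth_exponent f) * dynamical_degree f ^- n
       * torus_height (iter n f P))%:E).

End CanonicalHeight.

(* Main.v *)
(* For a point z of the torus over a number field K, the product formula gives *)
(* sum_v d_v |ln v(z_j)| = 2 sum_v d_v ln^+ v(z_j) <= 2 [K:Q] h(z), so that    *)
(* h(phi_B z) <= 2 N |B| h(z), with |B| the largest entry of B. On the other   *)
(* hand deg phi_B is comparable with |B|, and the decomposition of A into      *)
(* generalized eigenspaces shows that |A^n| is comparable with n^l rho^n for   *)
(* some rho and l. These are then the dynamical degree and the degree growth   *)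
(* exponent, whatever their relation to the spectrum, and the two estimates    *)
(* applied to B = A^n bound n^-l rho^-n h(phi_A^n P) by a multiple of h(P).    *)
(*   The product formula follows from the one over Q. Write K = Q[X]/f and let *)
(* F be the completion of Q at v0. For an irreducible factor g of f over F the *)
(* map h |-> |N(h)|^(1/deg g) on F[X]/g is multiplicative, and it is           *)
(* equivalent to the maximum of the coefficients by compactness; applied to    *)
(* k-th powers as k grows, this makes it an absolute value, and the only one   *)
(* extending that of F. Hence the places above v0 correspond to the factors g, *)
(* with local degree deg g, and prod_v v(y)^d_v = v0(N(y)).                    *)

From HB Require Import structures.
Require Import Defs.
From mathcomp Require Import all_boot all_order all_algebra all_field.
From mathcomp Require Import all_classical all_reals all_analysis.
From mathcomp Require Import complex.
From mathcomp Require Import -(notations) mpoly.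
From mathcomp Require Import perm ring lra zify.

Set Implicit Arguments.
Unset Strict Implicit.
Unset Printing Implicit Defensive.

Import Order.TTheory GRing.Theory Num.Theory.
Import numFieldNormedType.Exports.
Local Open Scope classical_set_scope.
Local Open Scope ring_scope.

(** * Absolute values *)

Section AbsoluteValue.
Variables (R : realType) (K : fieldType) (v : K -> R).
Hypothesis hv : is_absolute_value v.

Lemma av_ge0 x : 0 <= v x. Proof. by case: hv => + _ _ _; exact. Qed.

Lemma av_eq0 x : (v x == 0) = (x == 0).
Proof. by case: hv => _ h _ _; apply/eqP/eqP => /h. Qed.

Lemma avM x y : v (x * y) = v x * v y.
Proof. by case: hv => _ _ + _; exact. Qed.

Lemma avD x y : v (x + y) <= v x + v y.
Proof. by case: hv => _ _ _; exact. Qed.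

Lemma av0 : v 0 = 0. Proof. by apply/eqP; rewrite av_eq0. Qed.

Lemma av_gt0 x : (0 < v x) = (x != 0).
Proof. by rewrite lt0r av_eq0 av_ge0 andbT. Qed.

Lemma av1 : v 1 = 1.
Proof.
have h : v 1 != 0 by rewrite av_eq0 oner_eq0.
by apply: (mulfI h); rewrite -avM !mulr1.
Qed.

Lemma avX x n : v (x ^+ n) = v x ^+ n.
Proof. by elim: n => [|n IH]; rewrite ?expr0 ?av1// !exprS avM IH. Qed.

Lemma avN x : v (- x) = v x.
Proof.
rewrite -mulN1r avM; suff -> : v (-1) = 1 by rewrite mul1r.
have := avX (-1) 2; rewrite sqrrN expr1n av1 => /esym /eqP.
rewrite -subr_eq0 subr_sqr_1 mulf_eq0 => /orP[|]; first by rewrite subr_eq0 => /eqP.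
by rewrite gt_eqF// ltr_wpDl ?av_ge0.
Qed.

Lemma avV x : v x^-1 = (v x)^-1.
Proof.
have [->|x0] := eqVneq x 0; first by rewrite invr0 av0 invr0.
have h : v x != 0 by rewrite av_eq0.
by apply: (mulfI h); rewrite -avM !divff// av1.
Qed.

Lemma avXz x (n : int) : v (x ^ n) = v x ^ n.
Proof. by case: n => n; rewrite ?NegzE -?exprnN ?avV ?exprnP -?exprnP avX. Qed.

Lemma avBC x y : v (x - y) = v (y - x). Proof. by rewrite -avN opprB. Qed.

Lemma avB x y : v (x - y) <= v x + v y.
Proof. by rewrite (le_trans (avD _ _))// avN. Qed.

Lemma av_dist x y : `|v x - v y| <= v (x - y).
Proof.
have := avD (y - x) x; have := avD (x - y) y; rewrite !subrK (avBC y x) ler_norml.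
by move=> h1 h2; apply/andP; split; lra.
Qed.

Lemma av_sum (I : Type) (r : seq I) (P : pred I) (f : I -> K) :
  v (\sum_(i <- r | P i) f i) <= \sum_(i <- r | P i) v (f i).
Proof.
elim/big_rec2 : _ => [|i y x _ h]; first by rewrite av0.
by rewrite (le_trans (avD _ _))// lerD2l.
Qed.

Lemma av_prod (I : Type) (r : seq I) (P : pred I) (f : I -> K) :
  v (\prod_(i <- r | P i) f i) = \prod_(i <- r | P i) v (f i).
Proof. by elim/big_rec2 : _ => [|i y x _ h]; rewrite ?av1// avM h. Qed.

Lemma av_natr n : v n%:R <= n%:R.
Proof.
elim: n => [|n IH]; first by rewrite av0.
by rewrite -natr1 (le_trans (avD _ _))// -natr1 av1 lerD2r.
Qed.

Definition av_cvg (T : Type) (F : set_system T) (x : T -> K) (l : K) :=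
  forall e : R, 0 < e -> F [set t | v (x t - l) < e].

Section Limits.
Variables (T : Type) (F : set_system T).
Context {FF : ProperFilter F}.
Implicit Types x y : T -> K.

Lemma av_cvg_cst c : av_cvg F (fun=> c) c.
Proof. by move=> e e0; apply: filterE => t /=; rewrite subrr av0. Qed.

Lemma av_cvgD x y a b : av_cvg F x a -> av_cvg F y b -> av_cvg F (fun t => x t + y t) (a + b).
Proof.
move=> hx hy e e0; have e2 : 0 < e / 2 by rewrite divr_gt0.
apply: filterS2 (hx _ e2) (hy _ e2) => t /= h1 h2.
rewrite opprD addrACA (le_lt_trans (avD _ _))//.
by rewrite [ltRHS]splitr ltrD.
Qed.

Lemma av_cvgN x a : av_cvg F x a -> av_cvg F (fun t => - x t) (- a).
Proof.
move=> hx e e0; apply: filterS (hx _ e0) => t /=.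
by rewrite -opprD avN.
Qed.

Lemma av_cvgB x y a b : av_cvg F x a -> av_cvg F y b -> av_cvg F (fun t => x t - y t) (a - b).
Proof. by move=> hx hy; apply: av_cvgD => //; apply: av_cvgN. Qed.

Lemma av_cvgM x y a b : av_cvg F x a -> av_cvg F y b -> av_cvg F (fun t => x t * y t) (a * b).
Proof.
move=> hx hy e e0.
pose M := v a + v b + 1.
have M0 : 0 < M by rewrite ltr_wpDl// addr_ge0// av_ge0.
pose d := Num.min 1 (e / (2 * M)).
have d0 : 0 < d by rewrite lt_min ltr01 divr_gt0// mulr_gt0.
apply: filterS2 (hx _ d0) (hy _ d0) => t /= h1 h2.
have -> : x t * y t - a * b = (x t - a) * (y t - b) + (x t - a) * b + a * (y t - b) by ring.
rewrite (le_lt_trans (avD _ _))// (le_lt_trans (lerD (avD _ _) (lexx _)))// !avM.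
have d1 : d <= 1 by rewrite ge_min lexx.
have dM : d * M <= e / 2.
  rewrite -ler_pdivlMr// (le_trans (_ : d <= e / (2 * M)))// ?ge_min ?lexx ?orbT//.
  by rewrite invfM mulrA.
have p1 : v (x t - a) * v (y t - b) <= d * 1.
  by apply: ler_pM; rewrite ?av_ge0// ltW// (lt_le_trans h2).
have p2 : v (x t - a) * v b <= d * v b by rewrite ler_wpM2r ?av_ge0// ltW.
have p3 : v a * v (y t - b) <= d * v a by rewrite mulrC ler_wpM2r ?av_ge0// ltW.
rewrite (le_lt_trans (lerD (lerD p1 p2) p3))// -!mulrDr.
rewrite (le_lt_trans (_ : _ <= e / 2))//; last by rewrite ltr_pdivrMr// ltr_pMr// ltr1n.
by rewrite (le_trans _ dM)// /M ler_pM2l//; lra.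
Qed.

Lemma av_cvg_sum (I : Type) (r : seq I) (P : pred I) (f : I -> T -> K) (g : I -> K) :
  (forall i, P i -> av_cvg F (f i) (g i)) ->
  av_cvg F (fun t => \sum_(i <- r | P i) f i t) (\sum_(i <- r | P i) g i).
Proof.
move=> h; elim: r => [|i r IH].
  by under eq_fun do rewrite big_nil; rewrite big_nil; exact: av_cvg_cst.
under eq_fun do rewrite big_cons; rewrite big_cons.
by case: ifPn => // Pi; apply: av_cvgD => //; exact: h.
Qed.

Lemma av_cvg_prod (I : Type) (r : seq I) (P : pred I) (f : I -> T -> K) (g : I -> K) :
  (forall i, P i -> av_cvg F (f i) (g i)) ->
  av_cvg F (fun t => \prod_(i <- r | P i) f i t) (\prod_(i <- r | P i) g i).
Proof.
move=> h; elim: r => [|i r IH].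
  by under eq_fun do rewrite big_nil; rewrite big_nil; exact: av_cvg_cst.
under eq_fun do rewrite big_cons; rewrite big_cons.
by case: ifPn => // Pi; apply: av_cvgM => //; exact: h.
Qed.

Lemma av_cvg_unique x a b : av_cvg F x a -> av_cvg F x b -> a = b.
Proof.
move=> hx hy; apply/eqP; rewrite -subr_eq0 -av_eq0; apply/negPn/negP => h.
have e0 : 0 < v (a - b) / 2 by rewrite divr_gt0// lt0r h av_ge0.
have [t [/= h1 h2]] := filter_ex (filterI (hx _ e0) (hy _ e0)).
have : v (a - b) < v (a - b).
  rewrite {1}(_ : a - b = (x t - b) - (x t - a)); last by ring.
  by rewrite (le_lt_trans (avB _ _))// [ltRHS]splitr ltrD.
by rewrite ltxx.
Qed.

Lemma av_cvg_av x a : av_cvg F x a -> (fun t => v (x t)) @ F --> v a.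
Proof.
move=> hx; apply/cvgrPdist_lt => e e0; apply: filterS (hx _ e0) => t /=.
by rewrite distrC; apply: le_lt_trans; exact: av_dist.
Qed.

Lemma av_cvg0 x : av_cvg F x 0 <-> (fun t => v (x t)) @ F --> 0.
Proof.
split=> [/av_cvg_av|/cvgrPdist_lt h e e0]; first by rewrite av0.
by apply: filterS (h _ e0) => t /=; rewrite !sub0r normrN ger0_norm ?av_ge0// subr0.
Qed.

Lemma av_cvg_le x (y : T -> R) a : (forall t, v (x t - a) <= y t) -> y @ F --> 0 -> av_cvg F x a.
Proof.
move=> h /cvgrPdist_lt hy e e0; apply: filterS (hy _ e0) => t /=.
by rewrite sub0r normrN => yt; rewrite (le_lt_trans (h t))// (le_lt_trans (ler_norm _)).
Qed.

Lemma av_cvg_det n (A : T -> 'M[K]_n) (B : 'M[K]_n) :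
  (forall i j, av_cvg F (fun t => A t i j) (B i j)) -> av_cvg F (fun t => \det (A t)) (\det B).
Proof.
move=> h; rewrite /determinant; apply: av_cvg_sum => s _; apply: av_cvgM.
  exact: av_cvg_cst.
by apply: av_cvg_prod.
Qed.

End Limits.

Definition av_cauchy (u : nat -> K) := forall e : R, 0 < e -> exists n0, forall m n,
  (n0 <= m)%N -> (n0 <= n)%N -> v (u m - u n) < e.

Definition av_complete := forall u, av_cauchy u -> exists l, av_cvg \oo u l.

Lemma av_cvg_oo u l : av_cvg \oo u l <->
  (forall e : R, 0 < e -> exists n0, forall n, (n0 <= n)%N -> v (u n - l) < e).
Proof. by split=> h e /h [N]; [move=> _ hN|move=> hN]; exists N. Qed.

Lemma av_cvg_cauchy u l : av_cvg \oo u l -> av_cauchy u.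
Proof.
move=> /av_cvg_oo h e e0; have e2 : 0 < e / 2 by rewrite divr_gt0.
have [n0 hn] := h _ e2; exists n0 => m n /hn h1 /hn h2.
rewrite (_ : u m - u n = (u m - l) - (u n - l)); last by ring.
by rewrite (le_lt_trans (avB _ _))// [ltRHS]splitr ltrD.
Qed.

Lemma av_cauchy_bound u : av_cauchy u -> exists M, forall n, v (u n) <= M.
Proof.
move=> /(_ 1 ltr01) [n0 h].
exists (1 + v (u n0) + \sum_(i < n0) v (u i)) => n.
have s0 : 0 <= \sum_(i < n0) v (u i) by apply: sumr_ge0 => i _; exact: av_ge0.
have [n0n|nn0] := leqP n0 n.
  rewrite (le_trans (_ : _ <= v (u n - u n0) + v (u n0)))//.
    by rewrite (le_trans _ (avD _ _))// subrK.
  have := h _ _ n0n (leqnn _); lra.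
rewrite (bigD1 (Ordinal nn0))//=.
have : 0 <= \sum_(i < n0 | i != Ordinal nn0) v (u i) by apply: sumr_ge0 => i _; exact: av_ge0.
have := av_ge0 (u n0); lra.
Qed.

Lemma av_cauchy_R u : av_cauchy u -> cvgn (fun n => v (u n)).
Proof.
move=> cu; apply/cauchy_cvgP/cauchy_exP => e e0.
have [n0 h] := cu _ e0.
exists (v (u n0)); exists n0 => // n /= hn; rewrite /ball /=.
exact: le_lt_trans (av_dist _ _) (h _ _ (leqnn _) hn).
Qed.

End AbsoluteValue.

Section RingHom.
Variables (R : realType) (K L : fieldType) (v : K -> R) (w : L -> R) (i : {rmorphism K -> L}).
Hypotheses (hw : forall x, w (i x) = v x).

Lemma av_cvg_morph (T : Type) (F : set_system T) (x : T -> K) l :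
  av_cvg v F x l <-> av_cvg w F (fun t => i (x t)) (i l).
Proof. by split=> h e /h; congr (F _); apply/seteqP; split=> t /=; rewrite -rmorphB hw. Qed.

Lemma av_cauchy_morph (u : nat -> K) : av_cauchy v u <-> av_cauchy w (fun t => i (u t)).
Proof.
by split=> h e /h [n0 hn]; exists n0 => m n hm hn'; have := hn m n hm hn'; rewrite -rmorphB hw.
Qed.

End RingHom.

(** * Completion of a field *)

Section Completion.
Variables (R : realType) (K : fieldType) (v : K -> R).
Hypothesis hv : is_absolute_value v.

(* Functions form a nontrivial ring only on a pointed domain. *)
Let N := [the pointedType of nat : Type].

Definition cauchy_seq (h : is_absolute_value v) : {pred (N -> K)} :=
  fun u => `[< av_cauchy v u >].

Lemma cauchy_seqP u : reflect (av_cauchy v u) (u \in cauchy_seq hv).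
Proof. exact: asboolP. Qed.

Lemma cauchy_seq_subring : subring_closed (cauchy_seq hv).
Proof.
split.
- apply/cauchy_seqP; apply: (av_cvg_cauchy hv); exact: (av_cvg_cst hv).
- move=> x y /cauchy_seqP hx /cauchy_seqP hy; apply/cauchy_seqP => e e0.
  have e2 : 0 < e / 2 by rewrite divr_gt0.
  have [n1 h1] := hx _ e2; have [n2 h2] := hy _ e2.
  exists (maxn n1 n2) => m n; rewrite !geq_max => /andP[m1 m2] /andP[n1' n2'].
  rewrite (_ : (x - y) m - (x - y) n = (x m - x n) - (y m - y n)); last first.
    by change (x m - y m - (x n - y n) = x m - x n - (y m - y n)); ring.
  by rewrite (le_lt_trans (avB hv _ _))// [ltRHS]splitr ltrD// ?h1// h2.
- move=> x y /cauchy_seqP hx /cauchy_seqP hy; apply/cauchy_seqP => e e0.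
  have [M hM] := av_cauchy_bound hv hx; have [M' hM'] := av_cauchy_bound hv hy.
  pose B := Num.max 1 (Num.max M M').
  have B0 : 0 < B by rewrite lt_max ltr01.
  have e2 : 0 < e / (2 * B) by rewrite divr_gt0// mulr_gt0.
  have [n1 h1] := hx _ e2; have [n2 h2] := hy _ e2.
  exists (maxn n1 n2) => m n; rewrite !geq_max => /andP[m1 m2] /andP[n1' n2'].
  rewrite (_ : (x * y) m - (x * y) n = x m * (y m - y n) + y n * (x m - x n)); last first.
    by change (x m * y m - x n * y n = x m * (y m - y n) + y n * (x m - x n)); ring.
  have key a b : v a <= B -> v b < e / (2 * B) -> v (a * b) < e / 2.
    move=> ha hb; rewrite (avM hv)//; apply: (@le_lt_trans _ _ (B * v b)).
      by rewrite ler_wpM2r ?(av_ge0 hv).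
    by rewrite mulrC -ltr_pdivlMr// -mulrA -invfM.
  rewrite (le_lt_trans (avD hv _ _))// [ltRHS]splitr ltrD// key ?h1 ?h2//.
    by rewrite !le_max hM orbT.
  by rewrite !le_max hM' !orbT.
Qed.

HB.instance Definition _ :=
  GRing.isSubringClosed.Build (N -> K) (cauchy_seq hv) cauchy_seq_subring.

Record cauchy_ring := CauchyRing { cauchy_val :> N -> K; _ : cauchy_val \in cauchy_seq hv }.
HB.instance Definition _ := [isSub for cauchy_val].
HB.instance Definition _ := [Choice of cauchy_ring by <:].
HB.instance Definition _ := [SubChoice_isSubComNzRing of cauchy_ring by <:].

Lemma cauchy_ringP (u : cauchy_ring) : av_cauchy v u.
Proof. by case: u => u /= /cauchy_seqP. Qed.

Definition null_seq : {pred cauchy_ring} := fun u => `[< av_cvg v \oo (u : nat -> K) 0 >].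

Lemma null_seqP (u : cauchy_ring) : reflect (av_cvg v \oo (u : nat -> K) 0) (u \in null_seq).
Proof. exact: asboolP. Qed.

Lemma null_seq_ideal : idealr_closed null_seq.
Proof.
split.
- by apply/null_seqP; apply: (av_cvg_cst hv).
- apply/null_seqP => h.
  have e10 : (0 : K) = 1 := av_cvg_unique hv h (av_cvg_cst hv 1).
  by move/eqP: (oner_neq0 K); rewrite -e10.
- move=> a x y /null_seqP hx /null_seqP hy; apply/null_seqP => e e0.
  have e2 : 0 < e / 2 by rewrite divr_gt0.
  have [M hM] := av_cauchy_bound hv (cauchy_ringP a).
  pose B := Num.max 1 M.
  have B0 : 0 < B by rewrite lt_max ltr01.
  have e3 : 0 < e / 2 / B by rewrite !divr_gt0.
  apply: filterS2 (hx _ e3) (hy _ e2) => t /=; rewrite !subr0 => h1 h2.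
  rewrite (le_lt_trans (avD hv _ _))// [ltRHS]splitr ltrD// (avM hv)//.
  rewrite (@le_lt_trans _ _ (B * v (x t)))// ?ler_wpM2r ?(av_ge0 hv)// ?le_max ?hM ?orbT//.
  by rewrite mulrC -ltr_pdivlMr.
Qed.

HB.instance Definition _ := isIdealr.Build cauchy_ring null_seq null_seq_ideal.

Definition completion := {ideal_quot null_seq}.
HB.instance Definition _ := GRing.ComNzRing.on completion.
HB.instance Definition _ := Quotient.on completion.

Definition cpi (u : cauchy_ring) : completion := \pi_completion%qT u.

Lemma cpi_zmod : zmod_morphism cpi.
Proof. exact: (pi_is_zmod_morphism {ideal_quot null_seq}). Qed.

Lemma cpi_monoid : monoid_morphism cpi.
Proof. exact: (pi_is_monoid_morphism {ideal_quot null_seq}). Qed.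

HB.instance Definition _ := GRing.isZmodMorphism.Build cauchy_ring completion cpi cpi_zmod.
HB.instance Definition _ := GRing.isMonoidMorphism.Build cauchy_ring completion cpi cpi_monoid.

Lemma cpiP (x : completion) : exists u, x = cpi u.
Proof. by exists (repr x); rewrite /cpi reprK. Qed.

Lemma cpi_eq (u u' : cauchy_ring) : cpi u = cpi u' <-> av_cvg v \oo (fun n => u n - u' n) 0.
Proof.
rewrite /cpi; split=> [/eqP|h]; last apply/eqP;
  rewrite -Quotient.idealrBE; first by move/null_seqP.
exact/null_seqP.
Qed.

Lemma cpi_neq0 (u : cauchy_ring) : cpi u != 0 ->
  exists2 c : R, 0 < c & \forall n \near \oo, c <= v (u n).
Proof.
move=> h; have cv := av_cauchy_R hv (cauchy_ringP u).
have l0 : 0 < limn (fun n => v (u n)).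
  rewrite lt_neqAle; apply/andP; split; last first.
    by apply: limr_ge => //; apply: nearW => n; exact: (av_ge0 hv).
  apply: contra h => /eqP e; rewrite -(rmorph0 cpi); apply/eqP/cpi_eq.
  by apply/(av_cvg0 hv); rewrite e; under eq_fun do rewrite subr0.
exists (limn (fun n => v (u n)) / 2); first by rewrite divr_gt0.
move/cvgrPdist_lt : cv => /(_ (limn (fun n => v (u n)) / 2)) []; first by rewrite divr_gt0.
move=> n0 _ hn; exists n0 => // n /hn /=; rewrite ltr_norml => /andP[_].
lra.
Qed.

Definition cauchy_inv (u : cauchy_ring) : cauchy_ring := insubd 0 (fun n : N => (u n)^-1).

Lemma cauchy_invE (u : cauchy_ring) n : cpi u != 0 -> cauchy_inv u n = (u n)^-1.
Proof.
move=> /cpi_neq0 [c c0 [n0 _ hn]]; rewrite /cauchy_inv val_insubd ifT//.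
apply/cauchy_seqP => e e0.
have e2 : 0 < e * (c * c) by rewrite !mulr_gt0.
have [n1 h1] := cauchy_ringP u e2.
exists (maxn n0 n1) => k m; rewrite !geq_max => /andP[m1 m2] /andP[n1' n2'].
have hk := hn k m1; have hm := hn m n1'; rewrite /= in hk hm.
have vk : 0 < v (u k) by apply: lt_le_trans hk.
have vm : 0 < v (u m) by apply: lt_le_trans hm.
have uk : u k != 0 by rewrite -(av_gt0 hv).
have um : u m != 0 by rewrite -(av_gt0 hv).
rewrite (_ : _ - _ = (u m - u k) / (u k * u m)); last by field; rewrite uk um.
rewrite (avM hv)// (avV hv)// ltr_pdivrMr ?(avM hv) ?mulr_gt0//.
apply: (lt_le_trans (h1 _ _ n2' m2)).
by rewrite ler_pM2l// ler_pM// ltW.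
Qed.

Definition completion_inv (x : completion) : completion :=
  if x == 0 then 0 else cpi (cauchy_inv (repr x)).

Lemma completion_mulVf x : x != 0 -> completion_inv x * x = 1.
Proof.
move=> x0; rewrite /completion_inv (negPf x0).
have xE : x = cpi (repr x) by rewrite /cpi reprK.
rewrite {2}xE -rmorphM -(rmorph1 cpi); apply/cpi_eq.
have x0' : cpi (repr x) != 0 by rewrite -xE.
have [c c0 hc] := cpi_neq0 x0'.
move=> e e0; apply: filterS hc => n /= hn.
change (v (cauchy_inv (repr x) n * repr x n - 1 - 0) < e); rewrite cauchy_invE// mulVf.
  by rewrite subrr subr0 (av0 hv).
by rewrite -(av_gt0 hv) (lt_le_trans c0).
Qed.

Lemma completion_invr0 : completion_inv 0 = 0.
Proof. by rewrite /completion_inv eqxx. Qed.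

HB.instance Definition _ :=
  GRing.ComNzRing_isField.Build completion completion_mulVf completion_invr0.

Definition completion_av (x : completion) : R := limn (fun n => v (repr x n)).

Lemma cvg_completion_av (u : cauchy_ring) :
  (fun n => v (u n)) @ \oo --> completion_av (cpi u).
Proof.
have h : av_cvg v \oo (fun n => repr (cpi u) n - u n) 0.
  by apply/cpi_eq; rewrite /cpi reprK.
have c2 : cvgn (fun n => v (repr (cpi u) n)) by exact: (av_cauchy_R hv (@cauchy_ringP _)).
rewrite (_ : completion_av _ = completion_av (cpi u) - 0); last by rewrite subr0.
have h2 : (fun n => v (repr (cpi u) n) - v (u n)) @ \oo --> (0 : R).
  apply/cvgrPdist_lt => e e0; apply: filterS (h _ e0) => n /=.
  by rewrite sub0r normrN subr0; apply: le_lt_trans; exact: av_dist.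
rewrite (_ : (fun n => v (u n)) = (fun n => v (repr (cpi u) n)) - (fun n => v (repr (cpi u) n) - v (u n))).
  exact: cvgB.
by apply/funext => n /=; rewrite !fctE; ring.
Qed.

Lemma completion_avE (u : cauchy_ring) : completion_av (cpi u) = limn (fun n => v (u n)).
Proof. by apply/esym/cvg_lim => //; exact: cvg_completion_av. Qed.

Lemma completion_is_av : is_absolute_value completion_av.
Proof.
split.
- move=> x; have [u ->] := cpiP x.
  apply: limr_ge; last by apply: nearW => n; exact: (av_ge0 hv).
  exact: (av_cauchy_R hv (@cauchy_ringP _)).
- move=> x; have [u ->] := cpiP x; split => [h|].
    rewrite -(rmorph0 cpi); apply/cpi_eq/(av_cvg0 hv).
    by rewrite -h; under eq_fun do rewrite subr0; exact: cvg_completion_av.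
  rewrite -(rmorph0 cpi) => ->; rewrite completion_avE.
  rewrite (_ : (fun n => _) = cst 0); first by apply/cvg_lim => //; exact: cvg_cst.
  by apply/funext => n; exact: (av0 hv).
- move=> x y; have [u ->] := cpiP x; have [u' ->] := cpiP y.
  rewrite -rmorphM [LHS]completion_avE; apply/cvg_lim => //.
  rewrite (_ : (fun n => _) = (fun n => v (u n) * v (u' n))); last first.
    by apply/funext => n; exact: (avM hv (u n) (u' n)).
  by apply: cvgM; exact: cvg_completion_av.
- move=> x y; have [u ->] := cpiP x; have [u' ->] := cpiP y.
  have h2 : (fun n : nat => v (u n) + v (u' n)) @ \oo --> completion_av (cpi u) + completion_av (cpi u').
    by apply: cvgD; exact: cvg_completion_av.
  have h1 := @cvg_completion_av (u + u').
  rewrite -(rmorphD cpi u u'); apply: (@ler_cvg_to nat \oo _ R _ _ _ _ h1 h2).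
  by apply: nearW => n; exact: (avD hv (u n) (u' n)).
Qed.

Definition cauchy_cst (x : K) : cauchy_ring := insubd 0 (fun=> x).

Lemma cauchy_cstE x n : cauchy_cst x n = x.
Proof.
rewrite /cauchy_cst val_insubd ifT//; apply/cauchy_seqP.
by apply: (av_cvg_cauchy hv); exact: (av_cvg_cst hv x).
Qed.

Definition completion_in (x : K) : completion := cpi (cauchy_cst x).

Lemma completion_in_zmod : zmod_morphism completion_in.
Proof.
move=> x y; rewrite /completion_in -rmorphB; congr cpi; apply/val_inj/funext => n.
by rewrite -[RHS]/(cauchy_cst x n - cauchy_cst y n) /= !cauchy_cstE.
Qed.

Lemma completion_in_monoid : monoid_morphism completion_in.
Proof.
split=> [|x y]; rewrite /completion_in -?(rmorph1 cpi) -?rmorphM; congr cpi; apply/val_inj/funext => n.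
  by rewrite /= cauchy_cstE.
by rewrite -[RHS]/(cauchy_cst x n * cauchy_cst y n) /= !cauchy_cstE.
Qed.

HB.instance Definition _ := GRing.isZmodMorphism.Build K completion completion_in completion_in_zmod.
HB.instance Definition _ := GRing.isMonoidMorphism.Build K completion completion_in completion_in_monoid.

Lemma completion_av_in x : completion_av (completion_in x) = v x.
Proof.
rewrite completion_avE; apply/cvg_lim => //.
by under eq_fun do rewrite cauchy_cstE; exact: cvg_cst.
Qed.

Lemma completion_dense (y : completion) (e : R) : 0 < e ->
  exists x, completion_av (y - completion_in x) < e.
Proof.
move=> e0; have [u ->] := cpiP y.
have e2 : 0 < e / 2 by rewrite divr_gt0.
have [n0 hn] := cauchy_ringP u e2.
exists (u n0); rewrite /completion_in -rmorphB completion_avE.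
rewrite (@le_lt_trans _ _ (e / 2)) ?ltr_pdivrMr ?ltr_pMr ?ltr1n//.
apply: limr_le; first exact: (av_cauchy_R hv (@cauchy_ringP _)).
exists n0 => // n /= hn0; change (v (u n - cauchy_cst (u n0) n) <= e / 2); rewrite cauchy_cstE.
by rewrite ltW// hn.
Qed.

Lemma completion_complete : av_complete completion_av.
Proof.
move=> y cy.
have [x hx] : {x : nat -> K & forall n, completion_av (y n - completion_in (x n)) < n.+1%:R^-1}.
  apply: (@choice _ _ (fun (n : nat) (x : K) => completion_av (y n - completion_in x) < n.+1%:R^-1)) => n.
  by apply: completion_dense; rewrite invr_gt0.
have wav := completion_is_av.
have h0 : av_cvg completion_av \oo (fun n => y n - completion_in (x n)) 0.
  apply: (av_cvg_le (y := harmonic)) => [n|]; last exact: cvg_harmonic.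
  by rewrite subr0 ltW.
have cx : av_cauchy v x.
  apply/(av_cauchy_morph completion_av_in) => e e0.
  have e3 : 0 < e / 3 by rewrite divr_gt0.
  have [n0 hn0] := cy _ e3; have [n1 _ hn1] := h0 _ e3.
  exists (maxn n0 n1) => k m; rewrite !geq_max => /andP[m1 m2] /andP[n1' n2'].
  have := hn1 _ m2; have := hn1 _ n2'; rewrite /= !subr0 => a1 a2.
  rewrite (_ : _ - _ = (y k - y m) - (y k - completion_in (x k)) + (y m - completion_in (x m))); last by ring.
  have := hn0 _ _ m1 n1'.
  have := avD wav (y k - y m - (y k - completion_in (x k))) (y m - completion_in (x m)).
  have := avB wav (y k - y m) (y k - completion_in (x k)); lra.
have xin : x \in cauchy_seq hv by apply/cauchy_seqP.
exists (cpi (CauchyRing xin)).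
have h1 : av_cvg completion_av \oo (fun n => completion_in (x n)) (cpi (CauchyRing xin)).
  move=> e e0; have e2 : 0 < e / 2 by rewrite divr_gt0.
  have [n0 hn] := cx _ e2; exists n0 => // n /= hn0.
  rewrite /completion_in -rmorphB completion_avE.
  rewrite (@le_lt_trans _ _ (e / 2)) ?ltr_pdivrMr ?ltr_pMr ?ltr1n//.
  apply: limr_le; first exact: (av_cauchy_R hv (@cauchy_ringP _)).
  exists n0 => // m /= hm0; change (v (cauchy_cst (x n) m - x m) <= e / 2); rewrite cauchy_cstE.
  by rewrite ltW// hn.
rewrite -[cpi _]add0r (_ : y = fun n => y n - completion_in (x n) + completion_in (x n)).
  exact: (av_cvgD wav h0 h1).
by apply/funext => n; rewrite subrK.
Qed.

End Completion.

Lemma exists_completion (R : realType) (K : fieldType) (v : K -> R) : is_absolute_value v ->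
  exists (L : fieldType) (w : L -> R) (i : {rmorphism K -> L}),
    [/\ is_absolute_value w, forall x, w (i x) = v x,
        forall y e, 0 < e -> exists x, w (y - i x) < e & av_complete w].
Proof.
move=> hv; exists (completion hv), (@completion_av _ _ _ hv), (@completion_in _ _ _ hv); split.
- exact: completion_is_av.
- exact: completion_av_in.
- exact: completion_dense.
- exact: completion_complete.
Qed.

(** * Absolute values of the rationals *)

Section RationalPlaces.
Variable R : realType.

Definition real_abs (q : rat) : R := ratr `|q|.

Lemma real_abs_is_av : is_absolute_value real_abs.
Proof.
split=> [x|x|x y|x y]; rewrite /real_abs.
- by rewrite ler0q.
- by split=> [/eqP|->]; rewrite ?normr0 ?rmorph0// fmorph_eq0 normr_eq0 => /eqP.
- by rewrite normrM rmorphM.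
- by rewrite -rmorphD ler_rat ler_normD.
Qed.

Lemma real_abs_totally_bounded (M e : R) : 0 < e ->
  exists s : seq rat, forall x, real_abs x <= M -> exists2 c, c \in s & real_abs (x - c) < e.
Proof.
move=> e0.
pose n := (Num.truncn e^-1).+1.
have nP : e^-1 < n%:R by rewrite truncnS_gt.
pose L := (Num.truncn (n%:R * M)).+1.
have LP : n%:R * M < L%:R by rewrite truncnS_gt.
exists [seq (j%:Z - L%:Z)%:~R / n%:R : rat | j <- iota 0 (L + L)] => x xM.
have n0 : (0 : rat) < n%:R by rewrite ltr0n.
pose z := Num.floor (x * n%:R).
have /andP[z1 z2] := floor_itv (x * n%:R).
have xb : `|x| * n%:R < L%:R :> rat.
  rewrite -(ltr_rat R) !rmorphM /= !rmorph_nat mulrC (le_lt_trans _ LP)//.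
  by rewrite ler_wpM2l.
have /andP[xb1 xb2] : - L%:R < x * n%:R < L%:R.
  by rewrite -ltr_norml normrM [`|n%:R|]ger0_norm ?ler0n.
have zb1 : - L%:Z < z + 1.
  by rewrite -(ltr_int rat) rmorphN /= (lt_trans xb1).
have zb2 : z < L%:Z by rewrite -(ltr_int rat) (le_lt_trans z1).
exists (z%:~R / n%:R).
  apply/mapP; exists `|(z + L%:Z)%R|%N.
    rewrite mem_iota add0n /=; lia.
  by congr (_%:~R / _); lia.
apply: lt_trans (_ : n%:R^-1 < e); last by rewrite invf_plt// posrE ltr0n.
have -> : n%:R^-1 = ratr n%:R^-1 :> R by rewrite fmorphV rmorph_nat.
rewrite /real_abs ltr_rat.
rewrite -(ltr_pM2r n0) mulVf ?gt_eqF// -[X in _ * X](ger0_norm (ltW n0)) -normrM mulrBl.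
rewrite divfK ?gt_eqF// ger0_norm ?subr_ge0// ltrBlDl.
by rewrite rmorphD in z2.
Qed.

Section Padic.
Variable p : nat.
Hypothesis pp : prime p.

Let p1 : (1 : R) < p%:R. Proof. by rewrite ltr1n prime_gt1. Qed.
Let p0 : (p%:R : R) != 0. Proof. by rewrite pnatr_eq0 -lt0n prime_gt0. Qed.

Lemma padic_abs_frac (a b : int) : a != 0 -> b != 0 ->
  padic_abs R p (a%:~R / b%:~R) = p%:R ^ ((logn p `|b|)%:Z - (logn p `|a|)%:Z).
Proof.
move=> a0 b0; set q : rat := _ / _.
have q0 : q != 0 by rewrite mulf_neq0// ?invr_eq0 intr_eq0.
rewrite /padic_abs (negPf q0); congr (_ ^ _).
have E : numq q * b = a * denq q.
  apply/eqP; rewrite -(eqr_int rat) !rmorphM /= -eqr_div ?intr_eq0 ?denq_eq0//.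
  by rewrite divq_num_den.
have {}E : (`|numq q| * `|b| = `|a| * `|denq q|)%N by rewrite -!abszM E.
have n0 : numq q != 0 by rewrite numq_eq0.
have := congr1 (logn p) E; rewrite !lognM ?absz_gt0 ?denq_eq0//.
lia.
Qed.

Lemma rat_fracP (q : rat) : q != 0 ->
  exists a b : int, [/\ a != 0, b != 0 & q = a%:~R / b%:~R].
Proof.
move=> q0; exists (numq q), (denq q); split; rewrite ?numq_eq0 ?denq_eq0//.
by rewrite divq_num_den.
Qed.

Lemma padic_abs_ge0 q : 0 <= padic_abs R p q.
Proof. by rewrite /padic_abs; case: ifP => // _; rewrite exprz_ge0. Qed.

Lemma padic_abs0 : padic_abs R p 0 = 0. Proof. by rewrite /padic_abs eqxx. Qed.

Lemma padic_absM x y : padic_abs R p (x * y) = padic_abs R p x * padic_abs R p y.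
Proof.
have [->|x0] := eqVneq x 0; first by rewrite mul0r padic_abs0 mul0r.
have [->|y0] := eqVneq y 0; first by rewrite mulr0 padic_abs0 mulr0.
have [a [b [a0 b0 ->]]] := rat_fracP x0; have [c [d [c0 d0 ->]]] := rat_fracP y0.
rewrite mulf_div -!rmorphM /= !padic_abs_frac ?mulf_neq0// -expfzDr//.
by congr (_ ^ _); rewrite !abszM !lognM ?absz_gt0//; lia.
Qed.

Lemma padic_abs_le (a b : int) k : b != 0 -> (p ^ k %| `|a|)%N ->
  padic_abs R p (a%:~R / b%:~R) <= p%:R ^ ((logn p `|b|)%:Z - k%:Z).
Proof.
move=> b0 h; have [->|a0] := eqVneq a 0.
  by rewrite mul0r padic_abs0 exprz_ge0.
rewrite padic_abs_frac//; apply: ler_weXz2l; first exact: ltW.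
have : (k <= logn p `|a|)%N by rewrite -pfactor_dvdn// absz_gt0.
lia.
Qed.

Lemma padic_abs_ultra x y :
  padic_abs R p (x + y) <= Num.max (padic_abs R p x) (padic_abs R p y).
Proof.
have [->|x0] := eqVneq x 0; first by rewrite add0r le_max lexx orbT.
have [->|y0] := eqVneq y 0; first by rewrite addr0 le_max lexx.
have [a [b [a0 b0 ->]]] := rat_fracP x0; have [c [d [c0 d0 ->]]] := rat_fracP y0.
rewrite addf_div ?intr_eq0// -!rmorphM -rmorphD /=.
pose k := minn (logn p `|(a * d)%R|) (logn p `|(c * b)%R|).
have bd0 : b * d != 0 by rewrite mulf_neq0.
apply: le_trans (padic_abs_le (k := k) bd0 _) _.
  have h1 : (p ^ k %| `|(a * d)%R|)%N by rewrite pfactor_dvdn// ?absz_gt0 ?mulf_neq0// geq_minl.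
  have h2 : (p ^ k %| `|(c * b)%R|)%N by rewrite pfactor_dvdn// ?absz_gt0 ?mulf_neq0// geq_minr.
  have : ((p ^ k)%N%:Z %| a * d + c * b)%Z by apply: rpredD.
  by [].
rewrite !padic_abs_frac// le_max /k; case: (leqP (logn p `|(a * d)%R|) (logn p `|(c * b)%R|)) => h.
  by rewrite (_ : _ - _ = (logn p `|b|)%:Z - (logn p `|a|)%:Z) ?lexx//;
    rewrite !abszM !lognM ?absz_gt0//; lia.
by rewrite (_ : _ - _ = (logn p `|d|)%:Z - (logn p `|c|)%:Z) ?lexx ?orbT//;
    rewrite !abszM !lognM ?absz_gt0//; lia.
Qed.

Lemma padic_abs_is_av : is_absolute_value (@padic_abs R p).
Proof.
split=> [x|x|x y|x y].
- exact: padic_abs_ge0.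
- split=> [|->]; last exact: padic_abs0.
  by rewrite /padic_abs; case: eqVneq => // _ /eqP; rewrite expfz_eq0 (negPf p0) andbF.
- exact: padic_absM.
- rewrite (le_trans (padic_abs_ultra _ _))// ge_max.
  by rewrite lerDl lerDr !padic_abs_ge0.
Qed.

Lemma padic_abs_natr_pexp (k : nat) : padic_abs R p (p%:R ^+ k) = p%:R ^- k.
Proof.
have -> : (p%:R ^+ k : rat) = ((p ^ k)%N%:Z)%:~R / 1%:~R by rewrite divr1 -pmulrn natrX.
rewrite padic_abs_frac// ?pnatr_eq0.
  by rewrite logn1 absz_nat pfactorK// sub0r -exprnN.
by rewrite eqz_nat expn_eq0 negb_and -lt0n prime_gt0.
Qed.

Lemma padic_abs_totally_bounded (M e : R) : 0 < e ->
  exists s : seq rat, forall x, padic_abs R p x <= M ->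
    exists2 c, c \in s & padic_abs R p (x - c) < e.
Proof.
move=> e0.
have pow (B : R) : exists k, B < p%:R ^+ k.
  have [k hk] : exists k, B < k%:R by exists (Num.truncn B).+1; rewrite truncnS_gt.
  exists k; apply: (lt_trans hk); rewrite -natrX ltr_nat.
  by rewrite ltn_expl// prime_gt1.
have [k hk] := pow M; have [m hm] := pow e^-1.
exists [seq j%:R / p%:R ^+ k | j <- iota 0 (p ^ (m + k))] => x xM.
pose z := x * p%:R ^+ k.
have zle : padic_abs R p z <= 1.
  rewrite /z padic_absM padic_abs_natr_pexp ler_pdivrMr ?mul1r ?exprn_gt0//.
    by rewrite (le_trans xM)// ltW.
  exact: lt_trans p1.
have pb : coprime p `|denq z|.
  rewrite prime_coprime//; apply/negP => pd.
  have z0 : z != 0 by apply: contraL pd => /eqP ->; rewrite dvdn1 gtn_eqF// prime_gt1.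
  have lb : (0 < logn p `|denq z|)%N by rewrite -pfactor_dvdn ?expn1// absz_gt0 denq_eq0.
  have la : (0 < logn p `|numq z|)%N.
    move: zle; rewrite /padic_abs (negPf z0) -(expr0z (p%:R : R)) ler_eXz2l//; lia.
  have pn : (p %| `|numq z|)%N by rewrite -[p]expn1 pfactor_dvdn// absz_gt0 numq_eq0.
  have : (p %| gcdn `|numq z| `|denq z|)%N by rewrite dvdn_gcd pn pd.
  by rewrite (eqP (coprime_num_den z)) dvdn1 gtn_eqF// prime_gt1.
pose P := (p ^ (m + k))%N.
have P0 : (0 < P)%N by rewrite expn_gt0 prime_gt0.
have [c [cb hc]] : exists c : nat, (c < P)%N /\ (P %| `|(numq z - c%:Z * denq z)%R|)%N.
  have [u [w E]] := Bezoutz (denq z) P%:Z.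
  have {}E : u * denq z + w * P%:Z = 1.
    rewrite E /gcdz /= (_ : gcdn _ _ = 1%N)//; apply/eqP.
    by rewrite -/(coprime _ _) coprime_sym coprimeXl.
  have PZ : P%:Z != 0 by rewrite eqz_nat -lt0n.
  exists `|(numq z * u %% P%:Z)%Z|%N; split.
    by have := ltz_mod (numq z * u) PZ; have := modz_ge0 (numq z * u) PZ; lia.
  have -> : numq z - `|(numq z * u %% P%:Z)%Z|%N%:Z * denq z =
     (numq z * w + (numq z * u %/ P%:Z)%Z * denq z) * P%:Z.
    rewrite gez0_abs ?modz_ge0//.
    have -> : (numq z * u %% P%:Z)%Z = numq z * u - (numq z * u %/ P%:Z)%Z * P%:Z.
      by rewrite {2}(divz_eq (numq z * u) P%:Z); ring.
    by rewrite -{1}[numq z]mulr1 -E; ring.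
  by rewrite abszM dvdn_mull.
exists (c%:R / p%:R ^+ k).
  by apply/mapP; exists c => //; rewrite mem_iota add0n.
have ppos n : (0 : R) < p%:R ^+ n by rewrite exprn_gt0// (lt_trans _ p1).
have pk0 : p%:R ^+ k != 0 :> rat by rewrite expf_neq0// pnatr_eq0 -lt0n prime_gt0.
have -> : x - c%:R / p%:R ^+ k = (numq z - c%:Z * denq z)%:~R / (denq z)%:~R * (p%:R ^+ k)^-1.
  rewrite rmorphB rmorphM /= mulrBl mulfK ?intr_eq0 ?denq_eq0// divq_num_den.
  by rewrite mulrBl /z mulfK// -pmulrn.
rewrite padic_absM (avV padic_abs_is_av) padic_abs_natr_pexp invrK.
apply: (@le_lt_trans _ _ (p%:R ^- m)); last first.
  by rewrite invf_plt ?posrE// ppos.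
rewrite -ler_pdivlMr// -invfM -exprD; apply: le_trans (padic_abs_le (k := m + k) (negbT (denq_eq0 z)) hc) _.
by rewrite logn_coprime// sub0r -exprnN.
Qed.

End Padic.

Lemma ln_exprz (x : R) (z : int) : 0 < x -> ln (x ^ z) = z%:~R * ln x.
Proof.
move=> x0; case: z => n.
  by rewrite -exprnP lnXn// -pmulrn mulr_natl.
by rewrite NegzE -exprnN lnV ?posrE ?exprn_gt0// lnXn// rmorphN /= mulNr -pmulrn mulr_natl.
Qed.

Lemma ln_natr_primes n (S : seq nat) : (0 < n)%N -> uniq S -> {subset primes n <= S} ->
  ln (n%:R : R) = \sum_(p <- S) (logn p n)%:R * ln p%:R.
Proof.
move=> n0 uS sS.
have -> : \sum_(p <- S) (logn p n)%:R * ln p%:R = \sum_(p <- primes n) (logn p n)%:R * ln (p%:R : R).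
  rewrite [LHS](bigID (mem (primes n))) /= [X in _ + X]big1 ?addr0; last first.
    by move=> p; rewrite -logn_gt0 lt0n negbK => /eqP ->; rewrite mul0r.
  rewrite -big_filter; apply: perm_big; apply: uniq_perm; rewrite ?filter_uniq ?primes_uniq//.
  by move=> p; rewrite mem_filter; case: (boolP (p \in primes n)) => //= /sS.
rewrite {1}(prod_prime_decomp n0) prime_decompE big_map /=.
have : all prime (primes n) by apply/allP => p; rewrite mem_primes => /andP[].
elim: (primes n) => [|p s IH] /=; first by rewrite !big_nil ln1.
move=> /andP[pp /[dup] sp /IH {}IH]; rewrite !big_cons natrM lnM ?posrE ?ltr0n.
- by rewrite IH natrX lnXn ?ltr0n ?prime_gt0// mulr_natl.
- by rewrite expn_gt0 prime_gt0.
- rewrite big_seq; elim/big_rec : _ => // q y qs ?; rewrite muln_gt0 expn_gt0 prime_gt0//.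
  exact: (allP sp).
Qed.

Lemma rat_product_formula (q : rat) (S : seq nat) : q != 0 -> uniq S -> all prime S ->
  {subset primes `|numq q| <= S} -> {subset primes `|denq q| <= S} ->
  ln (real_abs q) + \sum_(p <- S) ln (padic_abs R p q) = 0.
Proof.
move=> q0 uS pS s1 s2.
have n0 : (0 < `|numq q|)%N by rewrite absz_gt0 numq_eq0.
have d0 : (0 < `|denq q|)%N by rewrite absz_gt0 denq_eq0.
have -> : real_abs q = `|numq q|%N%:R / `|denq q|%N%:R.
  rewrite /real_abs -{1}[q]divq_num_den normf_div fmorph_div -!intr_norm /= !ratr_int.
  by rewrite -!abszE -!pmulrn.
rewrite ln_div ?posrE ?ltr0n// (ln_natr_primes n0 uS s1) (ln_natr_primes d0 uS s2).
rewrite -sumrB -big_split /= big1_seq// => p /andP[_ /(allP pS) pp].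
rewrite /padic_abs (negPf q0) ln_exprz ?ltr0n ?prime_gt0// rmorphB /= -!pmulrn; ring.
Qed.

End RationalPlaces.

(** * Norms of residues modulo a polynomial *)

Section PolyNorm.
Variable F : fieldType.
Implicit Types f g h : {poly F}.

Definition mulmod n g h (u : 'rV[F]_n) : 'rV[F]_n := poly_rV ((rVpoly u * h) %% g).

Lemma mulmod_is_linear n g h : linear (@mulmod n g h).
Proof.
by move=> a u w; rewrite /mulmod linearP /= mulrDl -scalerAl modpD modpZl linearP.
Qed.

HB.instance Definition _ n g h := GRing.isLinear.Build F 'rV[F]_n 'rV[F]_n *:%R
  (@mulmod n g h) (@mulmod_is_linear n g h).

Definition mulmod_mx n g h : 'M[F]_n := lin1_mx (@mulmod n g h).

(* The norm of [h] from [F[X] / g] to [F] when [n] is the degree of [g]. *)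
Definition polynorm n g h : F := \det (mulmod_mx n g h).

Section Degree.
Variables (n : nat) (g : {poly F}).
Hypothesis gn : size g = n.+1.

Let g0 : g != 0. Proof. by rewrite -size_poly_gt0 gn. Qed.

Lemma size_modp_le h : (size (h %% g)%R <= n)%N.
Proof. by rewrite -ltnS -gn ltn_modp. Qed.

Lemma rVpoly_mulmod h u : rVpoly (u *m mulmod_mx n g h) = (rVpoly u * h) %% g.
Proof. by rewrite mul_rV_lin1 /= /mulmod poly_rV_K// size_modp_le. Qed.

Lemma mulmod_mxE h i k : mulmod_mx n g h i k = (('X^i * h) %% g)`_k.
Proof.
by rewrite !mxE /= rVpoly_delta.
Qed.

Lemma rV_mx_inj m (A B : 'M[F]_(m, n)) : (forall u, rVpoly (u *m A) = rVpoly (u *m B)) -> A = B.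
Proof.
move=> h; apply/row_matrixP => i; rewrite !rowE.
by apply: (can_inj rVpolyK); exact: h.
Qed.

Lemma mulmod_mxM h h' : mulmod_mx n g (h * h') = mulmod_mx n g h *m mulmod_mx n g h'.
Proof.
apply: rV_mx_inj => u; rewrite mulmxA !rVpoly_mulmod mulrA.
by rewrite [X in _ = X %% _]mulrC modp_mul [in RHS]mulrC.
Qed.

Lemma polynormM h h' : polynorm n g (h * h') = polynorm n g h * polynorm n g h'.
Proof. by rewrite /polynorm mulmod_mxM det_mulmx. Qed.

Lemma mulmod_mx_mod h : mulmod_mx n g (h %% g) = mulmod_mx n g h.
Proof. by apply: rV_mx_inj => u; rewrite !rVpoly_mulmod modp_mul. Qed.

Lemma polynorm_mod h : polynorm n g (h %% g) = polynorm n g h.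
Proof. by rewrite /polynorm mulmod_mx_mod. Qed.

Lemma polynormC c : polynorm n g c%:P = c ^+ n.
Proof.
rewrite /polynorm (_ : mulmod_mx n g c%:P = c%:M) ?det_scalar//.
apply: rV_mx_inj => u; rewrite rVpoly_mulmod mul_mx_scalar linearZ /=.
by rewrite mulrC mul_polyC modp_small// gn ltnS (leq_trans (size_scale_leq _ _))// size_poly.
Qed.

Lemma polynorm1 : polynorm n g 1 = 1.
Proof. by rewrite polynormC expr1n. Qed.

Lemma polynorm_coprime h : coprimep g h -> polynorm n g h != 0.
Proof.
move=> /Bezout_eq1_coprimepP [[u w] /= E].
have : polynorm n g (w * h) = 1.
  by rewrite -polynorm1 -[in RHS]E -[RHS]polynorm_mod modpD modp_mull add0r polynorm_mod.
rewrite polynormM => H; apply: contra_eq_neq H => ->.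
by rewrite mulr0 eq_sym oner_neq0.
Qed.

Lemma polynorm_dvd h : (0 < n)%N -> g %| h -> polynorm n g h = 0.
Proof.
move=> n0 gh; rewrite /polynorm (_ : mulmod_mx _ _ _ = 0).
  by rewrite -(scale0r 1%:M) detZ expr0n gtn_eqF// mul0r.
apply: rV_mx_inj => u; rewrite rVpoly_mulmod mulmx0 linear0.
by apply/eqP; rewrite -/(g %| _) dvdp_mull.
Qed.

End Degree.

(* In the coordinates (a, b) of a + f b, with a of degree less than m, the     *)
(* multiplication by h modulo f g is block triangular.                         *)
Lemma polynorm_mulmod m n f g h : size f = m.+1 -> size g = n.+1 ->
  polynorm (m + n) (f * g) h = polynorm m f h * polynorm n g h.
Proof.
move=> fm gn.
have f0 : f != 0 by rewrite -size_poly_gt0 fm.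
have g0 : g != 0 by rewrite -size_poly_gt0 gn.
have fgn : size (f * g) = (m + n).+1 by rewrite size_mul// fm gn addSn addnS.
pose B (u : 'rV[F]_(m + n)) : 'rV[F]_(m + n) :=
  poly_rV (rVpoly (lsubmx u) + f * rVpoly (rsubmx u)).
have Blin : linear B.
  move=> a u w; rewrite /B -linearP; congr poly_rV.
  by rewrite !linearP /= mulrDr scalerDr -scalerAr addrACA.
pose B' (u : 'rV[F]_(m + n)) : 'rV[F]_(m + n) :=
  row_mx (poly_rV (rVpoly u %% f)) (poly_rV (rVpoly u %/ f)).
have B'lin : linear B'.
  move=> a u w; rewrite /B' !linearP /= modpD divpD modpZl divpZl !linearP /=.
  by rewrite scale_row_mx add_row_mx.
pose Bl := HB.pack_for {linear 'rV[F]_(m + n) -> 'rV[F]_(m + n)} B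
  (GRing.isLinear.Build _ _ _ _ B Blin).
pose B'l := HB.pack_for {linear 'rV[F]_(m + n) -> 'rV[F]_(m + n)} B'
  (GRing.isLinear.Build _ _ _ _ B' B'lin).
pose P := lin1_mx Bl; pose P' := lin1_mx B'l.
have PE u : rVpoly (u *m P) = rVpoly (lsubmx u) + f * rVpoly (rsubmx u).
  rewrite mul_rV_lin1 /= /B poly_rV_K// (leq_trans (size_polyD _ _))// geq_max.
  rewrite (leq_trans (size_poly _ _)) ?leq_addr//=.
  rewrite (leq_trans (size_polyMleq _ _))// fm addSn /= leq_add2l.
  exact: size_poly.
have P'E u : u *m P' = row_mx (poly_rV (rVpoly u %% f)) (poly_rV (rVpoly u %/ f)).
  by rewrite mul_rV_lin1.
have szu k (u : 'rV[F]_k) : (size (rVpoly u) <= k)%N by exact: size_poly.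
have PP' : P *m P' = 1%:M.
  apply: rV_mx_inj => u; rewrite mulmxA P'E PE mulmx1; congr rVpoly.
  have lt : (size (rVpoly (lsubmx u)) < size f)%N by rewrite fm ltnS szu.
  rewrite modpD mulrC modp_mull addr0 modp_small// divpD divp_small// add0r mulpK//.
  by rewrite !rVpolyK hsubmxK.
pose q (u : 'rV[F]_m) : 'rV[F]_n := poly_rV (((rVpoly u * h) %/ f) %% g).
have qlin : linear q.
  move=> a u w; rewrite /q linearP /= mulrDl -scalerAl divpD divpZl modpD modpZl.
  by rewrite linearP.
pose ql := HB.pack_for {linear 'rV[F]_m -> 'rV[F]_n} q (GRing.isLinear.Build _ _ _ _ q qlin).
have qE u : u *m lin1_mx q = q u by exact: (mul_rV_lin1 ql).
pose D : 'M[F]_(m + n) := block_mx (mulmod_mx m f h) (lin1_mx ql) 0 (mulmod_mx n g h).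
have key : P *m mulmod_mx (m + n) (f * g) h = D *m P.
  apply: rV_mx_inj => u; rewrite !mulmxA (rVpoly_mulmod fgn) !PE.
  rewrite -{3 4}[u]hsubmxK mul_row_block mulmx0 addr0 row_mxKl row_mxKr.
  rewrite linearD /= !rVpoly_mulmod//.
  rewrite qE /q poly_rV_K ?(size_modp_le gn)//.
  set a := rVpoly _; set b := rVpoly _.
  rewrite -modpD; set t := (_ + b * h).
  apply/esym/(@modpP _ _ (t %/ g)).
    rewrite mulrDl {1}(divp_eq (a * h) f) -mulrA -/b.
    have {1}-> : b * h = t - (a * h) %/ f by rewrite /t addrC addKr.
    by rewrite {1}(divp_eq t g); ring.
  rewrite fgn ltnS (leq_trans (size_polyD _ _))// geq_max.
  rewrite (leq_trans (size_modp_le fm _)) ?leq_addr//=.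
  rewrite (leq_trans (size_polyMleq _ _))// fm addSn /= leq_add2l.
  exact: size_modp_le.
have dP : \det P != 0.
  move/(congr1 determinant): PP'; rewrite det_mulmx det1 => H; apply: contra_eq_neq H => ->.
  by rewrite mul0r eq_sym oner_neq0.
by move/(congr1 determinant): key; rewrite !det_mulmx det_ublock mulrC => /(mulIf dP).
Qed.

End PolyNorm.

Lemma polynorm_map (F F' : fieldType) (j : {rmorphism F -> F'}) n (g h : {poly F}) :
  size g = n.+1 -> polynorm n (map_poly j g) (map_poly j h) = j (polynorm n g h).
Proof.
move=> gn; rewrite /polynorm -det_map_mx; congr (\det _); apply/matrixP => i k.
rewrite [RHS]mxE !mulmod_mxE ?size_map_poly//.
by rewrite -(map_polyXn j) -rmorphM -map_modp coef_map.
Qed.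

Lemma mulmod_mx_coefE (F : fieldType) n m (g h : {poly F}) i k :
  size g = n.+1 -> (size h <= m)%N ->
  mulmod_mx n g h i k = \sum_(j < m) h`_j * (('X^i * 'X^j) %% g)`_k.
Proof.
move=> gn hm; rewrite mulmod_mxE// {1}(_ : h = \sum_(j < m) h`_j *: 'X^j).
  rewrite mulr_sumr (big_morph (fun p => p %% g) (modpD g) (mod0p g)).
  by rewrite coef_sum; apply: eq_bigr => j _; rewrite -scalerAr modpZl coefZ.
by rewrite -poly_def; apply/polyP => j; rewrite coef_poly; case: ltnP => // /(leq_trans hm)/leq_sizeP ->.
Qed.

Lemma polynorm_cvg (R : realType) (F : fieldType) (v : F -> R) (hv : is_absolute_value v)
    (T : Type) (G : set_system T) (PG : ProperFilter G)
    n m (g : {poly F}) (h : T -> {poly F}) (l : {poly F}) :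
  size g = n.+1 -> (forall t, (size (h t) <= m)%N) -> (size l <= m)%N ->
  (forall j, av_cvg v G (fun t => (h t)`_j) l`_j) ->
  av_cvg v G (fun t => polynorm n g (h t)) (polynorm n g l).
Proof.
move=> gn hm lm hl; apply: (av_cvg_det hv) => i k.
under eq_fun do rewrite (mulmod_mx_coefE _ _ gn (hm _)).
rewrite (mulmod_mx_coefE _ _ gn lm); apply: (av_cvg_sum hv) => j _.
by apply: (av_cvgM hv) => //; exact: (av_cvg_cst hv).
Qed.

Section PowerTrick.
Variable R : realType.

Lemma bernoulli_ineq (s : R) n : 0 <= s -> 1 + s *+ n <= (1 + s) ^+ n.
Proof.
move=> s0; elim: n => [|n IH]; first by rewrite mulr0n addr0 expr0.
rewrite exprS (le_trans _ (ler_wpM2l _ IH))// ?addr_ge0// mulrDl mul1r mulrDr mulr1.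
rewrite mulrSr addrA lerD2l lerDl mulr_ge0// mulrn_wge0//.
Qed.

Lemma pow_bound_le (a b C : R) : 0 <= a -> 0 <= b ->
  (forall k, a ^+ k <= C * k.+1%:R * b ^+ k) -> a <= b.
Proof.
move=> a0 b0 h; rewrite leNgt; apply/negP => ba.
have [b00|bn0] := eqVneq b 0.
  by have := h 1; rewrite !expr1 b00 mulr0 leNgt -b00 ba.
have bp : 0 < b by rewrite lt0r bn0.
pose s := a / b - 1.
have s0 : 0 < s by rewrite subr_gt0 ltr_pdivlMr// mul1r.
have hk k : (1 + s) ^+ k <= C * k.+1%:R.
  rewrite addrC subrK exprMn exprVn ler_pdivrMr ?exprn_gt0//.
have C0 : 1 <= C by have := h 0; rewrite !expr0 !mulr1.
pose m := (Num.truncn (3 * C / (s * s))).+1.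
have mP : 3 * C / (s * s) < m%:R by rewrite truncnS_gt.
have m1 : (1 : R) <= m%:R by rewrite ler1n.
have h1 : (m%:R * s) ^+ 2 <= C * (3 * m%:R).
  have : (1 + s) ^+ (m * 2) <= C * (3 * m%:R).
    apply: (le_trans (hk _)); rewrite ler_wpM2l//; first by rewrite (le_trans ler01).
    by rewrite -natrM ler_nat; lia.
  have ms0 : 0 <= m%:R * s by rewrite mulr_ge0// ltW.
  have hs : m%:R * s <= (1 + s) ^+ m.
    by rewrite (le_trans _ (bernoulli_ineq m (ltW s0)))// mulr_natl lerDr.
  by apply: le_trans; rewrite exprM lerXn2r// nnegrE (le_trans ms0 hs).
have : m%:R * (s * s) <= 3 * C.
  rewrite -(ler_pM2l (lt_le_trans ltr01 m1)).
  have -> : m%:R * (m%:R * (s * s)) = (m%:R * s) ^+ 2 by ring.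
  by rewrite (le_trans h1)// le_eqVlt; apply/orP; left; apply/eqP; ring.
rewrite -ler_pdivlMr ?mulr_gt0// leNgt mP //.
Qed.

Lemma av_ultrametric (K : fieldType) (v : K -> R) : is_absolute_value v ->
  (forall m, v m%:R <= 1) -> forall x y, v (x + y) <= Num.max (v x) (v y).
Proof.
move=> hv v1 x y; set M := Num.max _ _.
have M0 : 0 <= M by rewrite le_max (av_ge0 hv).
apply: (@pow_bound_le _ _ 1) => [||k]; rewrite ?(av_ge0 hv)//.
rewrite -(avX hv) exprDn (le_trans (av_sum hv _ _ _))// mul1r.
rewrite -[X in X%:R](card_ord k.+1) mulr_natl -sumr_const; apply: ler_sum => i _.
rewrite -mulr_natl !(avM hv) !(avX hv) -[leRHS]mul1r.
apply: ler_pM; rewrite ?mulr_ge0 ?exprn_ge0 ?(av_ge0 hv)//.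
have ik : (i <= k)%N by rewrite -ltnS.
rewrite -[X in M ^+ X](subnK ik) exprD.
by apply: ler_pM; rewrite ?exprn_ge0 ?(av_ge0 hv)// lerXn2r ?nnegrE ?(av_ge0 hv)// le_max lexx ?orbT.
Qed.

End PowerTrick.

(** * Extensions of locally compact fields *)

Section LocalField.
Variables (R : realType) (F : fieldType) (nF : F -> R).
Hypotheses (hF : is_absolute_value nF) (cF : av_complete nF).
Hypothesis tbF : forall M e : R, 0 < e ->
  exists s : seq F, forall x, nF x <= M -> exists2 c, c \in s & nF (x - c) < e.

Lemma ultra_seq_cover (U : set_system nat) (T : eqType) (s : seq T) (P : T -> nat -> Prop) :
  UltraFilter U -> (forall k, exists2 c, c \in s & P c k) -> exists2 c, c \in s & U (P c).
Proof.
move=> uU.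
suff H : U [set k | exists2 c, c \in s & P c k] -> exists2 c, c \in s & U (P c).
  by move=> h; apply: H; apply: filterE.
elim: s => [|c s IH] hU.
  by have [k [? ]] := filter_ex hU.
have [hc|hc] := in_ultra_setVsetC (P c) uU.
  by exists c; rewrite ?mem_head.
have [|c' c's Uc'] := IH; last by exists c' => //; rewrite inE c's orbT.
apply: filterS2 hU hc => k [c']; rewrite inE => /orP[/eqP ->//|c's] Pc' _.
by exists c'.
Qed.

Lemma ultra_limit (U : set_system nat) (x : nat -> F) M : UltraFilter U ->
  (forall k, nF (x k) <= M) -> exists l, av_cvg nF U x l.
Proof.
move=> uU xM.
have [c hc] : {c : nat -> F & forall m, U [set k | nF (x k - c m) < m.+1%:R^-1]}.
  apply: (@choice _ _ (fun (m : nat) (c : F) => U [set k | nF (x k - c) < m.+1%:R^-1])) => m.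
  have im : 0 < m.+1%:R^-1 :> R by rewrite invr_gt0.
  have [s hs] := tbF M im.
  have [c _ Uc] := ultra_seq_cover uU (fun k => hs _ (xM k)).
  by exists c.
have inv_small (e : R) : 0 < e -> exists n0, forall m, (n0 <= m)%N -> m.+1%:R^-1 < e.
  move=> e0; exists (Num.truncn e^-1) => m hm.
  by rewrite invf_plt ?posrE// (lt_le_trans (truncnS_gt _))// ler_nat ltnS.
have [l hl] : exists l, av_cvg nF \oo c l.
  apply: cF => e e0; have e2 : 0 < e / 2 by rewrite divr_gt0.
  have [n0 hn] := inv_small _ e2; exists n0 => m n hm hn'.
  have [k /= [h1 h2]] := filter_ex (filterI (hc m) (hc n)).
  rewrite (_ : c m - c n = (x k - c n) - (x k - c m)); last by ring.
  rewrite (le_lt_trans (avB hF _ _))// [ltRHS]splitr ltrD//.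
    exact: lt_trans h2 (hn _ hn').
  exact: lt_trans h1 (hn _ hm).
exists l => e e0; have e2 : 0 < e / 2 by rewrite divr_gt0.
have [n0 hn] := inv_small _ e2; have [n1 _ hn1] := hl _ e2.
have h1 := hn (maxn n0 n1) (leq_maxl _ _); have h2 := hn1 (maxn n0 n1) (leq_maxr _ _).
apply: filterS (hc (maxn n0 n1)) => k /= h3; rewrite /= in h2.
rewrite (_ : x k - l = (x k - c (maxn n0 n1)) + (c (maxn n0 n1) - l)); last by ring.
rewrite (le_lt_trans (avD hF _ _))// [ltRHS]splitr ltrD//.
exact: lt_trans h3 h1.
Qed.

Section Irreducible.
Variables (n : nat) (g : {poly F}).
Hypotheses (gn : size g = n.+1) (n0 : (0 < n)%N).

Definition polyav (h : {poly F}) : R := nF (polynorm n g h) `^ n%:R^-1.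

Lemma polyav_ge0 h : 0 <= polyav h. Proof. exact: powR_ge0. Qed.

Lemma polyavXn h : polyav h ^+ n = nF (polynorm n g h).
Proof.
rewrite -powR_mulrn ?polyav_ge0// -powRrM mulVf ?pnatr_eq0 -?lt0n//.
by rewrite powRr1// (av_ge0 hF).
Qed.

Lemma polyavM h h' : polyav (h * h') = polyav h * polyav h'.
Proof. by rewrite /polyav polynormM// (avM hF) powRM ?(av_ge0 hF). Qed.

Lemma polyav_mod h : polyav (h %% g) = polyav h.
Proof. by rewrite /polyav polynorm_mod. Qed.

Lemma polyavC c : polyav c%:P = nF c.
Proof.
by apply: (@pexpIrn _ n) => //; rewrite ?nnegrE ?polyav_ge0 ?(av_ge0 hF)// polyavXn polynormC// (avX hF).
Qed.

Lemma polyavX h k : polyav (h ^+ k) = polyav h ^+ k.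
Proof.
elim: k => [|k IH]; last by rewrite !exprS polyavM IH.
by rewrite !expr0 -[1]/(1%:P) polyavC (av1 hF).
Qed.

Definition coef_norm (h : {poly F}) : R := \sum_(j < n) nF (h %% g)`_j.

Lemma coef_norm_ge0 h : 0 <= coef_norm h.
Proof. by apply: sumr_ge0 => j _; exact: (av_ge0 hF). Qed.

Lemma coef_norm_sum (I : Type) (r : seq I) (f : I -> {poly F}) :
  coef_norm (\sum_(i <- r) f i) <= \sum_(i <- r) coef_norm (f i).
Proof.
elim/big_rec2 : _ => [|i y x _ h].
  by rewrite /coef_norm mod0p big1// => j _; rewrite coef0 (av0 hF).
apply: (@le_trans _ _ (coef_norm (f i) + coef_norm x)); last by rewrite lerD2l.
by rewrite -big_split; apply: ler_sum => j _; rewrite modpD coefD (avD hF).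
Qed.

Lemma coef_normZ c h : coef_norm (c *: h) = nF c * coef_norm h.
Proof. by rewrite mulr_sumr; apply: eq_bigr => j _; rewrite modpZl coefZ (avM hF). Qed.

Lemma polyav_le_coef_norm : exists2 C : R, 0 < C & forall h, polyav h <= C * coef_norm h.
Proof.
pose c (i j k : 'I_n) := (('X^i * 'X^j) %% g)`_k.
pose B := \sum_i \sum_j \sum_k nF (c i j k).
have cB i j k : nF (c i j k) <= B.
  rewrite /B (bigD1 i)//= (bigD1 j)//= (bigD1 k)//= -!addrA lerDl !addr_ge0//; do ?[apply: sumr_ge0 => *];
  by rewrite ?(av_ge0 hF)//; apply: sumr_ge0 => *; rewrite ?(av_ge0 hF)//; apply: sumr_ge0 => *; rewrite (av_ge0 hF).
have B0 : 0 <= B by do 3 (apply: sumr_ge0 => ? _); exact: (av_ge0 hF).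
have entry h i k : nF (mulmod_mx n g h i k) <= B * coef_norm h.
  rewrite -mulmod_mx_mod// (mulmod_mx_coefE _ _ gn (size_modp_le gn h)).
  rewrite (le_trans (av_sum hF _ _ _))// mulr_sumr; apply: ler_sum => j _.
  by rewrite (avM hF) mulrC ler_wpM2r ?(av_ge0 hF) ?cB.
pose D := \sum_(s : {perm 'I_n}) (1 : R).
have f1 : 1 <= D by rewrite /D (bigD1 (perm_one _))//= lerDl sumr_ge0.
have D0 : 0 < D := lt_le_trans ltr01 f1.
exists (D * (B + 1)) => [|h].
  by rewrite mulr_gt0// ltr_wpDl.
have f0 : 0 <= D * (B + 1) * coef_norm h.
  by rewrite !mulr_ge0 ?coef_norm_ge0 ?(ltW D0)// addr_ge0.
rewrite -(@ler_pXn2r _ n)// ?nnegrE ?polyav_ge0// polyavXn.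
rewrite /polynorm /determinant (le_trans (av_sum hF _ _ _))//.
apply: (@le_trans _ _ (\sum_(s : {perm 'I_n}) ((B + 1) * coef_norm h) ^+ n)).
  apply: ler_sum => s _; rewrite (avM hF) (avX hF) (avN hF) (av1 hF) expr1n mul1r.
  rewrite (av_prod hF) -[X in _ ^+ X](card_ord n) -prodr_const; apply: ler_prod => i _.
  rewrite (av_ge0 hF) (le_trans (entry _ _ _))// ler_wpM2r ?coef_norm_ge0//.
  by rewrite lerDl.
have -> : \sum_(s : {perm 'I_n}) ((B + 1) * coef_norm h) ^+ n = D * ((B + 1) * coef_norm h) ^+ n.
  by rewrite mulr_suml; apply: eq_bigr => s _; rewrite mul1r.
rewrite -mulrA [leRHS]exprMn.
rewrite ler_wpM2r ?exprn_ge0 ?mulr_ge0 ?coef_norm_ge0 ?addr_ge0//.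
by rewrite ler_eXnr.
Qed.

Hypothesis ig : irreducible_poly g.

Lemma polynorm_eq0 h : (polynorm n g h == 0) = (g %| h).
Proof.
apply/idP/idP => [|gh]; last by rewrite polynorm_dvd.
apply: contraLR; rewrite -irreducible_poly_coprime// => cgh.
by rewrite polynorm_coprime.
Qed.

(* Otherwise there are residues with coefficients bounded by 1, one of them    *)
(* equal to 1, and with norms tending to 0; their limit along an ultrafilter   *)
(* would be a nonzero residue of norm 0.                                       *)
Lemma coef_norm_le_polyav : exists2 C : R, 0 < C & forall h, coef_norm h <= C * polyav h.
Proof.
apply: contrapT => H.
have {}H (k : nat) : exists h, k.+1%:R * polyav h < coef_norm h.
  apply: contrapT => Hk; apply: H; exists k.+1%:R => // h.
  by rewrite leNgt; apply/negP => hh; apply: Hk; exists h.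
have {}H (k : nat) : exists r : {poly F}, [/\ (size r <= n)%N,
    forall j, nF r`_j <= 1, exists j : 'I_n, r`_j = 1 & polyav r <= n%:R / k.+1%:R].
  have [h hk] := H k; pose r := h %% g.
  have ninh : 'I_n by exact: (Ordinal n0).
  case: (@arg_maxP _ _ _ (Ordinal n0) xpredT (fun j : 'I_n => nF r`_j)) => // i _ hi.
  have cn : coef_norm h <= n%:R * nF r`_i.
    rewrite mulr_natl -[X in _ *+ X](card_ord n) -sumr_const; apply: ler_sum => j _.
    exact: hi.
  have ri : r`_i != 0.
    rewrite -(av_gt0 hF) ltNge; apply/negP => ri.
    have c0 : coef_norm h <= 0 by rewrite (le_trans cn)// mulr_ge0_le0.
    by have := lt_le_trans hk c0; rewrite ltNge mulr_ge0 ?polyav_ge0.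
  have rip : 0 < nF r`_i by rewrite (av_gt0 hF).
  exists ((r`_i)^-1 *: r); split.
  - by rewrite (leq_trans (size_scale_leq _ _)) ?size_modp_le.
  - move=> j; rewrite coefZ (avM hF) (avV hF) mulrC ler_pdivrMr// mul1r.
    have [jn|nj] := ltnP j n; first exact: (hi (Ordinal jn)).
    by rewrite nth_default ?(av0 hF) ?(av_ge0 hF)// (leq_trans (size_modp_le gn _)).
  - by exists i; rewrite coefZ mulVf.
  - rewrite -mul_polyC polyavM polyavC (avV hF) mulrC ler_pdivrMr// polyav_mod.
    rewrite -mulrA [_^-1 * _]mulrC mulrA ler_pdivlMr// mulrC.
    by rewrite (le_trans (ltW hk)).
have [r hr] := choice H.
have [U [uU ooU]] := ultraFilterLemma (_ : ProperFilter \oo).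
have [l hl] : {l : nat -> F & forall j, av_cvg nF U (fun k => (r k)`_j) (l j)}.
  apply: (@choice _ _ (fun (j : nat) (l : F) => av_cvg nF U (fun k => (r k)`_j) l)) => j.
  by apply: ultra_limit => k; have [_ + _ _] := hr k; exact.
pose L := \poly_(j < n) l j.
have LE j : L`_j = l j.
  rewrite coef_poly; case: ltnP => // nj.
  rewrite [in RHS](_ : l j = 0)//; apply: (av_cvg_unique hF (hl j)).
  rewrite (_ : (fun k => _) = fun=> 0); first exact: (av_cvg_cst hF).
  apply/funext => k; rewrite nth_default//.
  by have [rk _ _ _] := hr k; rewrite (leq_trans rk).
have c1 : av_cvg nF U (fun k => polynorm n g (r k)) (polynorm n g L).
  apply: (polynorm_cvg hF _ gn (m := n)) => [k||j]; first by have [] := hr k.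
    exact: size_poly.
  by rewrite LE.
have c2 : av_cvg nF U (fun k => polynorm n g (r k)) 0.
  move=> e e0; apply: ooU.
  pose e' := Num.min e 1.
  have e'0 : 0 < e' by rewrite lt_min e0 ltr01.
  exists (Num.truncn (n%:R / e')) => // k /= hk.
  have kx : n%:R / k.+1%:R < e'.
    rewrite ltr_pdivrMr// mulrC -ltr_pdivrMr// (lt_le_trans (truncnS_gt _))//.
    by rewrite ler_nat ltnS.
  have [_ _ _ rk] := hr k.
  rewrite subr0 -polyavXn (le_lt_trans (_ : _ <= (n%:R / k.+1%:R) ^+ n))//.
    by rewrite lerXn2r ?nnegrE ?polyav_ge0// (le_trans _ rk) ?polyav_ge0.
  rewrite (le_lt_trans (_ : _ <= n%:R / k.+1%:R))//.
    rewrite -[leRHS]expr1 ler_wiXn2l// ?divr_ge0//.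
    by rewrite (le_trans (ltW kx))// ge_min lexx orbT.
  by rewrite (lt_le_trans kx)// ge_min lexx.
have gL : g %| L by rewrite -polynorm_eq0 (av_cvg_unique hF c1 c2).
have L0 : L = 0.
  apply/eqP; apply: contraLR gL => L0; apply/negP => /(dvdp_leq L0).
  by rewrite gn leqNgt ltnS size_poly.
have c3 : av_cvg nF U (fun k => \prod_(j < n) ((r k)`_j - 1)) (\prod_(j < n) (L`_j - 1)).
  apply: (av_cvg_prod hF) => j _; apply: (av_cvgB hF); last exact: (av_cvg_cst hF).
  by rewrite LE.
have c4 : av_cvg nF U (fun k => \prod_(j < n) ((r k)`_j - 1)) 0.
  rewrite (_ : (fun k => _) = fun=> 0); first exact: (av_cvg_cst hF).
  apply/funext => k; have [_ _ [j rj] _] := hr k.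
  by apply/eqP/prodf_eq0; exists j => //; rewrite rj subrr.
have : \prod_(j < n) (L`_j - 1) == 0 by rewrite (av_cvg_unique hF c3 c4).
rewrite L0; under eq_bigr do rewrite coef0 sub0r.
by rewrite prodr_const expf_eq0 oppr_eq0 oner_eq0 andbF.
Qed.

Lemma polyavD h1 h2 : polyav (h1 + h2) <= polyav h1 + polyav h2.
Proof.
have [C1 C10 hC1] := polyav_le_coef_norm; have [C2 C20 hC2] := coef_norm_le_polyav.
apply: (@pow_bound_le _ _ _ (C1 * C2)) => [||k]; rewrite ?addr_ge0 ?polyav_ge0//.
apply: (@le_trans _ _ (C1 * C2 * (polyav h1 + polyav h2) ^+ k)); last first.
  rewrite ler_wpM2r ?exprn_ge0 ?addr_ge0 ?polyav_ge0// ler_peMr ?ler1n//.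
  by rewrite mulr_ge0 ?ltW.
rewrite -polyavX (le_trans (hC1 _))// -mulrA ler_pM2l// exprDn.
rewrite (le_trans (coef_norm_sum _ _))// exprDn mulr_sumr; apply: ler_sum => i _.
rewrite -scaler_nat coef_normZ -[X in C2 * X]mulr_natl (mulrCA C2).
apply: ler_pM; [exact: (av_ge0 hF)|exact: coef_norm_ge0|exact: (av_natr hF)|].
by rewrite (le_trans (hC2 _))// polyavM !polyavX.
Qed.

Lemma polyav_eq0 h : (polyav h == 0) = (g %| h).
Proof.
rewrite -polynorm_eq0 -(av_eq0 hF) -polyavXn expf_eq0.
by rewrite n0.
Qed.

Lemma polyav_unique (L : fieldType) (w : L -> R) (H : {rmorphism {poly F} -> L}) :
  is_absolute_value w -> (forall c, w (H c%:P) = nF c) -> H g = 0 ->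
  forall h, w (H h) = polyav h.
Proof.
move=> hw Hc Hg.
have Hmod h : H (h %% g) = H h.
  by rewrite {2}(divp_eq h g) rmorphD rmorphM Hg mulr0 add0r.
pose B := \sum_(j < n) w (H 'X) ^+ j.
have HB h : w (H h) <= B * coef_norm h.
  rewrite -Hmod {1}(_ : h %% g = \sum_(j < n) (h %% g)`_j *: 'X^j).
    rewrite rmorph_sum /= (le_trans (av_sum hw _ _ _))// mulr_sumr; apply: ler_sum => j _.
    rewrite -mul_polyC rmorphM rmorphXn (avM hw) Hc (avX hw) mulrC ler_wpM2r ?(av_ge0 hF)//.
    by rewrite /B (bigD1 j)//= lerDl sumr_ge0// => i _; rewrite exprn_ge0 ?(av_ge0 hw).
  rewrite -poly_def; apply/polyP => j; rewrite coef_poly; case: ltnP => // nj.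
  by rewrite nth_default// (leq_trans (size_modp_le gn _)).
have B0 : 0 <= B by apply: sumr_ge0 => i _; rewrite exprn_ge0 ?(av_ge0 hw).
have [C2 C20 hC2] := coef_norm_le_polyav.
have le h : w (H h) <= polyav h.
  apply: (@pow_bound_le _ _ _ (B * C2)) => [||k]; rewrite ?(av_ge0 hw) ?polyav_ge0//.
  rewrite -(avX hw) -rmorphXn -polyavX (le_trans (HB _))//.
  apply: (@le_trans _ _ (B * (C2 * polyav (h ^+ k)))); first exact: ler_wpM2l.
  rewrite mulrA polyavX -[leRHS]mulrA ler_wpM2l ?mulr_ge0 ?(ltW C20)//.
  by rewrite ler_peMl ?ler1n// exprn_ge0 ?polyav_ge0.
move=> h; have [gh|ngh] := boolP (g %| h).
  have /eqP -> : polyav h == 0 by rewrite polyav_eq0.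
  by rewrite -Hmod; move: gh; rewrite /dvdp => /eqP ->; rewrite rmorph0 (av0 hw).
have /Bezout_eq1_coprimepP [[u u'] /= E] : coprimep g h by rewrite irreducible_poly_coprime.
have e1 : w (H u') * w (H h) = 1.
  rewrite -(avM hw) -rmorphM -(av1 hw) -(rmorph1 H) -E rmorphD [H (u * g)]rmorphM Hg mulr0.
  by rewrite add0r.
have e2 : polyav u' * polyav h = 1.
  rewrite -polyavM -polyav_mod -(av1 hF) -polyavC -[in RHS]polyav_mod.
  by congr polyav; rewrite -[1%:P]E modpD modp_mull add0r.
apply/le_anti/andP; split; first exact: le.
have uh : polyav u' != 0 by apply: contra_eq_neq e2 => ->; rewrite mul0r eq_sym oner_neq0.
have up : 0 < polyav u' by rewrite lt0r uh polyav_ge0.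
rewrite -(ler_pM2l up) e2 -e1.
by rewrite ler_wpM2r ?(av_ge0 hw).
Qed.

End Irreducible.

End LocalField.

Section Extension.
Variables (R : realType) (K F L : fieldType) (v : K -> R) (nF : F -> R) (w : L -> R).
Variables (j : {rmorphism K -> F}) (k : {rmorphism K -> L}).
Hypotheses (hF : is_absolute_value nF) (hw : is_absolute_value w) (cw : av_complete w).
Hypotheses (jE : forall q, nF (j q) = v q) (kE : forall q, w (k q) = v q).
Hypothesis dF : forall x (e : R), 0 < e -> exists q, nF (x - j q) < e.

Let rel (x : F) (l : L) := forall e : R, 0 < e -> exists q, nF (x - j q) < e /\ w (l - k q) < e.

Let rel_ex x : exists l, rel x l.
Proof.
have [q hq] : {q : nat -> K & forall m, nF (x - j (q m)) < m.+1%:R^-1}.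
  apply: (@choice _ _ (fun (m : nat) (q : K) => nF (x - j q) < m.+1%:R^-1)) => m.
  by apply: dF; rewrite invr_gt0.
have cq : av_cvg nF \oo (fun m => j (q m)) x.
  apply: (av_cvg_le (y := harmonic)) => [m|]; last exact: cvg_harmonic.
  by rewrite (avBC hF) ltW.
have [l hl] : exists l, av_cvg w \oo (fun m => k (q m)) l.
  apply: cw; apply/(av_cauchy_morph kE)/(av_cauchy_morph jE).
  exact: av_cvg_cauchy cq.
exists l => e e0; have [m [/= h1 h2]] := filter_ex (filterI (cq _ e0) (hl _ e0)).
by exists (q m); rewrite (avBC hF) (avBC hw).
Qed.

Let rel_uniq x l l' : rel x l -> rel x l' -> l = l'.
Proof.
move=> h h'; apply/eqP; rewrite -subr_eq0 -(av_eq0 hw); apply/negPn/negP => n0.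
have e0 : 0 < w (l - l') / 4 by rewrite divr_gt0// lt0r n0 (av_ge0 hw).
have [q [q1 q2]] := h _ e0; have [q' [q'1 q'2]] := h' _ e0.
have e1 : v (q - q') < w (l - l') / 2.
  rewrite -jE rmorphB (_ : _ - _ = (x - j q') - (x - j q)); last by ring.
  by rewrite (le_lt_trans (avB hF _ _))//; lra.
have : w (l - l') < w (l - l').
  rewrite {1}(_ : l - l' = (l - k q) - (l' - k q') + k (q - q')); last by rewrite rmorphB; ring.
  have := avD hw (l - k q - (l' - k q')) (k (q - q')); have := avB hw (l - k q) (l' - k q').
  rewrite kE; lra.
by rewrite ltxx.
Qed.

Let rel_j q : rel (j q) (k q).
Proof. by move=> e e0; exists q; rewrite !subrr (av0 hF) (av0 hw). Qed.

Let relB x y l l' : rel x l -> rel y l' -> rel (x - y) (l - l').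
Proof.
move=> h h' e e0; have e2 : 0 < e / 2 by rewrite divr_gt0.
have [q [q1 q2]] := h _ e2; have [q' [q'1 q'2]] := h' _ e2.
exists (q - q'); rewrite !rmorphB; split.
  rewrite (_ : x - y - (j q - j q') = (x - j q) - (y - j q')); last by ring.
  by rewrite (le_lt_trans (avB hF _ _))// [ltRHS]splitr ltrD.
rewrite (_ : l - l' - (k q - k q') = (l - k q) - (l' - k q')); last by ring.
by rewrite (le_lt_trans (avB hw _ _))// [ltRHS]splitr ltrD.
Qed.

Let rel_seq x l : rel x l -> {q : nat -> K |
  av_cvg nF \oo (fun m => j (q m)) x /\ av_cvg w \oo (fun m => k (q m)) l}.
Proof.
move=> h.
have [q hq] : {q : nat -> K & forall m, nF (x - j (q m)) < m.+1%:R^-1 /\ w (l - k (q m)) < m.+1%:R^-1}.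
  apply: (@choice _ _ (fun (m : nat) (q : K) => nF (x - j q) < m.+1%:R^-1 /\ w (l - k q) < m.+1%:R^-1)) => m.
  by apply: h; rewrite invr_gt0.
exists q; split; apply: (av_cvg_le (y := harmonic)) => [m|]; do ?exact: cvg_harmonic.
  by have [/ltW] := hq m; rewrite (avBC hF).
by have [_ /ltW] := hq m; rewrite (avBC hw).
Qed.

Let relM x y l l' : rel x l -> rel y l' -> rel (x * y) (l * l').
Proof.
move=> /rel_seq [q [q1 q2]] /rel_seq [q' [q'1 q'2]] e e0.
have h1 : av_cvg nF \oo (fun m => j (q m) * j (q' m)) (x * y) by apply: (av_cvgM hF).
have h2 : av_cvg w \oo (fun m => k (q m) * k (q' m)) (l * l') by apply: (av_cvgM hw).
have [m [/= h3 h4]] := filter_ex (filterI (h1 _ e0) (h2 _ e0)).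
by exists (q m * q' m); rewrite !rmorphM (avBC hF) (avBC hw).
Qed.

Lemma completion_extension : exists e : {rmorphism F -> L},
  (forall x, w (e x) = nF x) /\ forall q, e (j q) = k q.
Proof.
have [e he] := choice rel_ex.
have eZ : zmod_morphism e by move=> x y; apply: rel_uniq (he _) _; exact: relB.
have eM : monoid_morphism e.
  split=> [|x y]; last by apply: rel_uniq (he _) _; exact: relM.
  by apply: rel_uniq (he _) _; rewrite -(rmorph1 j) -(rmorph1 k); exact: rel_j.
pose E := HB.pack_for {rmorphism F -> L} e
  (GRing.isZmodMorphism.Build _ _ _ eZ) (GRing.isMonoidMorphism.Build _ _ _ eM).
exists E; split=> [x|q] /=; last by apply: rel_uniq (he _) _; exact: rel_j.
have [q [q1 q2]] := rel_seq (he x).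
have c1 : (fun t => nF (j (q t))) @ \oo --> nF x by exact: (av_cvg_av hF q1).
have c2 : (fun t => w (k (q t))) @ \oo --> w (e x) by exact: (av_cvg_av hw q2).
rewrite -(cvg_lim (@Rhausdorff R) c2) -(cvg_lim (@Rhausdorff R) c1).
by congr (limn _); apply/funext => m /=; rewrite kE jE.
Qed.

End Extension.

Section Factor.
Variable F : fieldType.

Lemma reducible_split (p : {poly F}) : (1 < size p)%N -> ~ irreducible_poly p ->
  exists q r, [/\ p = q * r, q \is monic, (size q < size p)%N & (size r < size p)%N].
Proof.
move=> p1 ip; have p0 : p != 0 by rewrite -size_poly_gt0 ltnW.
have [q [q1 qp nqp]] : exists q : {poly F}, [/\ size q != 1, q %| p & ~~ (q %= p)].
  apply: contrapT => H; apply: ip; split=> // q q1 qp; apply/negPn/negP => nqp.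
  by apply: H; exists q.
have /dvdpP [r rE] := qp.
have q0 : q != 0 by apply: contraNneq p0 => q0; rewrite rE q0 mulr0.
have r0 : r != 0 by apply: contraNneq p0 => r0; rewrite rE r0 mul0r.
have lq0 : lead_coef q != 0 by rewrite lead_coef_eq0.
exists ((lead_coef q)^-1 *: q), (lead_coef q *: r); rewrite !size_scale ?invr_eq0//; split.
- by rewrite -scalerAl -scalerAr scalerA mulVf// scale1r mulrC.
- by rewrite monicE lead_coefZ mulVf.
- by rewrite ltn_neqAle dvdp_size_eqp// nqp dvdp_leq.
- have q2 : (1 < size q)%N by rewrite ltn_neqAle eq_sym q1 size_poly_gt0.
  rewrite rE size_mul//; move: q2; case: (size q) => [|[|k]]// _.
  by rewrite !addnS /= ltnS leq_addr.
Qed.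

Lemma monic_factorization (p : {poly F}) : p \is monic ->
  exists s : seq {poly F}, [/\ forall g, g \in s -> g \is monic,
     forall g, g \in s -> irreducible_poly g & p = \prod_(g <- s) g].
Proof.
have [m] := ubnP (size p); elim: m p => // m IH p /ltnSE pm pmon.
have p0 : p != 0 by rewrite monic_neq0.
have [p1|p1] := leqP (size p) 1.
  exists [::]; split=> //; rewrite big_nil; apply/eqP; move: pmon.
  by rewrite monicE [p]size1_polyC// lead_coefC => /eqP ->.
have [ip|nip] := pselect (irreducible_poly p).
  by exists [:: p]; rewrite big_seq1; split=> // g; rewrite inE => /eqP ->.
have [q [r [pE qmon sq sr]]] := reducible_split p1 nip.
have rmon : r \is monic by move: pmon; rewrite pE monicMl.
have [s [s1 s2 s3]] := IH q (leq_trans sq pm) qmon.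
have [t [t1 t2 t3]] := IH r (leq_trans sr pm) rmon.
exists (s ++ t); split; rewrite ?big_cat -?s3 -?t3//= => g.
  by rewrite mem_cat => /orP[/s1|/t1].
by rewrite mem_cat => /orP[/s2|/t2].
Qed.

Lemma irreducible_dvd_prod (g : {poly F}) (s : seq {poly F}) :
  g \is monic -> irreducible_poly g ->
  (forall h, h \in s -> h \is monic) -> (forall h, h \in s -> irreducible_poly h) ->
  g %| \prod_(h <- s) h -> g \in s.
Proof.
move=> gm ig; elim: s => [|h s IH] sm si.
  rewrite big_nil dvdp1 => /eqP g1; by case: ig; rewrite g1.
rewrite big_cons; have [gh|ngh] := boolP (g %| h) => gd.
  have ih : irreducible_poly h by apply: si; rewrite mem_head.
  have /eqP g1 : size g != 1 by case: (ig) => + _; case: (size g) => [|[]].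
  have : g %= h by case: ih => _; apply=> //; apply/eqP.
  by rewrite (eqp_monic gm (sm _ (mem_head _ _))) => /eqP ->; rewrite mem_head.
rewrite inE; apply/orP; right; apply: IH => [x xs|x xs|].
- by apply: sm; rewrite inE xs orbT.
- by apply: si; rewrite inE xs orbT.
by rewrite -(Gauss_dvdpr _ (_ : coprimep g h))// irreducible_poly_coprime.
Qed.

Lemma exists_irreducible_root (L : fieldType) (H : {rmorphism {poly F} -> L}) (p : {poly F}) :
  p \is monic -> H p = 0 ->
  exists g, [/\ g \is monic, irreducible_poly g, g %| p & H g = 0].
Proof.
move=> pm; have [s [s1 s2 s3]] := monic_factorization pm.
rewrite {1}s3 rmorph_prod => /eqP; rewrite prodf_seq_eq0 => /hasP [g gs /eqP Hg].
exists g; split; rewrite ?s1//; first exact: s2.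
by rewrite s3 (big_rem g)//= dvdp_mulr.
Qed.

Lemma uniq_factorization (s : seq {poly F}) : (forall g, g \in s -> irreducible_poly g) ->
  separable_poly (\prod_(g <- s) g) -> uniq s.
Proof.
elim: s => // g s IH si; rewrite big_cons separable_mul => /and3P[_ seps cop] /=.
rewrite IH// ?andbT; last by move=> h hs; apply: si; rewrite inE hs orbT.
apply/negP => gs; have ig : irreducible_poly g by apply: si; rewrite mem_head.
move: cop; rewrite irreducible_poly_coprime// => /negP; apply.
by rewrite (big_rem g)//= dvdp_mulr.
Qed.

End Factor.

Section Basis.
Variables (F L : fieldType) (e : {rmorphism F -> L}).

Definition is_basis_over n (b : 'I_n -> L) := forall y : L, exists! c : {ffun 'I_n -> L},
  (forall j, exists x, c j = e x) /\ y = \sum_j c j * b j.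

Lemma is_basis_over_exp n (b : 'I_n -> L) y : is_basis_over b ->
  exists x : 'I_n -> F, y = \sum_j e (x j) * b j.
Proof.
move=> /(_ y) [c [[/choice [x xE] ->] _]].
by exists x; apply: eq_bigr => j _; rewrite xE.
Qed.

Lemma is_basis_over_inj n (b : 'I_n -> L) (x x' : 'I_n -> F) : is_basis_over b ->
  \sum_j e (x j) * b j = \sum_j e (x' j) * b j -> x =1 x'.
Proof.
move=> hb E; have [c [_ uc]] := hb (\sum_j e (x j) * b j).
have h (z : 'I_n -> F) : \sum_j e (x j) * b j = \sum_j e (z j) * b j ->
    c = [ffun j => e (z j)].
  move=> Ez; apply: uc; split=> [j|]; first by exists (z j); rewrite ffunE.
  by rewrite Ez; apply: eq_bigr => j _; rewrite ffunE.
move=> j; apply: (fmorph_inj e).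
by have /ffunP /(_ j) := etrans (esym (h x erefl)) (h x' E); rewrite !ffunE.
Qed.

Lemma is_basis_over_leq n m (b : 'I_n -> L) (b' : 'I_m -> L) :
  is_basis_over b -> is_basis_over b' -> (n <= m)%N.
Proof.
move=> hb hb'.
have /choice [x xE] := fun j => is_basis_over_exp (b j) hb'.
have /choice [x' x'E] := fun j => is_basis_over_exp (b' j) hb.
apply: (@mulmx1_min _ _ _ (\matrix_(i, j) x i j) (\matrix_(i, j) x' i j)).
apply/matrixP => i j; rewrite !mxE; move: j; apply: (is_basis_over_inj hb).
transitivity (b i).
  rewrite [RHS]xE; under [RHS]eq_bigr do rewrite x'E mulr_sumr.
  rewrite exchange_big /=; apply: eq_bigr => j _; rewrite rmorph_sum mulr_suml.
  by apply: eq_bigr => k _; rewrite !mxE rmorphM mulrA.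
rewrite (bigD1 i)//= eqxx rmorph1 mul1r big1 ?addr0// => j ji.
by rewrite eq_sym (negPf ji) rmorph0 mul0r.
Qed.

End Basis.

Lemma ln_prod_seq (R : realType) (I : eqType) (s : seq I) (f : I -> R) :
  (forall i, i \in s -> 0 < f i) -> ln (\prod_(i <- s) f i) = \sum_(i <- s) ln (f i).
Proof.
elim: s => [|i s IH] f0; first by rewrite !big_nil ln1.
have fs k : k \in s -> 0 < f k by move=> ks; rewrite f0// inE ks orbT.
rewrite !big_cons lnM ?posrE ?f0 ?mem_head ?IH//.
by rewrite big_seq prodr_gt0.
Qed.

(** * Places of a number field *)

Section Places.
Variables (R : realType) (v0 : rat -> R) (F : fieldType) (nF : F -> R).
Variable j : {rmorphism rat -> F}.
Hypotheses (hF : is_absolute_value nF) (cF : av_complete nF).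
Hypothesis tbF : forall M e : R, 0 < e ->
  exists s : seq F, forall x, nF x <= M -> exists2 c, c \in s & nF (x - c) < e.
Hypotheses (jE : forall q, nF (j q) = v0 q).
Hypothesis dF : forall x (e : R), 0 < e -> exists q, nF (x - j q) < e.
Variables (K : fieldExtType rat) (ev : {rmorphism {poly rat} -> K}) (f : {poly rat}) (N : nat).
Hypotheses (fm : f \is monic) (fN : size f = N.+1) (sf : separable_poly f).
Hypothesis ev_surj : forall y, exists P, ev P = y.
Hypothesis ev_eq0 : forall P, (ev P == 0) = (f %| P).

Local Notation psi := (map_poly j).

Definition place_over (v : K -> R) := is_absolute_value v /\ forall q, v (ratr q) = v0 q.

Lemma evC q : ev q%:P = ratr q.
Proof.
exact: (fmorph_eq_rat (ev \o polyC)).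
Qed.

Lemma irredp_degree (g : {poly F}) : irreducible_poly g -> size g = (size g).-1.+1 /\ (0 < (size g).-1)%N.
Proof. by case=> + _; case: (size g) => [|[]]. Qed.

Lemma factor_place (g : {poly F}) : irreducible_poly g -> g %| psi f ->
  exists v, place_over v /\ forall P, v (ev P) = polyav nF (size g).-1 g (psi P).
Proof.
move=> ig gf; have [gn n0] := irredp_degree ig; set n := (size g).-1 in gn n0 *.
have [lift liftE] := choice ev_surj.
pose v y := polyav nF n g (psi (lift y)).
have vE P : v (ev P) = polyav nF n g (psi P).
  have d : g %| psi (lift (ev P)) - psi P.
    rewrite -rmorphB; apply: dvdp_trans gf _.
    by rewrite dvdp_map -ev_eq0 rmorphB liftE subrr.
  rewrite /v -(polyav_mod nF gn) -[RHS](polyav_mod nF gn); congr polyav.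
  by apply/eqP; rewrite -subr_eq0 -modpN -modpD; exact: d.
exists v; split=> //; split; last first.
  by move=> q; rewrite -evC vE map_polyC /= (polyavC hF gn n0) jE.
split=> [y|y|x y|x y].
- exact: polyav_ge0.
- have [P <-] := ev_surj y; split=> [vP|->]; last first.
    by rewrite -(rmorph0 ev) vE rmorph0 (polyavC hF) // (av0 hF).
  apply/eqP/negPn/negP => P0; have [Q QE] := ev_surj (ev P)^-1.
  have : v (ev P) * v (ev Q) = 1.
    rewrite !vE -polyavM// -rmorphM -vE rmorphM QE divff// -(rmorph1 ev) vE rmorph1.
    by rewrite -[1]/(1%:P) polyavC// (av1 hF).
  by move/eqP; rewrite vP mul0r eq_sym oner_eq0.
- by have [P <-] := ev_surj x; have [Q <-] := ev_surj y; rewrite -rmorphM !vE rmorphM polyavM.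
- have [P <-] := ev_surj x; have [Q <-] := ev_surj y; rewrite -rmorphD !vE rmorphD.
  exact: (polyavD hF cF tbF).
Qed.

Definition rat_closure (L : fieldType) (w : L -> R) (i : {rmorphism K -> L}) : set L :=
  [set z : L | forall e : R, 0 < e -> exists q : rat, w (z - i (ratr q)) < e].

Definition rat_basis (L : fieldType) (w : L -> R) (i : {rmorphism K -> L}) d (b : 'I_d -> L) :=
  forall y : L, exists! c : {ffun 'I_d -> L},
    (forall k, rat_closure w i (c k)) /\ y = \sum_k c k * b k.

(* The closure of Q in L is F, and L = F[th] for the image th of X; the factor *)
(* g is the minimal polynomial of th.                                          *)
Lemma completion_factor (v : K -> R) (L : fieldType) (w : L -> R) (i : {rmorphism K -> L}) :
  place_over v -> is_completion v w i ->
  exists g, [/\ g \is monic, irreducible_poly g, g %| psi f,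
    (forall P, v (ev P) = polyav nF (size g).-1 g (psi P)) &
    forall d, (exists b : 'I_d -> L, rat_basis w i b) <-> d = (size g).-1].
Proof.
move=> [hv vq] [hw wi dL cL].
have cw : av_complete w by move=> u /cL [l hl]; exists l; apply/av_cvg_oo.
pose k : {rmorphism rat -> L} := (i \o ev) \o polyC.
have kE q : w (k q) = v0 q by rewrite /k /= wi evC vq.
have [e [we ek]] := completion_extension hF hw cw jE kE dF.
pose th := i (ev 'X).
pose H : {rmorphism {poly F} -> L} := horner_eval th \o map_poly e.
have HC c : H c%:P = e c by rewrite /H /= map_polyC /horner_eval hornerC.
have HX : H 'X = th by rewrite /H /= map_polyX /horner_eval hornerX.
have Hpsi P : H (psi P) = i (ev P).
  elim/poly_ind : P => [|P c IH]; first by rewrite !rmorph0.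
  have -> : psi (P * 'X + c%:P) = psi P * 'X + (j c)%:P.
    by rewrite rmorphD rmorphM /= map_polyX map_polyC.
  have -> : ev (P * 'X + c%:P) = ev P * ev 'X + ev c%:P by rewrite rmorphD rmorphM.
  have -> : H (psi P * 'X + (j c)%:P) = H (psi P) * H 'X + H (j c)%:P by rewrite rmorphD rmorphM.
  by rewrite IH HX HC ek rmorphD rmorphM.
have pfm : psi f \is monic by rewrite monic_map.
have Hf : H (psi f) = 0.
  by rewrite Hpsi; apply/eqP; rewrite fmorph_eq0 ev_eq0 dvdpp.
have [g [gm ig gf Hg]] := exists_irreducible_root pfm Hf.
have [gn n0] := irredp_degree ig.
exists g; split=> //; set n := (size g).-1 in gn n0 *.
  move=> P; rewrite -wi -Hpsi.
  by apply: (polyav_unique hF cF tbF gn n0 ig hw) => // c; rewrite HC we.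
have wH h : w (H h) = polyav nF n g h.
  by apply: (polyav_unique hF cF tbF gn n0 ig hw) => // c; rewrite HC we.
have Hmod h : H (h %% g) = H h.
  by rewrite {2}(divp_eq h g) rmorphD rmorphM Hg mulr0 add0r.
have ratrE q : i (ratr q) = k q by rewrite -evC.
have closE z : rat_closure w i z <-> exists x, z = e x.
  split=> [hz|[x ->] d d0]; last first.
    by have [q hq] := dF x d0; exists q; rewrite ratrE -ek -rmorphB we.
  have [q hq] : {q : nat -> rat & forall m, w (z - k (q m)) < m.+1%:R^-1}.
    apply: (@choice _ _ (fun (m : nat) (q : rat) => w (z - k q) < m.+1%:R^-1)) => m.
    have m0 : 0 < m.+1%:R^-1 :> R by rewrite invr_gt0.
    by have [q] := hz _ m0; rewrite ratrE; exists q.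
  have c1 : av_cvg w \oo (fun m => k (q m)) z.
    apply: (av_cvg_le (y := harmonic)) => [m|]; last exact: cvg_harmonic.
    by rewrite (avBC hw) ltW.
  have [x hx] : exists x, av_cvg nF \oo (fun m => j (q m)) x.
    apply: cF; apply/(av_cauchy_morph jE)/(av_cauchy_morph kE).
    exact: av_cvg_cauchy c1.
  exists x; apply: (av_cvg_unique hw c1).
  have : av_cvg w \oo (fun m => e (j (q m))) (e x) by apply/(av_cvg_morph we).
  by under eq_fun do rewrite ek.
have Hsum (x : 'I_n -> F) : H (\sum_m x m *: 'X^m) = \sum_m e (x m) * th ^+ m.
  rewrite rmorph_sum; apply: eq_bigr => m _.
  by rewrite -mul_polyC rmorphM HC rmorphXn HX.
have surj y : exists x : 'I_n -> F, y = \sum_m e (x m) * th ^+ m.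
  have [P hP] : {P : nat -> {poly rat} & forall m, w (y - i (ev (P m))) < m.+1%:R^-1}.
    apply: (@choice _ _ (fun (m : nat) (P : {poly rat}) => w (y - i (ev P)) < m.+1%:R^-1)) => m.
    have m0 : 0 < m.+1%:R^-1 :> R by rewrite invr_gt0.
    have [x hx] := dL y _ m0; have [P PE] := ev_surj x.
    by exists P; rewrite PE.
  have c1 : av_cvg w \oo (fun m => i (ev (P m))) y.
    apply: (av_cvg_le (y := harmonic)) => [m|]; last exact: cvg_harmonic.
    by rewrite (avBC hw) ltW.
  pose h m := psi (P m) %% g.
  have hE m : H (h m) = i (ev (P m)) by rewrite Hmod Hpsi.
  have [C C0 hC] := coef_norm_le_polyav hF cF tbF gn n0 ig.
  have [x hx] : {x : 'I_n -> F & forall t : 'I_n, av_cvg nF \oo (fun m => (h m)`_t) (x t)}.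
    apply: (@choice _ _ (fun (t : 'I_n) (x : F) => av_cvg nF \oo (fun m => (h m)`_t) x)) => t.
    apply: cF => d d0; have dC : 0 < d / C by rewrite divr_gt0.
    have [m0 hm] := av_cvg_cauchy hw c1 dC; exists m0 => m m' mm mm'.
    apply: (@le_lt_trans _ _ (coef_norm nF n g (psi (P m) - psi (P m')))).
      rewrite /coef_norm (bigD1 t)//= modpD modpN -!/(h _) coefB lerDl.
      by apply: sumr_ge0 => ? _; exact: (av_ge0 hF).
    apply: (le_lt_trans (hC _)); rewrite -wH rmorphB !Hpsi mulrC -ltr_pdivlMr//.
    exact: hm.
  exists x; apply: (av_cvg_unique hw c1).
  have -> : (fun m => i (ev (P m))) = (fun m => \sum_(t < n) e ((h m)`_t) * th ^+ t).
    apply/funext => m; rewrite -hE -Hsum; congr (H _).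
    rewrite -(poly_def n (fun t => (h m)`_t)); apply/polyP => t; rewrite coef_poly.
    by case: ltnP => // nt; rewrite nth_default// (leq_trans (size_modp_le gn _)).
  apply: (av_cvg_sum hw) => t _; apply: (av_cvgM hw); last exact: (av_cvg_cst hw).
  by apply/(av_cvg_morph we); exact: hx.
have basisE d (b : 'I_d -> L) : rat_basis w i b <-> is_basis_over e b.
  split=> h y; have [c [[c1 c2] c3]] := h y; exists c; split.
  - by split=> // m; apply/closE.
  - by move=> c' [h1 h2]; apply: c3; split=> // m; apply/closE.
  - by split=> // m; apply/closE.
  - by move=> c' [h1 h2]; apply: c3; split=> // m; apply/closE.
have hb : is_basis_over e (fun m : 'I_n => th ^+ m).
  move=> y; have [x ->] := surj y; exists [ffun m => e (x m)]; split.
    split=> [m|]; first by exists (x m); rewrite ffunE.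
    by apply: eq_bigr => m _; rewrite ffunE.
  move=> c [/choice [x' x'E]].
  under [in RHS]eq_bigr do rewrite x'E.
  rewrite -!Hsum => /eqP; rewrite -subr_eq0 -rmorphB -sumrB.
  under eq_bigr do rewrite -scalerBl.
  move=> H0; apply/ffunP => m; rewrite ffunE x'E; congr (e _).
  have : g %| \sum_m (x m - x' m) *: 'X^m.
    by rewrite -(polyav_eq0 hF gn n0 ig) -wH (eqP H0) (av0 hw).
  set D := \sum_m _ => gD.
  have D0 : D = 0.
    apply/eqP; apply: contraLR gD => D0; apply/negP => /(dvdp_leq D0).
    rewrite gn leqNgt ltnS => /negP; apply.
    rewrite (leq_trans (size_sum _ _ _))//; apply/bigmax_leqP => t _.
    by rewrite (leq_trans (size_scale_leq _ _))// size_polyXn.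
  have := congr1 (fun p : {poly F} => p`_m) D0; rewrite /= coef0 coef_sum (bigD1 m)//=.
  rewrite coefZ coefXn eqxx mulr1 big1 ?addr0 => [/eqP|t tm].
    by rewrite subr_eq0 => /eqP.
  rewrite coefZ coefXn (_ : (m == t :> nat) = false) ?mulr0//.
  by apply/negbTE; rewrite eq_sym.
move=> d; split=> [[b /basisE bb]|->]; last by exists (fun m => th ^+ m); apply/basisE.
by apply/eqP; rewrite eqn_leq (is_basis_over_leq bb hb) (is_basis_over_leq hb bb).
Qed.

(* Along rational polynomials approximating g, the norms modulo g tend to 0,   *)
(* hence so do the norms modulo g', and g' divides g.                          *)
Lemma place_factor_inj (g g' : {poly F}) :
  g \is monic -> irreducible_poly g -> g' \is monic -> irreducible_poly g' ->
  (forall P, polyav nF (size g).-1 g (psi P) = polyav nF (size g').-1 g' (psi P)) -> g = g'.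
Proof.
move=> gm ig gm' ig' E.
have [gn n0] := irredp_degree ig; set n := (size g).-1 in gn n0 E.
have [gn' n0'] := irredp_degree ig'; set n' := (size g').-1 in gn' n0' E.
have [q hq] : {q : nat * nat -> rat & forall p, nF (g`_p.2 - j (q p)) < p.1.+1%:R^-1}.
  apply: (@choice _ _ (fun (p : nat * nat) (q : rat) => nF (g`_p.2 - j q) < p.1.+1%:R^-1)) => p.
  by apply: dF; rewrite invr_gt0.
pose P m := \poly_(t < n.+1) q (m, t).
have szP m : (size (psi (P m)) <= n.+1)%N by rewrite size_map_poly size_poly.
have cP t : av_cvg nF \oo (fun m => (psi (P m))`_t) g`_t.
  apply: (av_cvg_le (y := harmonic)) => [m|]; last exact: cvg_harmonic.
  rewrite coef_map coef_poly /=; case: ltnP => [tn|nt].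
    by rewrite (avBC hF) ltW// (hq (m, t)).
  by rewrite rmorph0 nth_default ?gn// subrr (av0 hF) invr_ge0.
have c1 : av_cvg nF \oo (fun m => polynorm n g (psi (P m))) 0.
  have <- : polynorm n g g = 0 by rewrite polynorm_dvd// dvdpp.
  by apply: (polynorm_cvg hF _ gn szP); rewrite ?gn.
have c2 : av_cvg nF \oo (fun m => polynorm n' g' (psi (P m))) (polynorm n' g' g).
  by apply: (polynorm_cvg hF _ gn' szP); rewrite ?gn.
have cX (u : nat -> F) l k : av_cvg nF \oo u l -> av_cvg nF \oo (fun m => u m ^+ k) (l ^+ k).
  move=> ul; elim: k => [|k IH]; first by rewrite expr0; exact: (av_cvg_cst hF).
  by under eq_fun do rewrite exprS; rewrite exprS; exact: (av_cvgM hF).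
have c3 : (fun m => nF (polynorm n g (psi (P m)) ^+ n')) @ \oo --> nF (0 ^+ n').
  exact: (av_cvg_av hF (cX _ _ _ c1)).
have c4 : (fun m => nF (polynorm n' g' (psi (P m)) ^+ n)) @ \oo --> nF (polynorm n' g' g ^+ n).
  exact: (av_cvg_av hF (cX _ _ _ c2)).
have : nF (polynorm n' g' g ^+ n) = nF (0 ^+ n').
  rewrite -(cvg_lim (@Rhausdorff R) c3) -(cvg_lim (@Rhausdorff R) c4).
  congr (limn _); apply/funext => m /=.
  by rewrite !(avX hF) -(polyavXn hF) // -(polyavXn hF)// E -!exprM mulnC.
rewrite expr0n gtn_eqF// (av0 hF) => /eqP; rewrite (av_eq0 hF) expf_eq0 n0 /=.
rewrite (polynorm_eq0 gn' n0' ig') => g'g; apply/esym/eqP.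
rewrite -eqp_monic//; case: ig => _; apply=> //.
by rewrite gn'; case: (n') n0'.
Qed.

Lemma place_completion (v : K -> R) : is_absolute_value v ->
  exists (L : fieldType) (w : L -> R) (i : {rmorphism K -> L}), is_completion v w i.
Proof.
move=> hv; have [L [w [i [hw wi dL cL]]]] := exists_completion hv; exists L, w, i; split=> //.
by move=> u /cL [l hl]; exists l; apply/av_cvg_oo.
Qed.

Lemma local_degree_factor (v : K -> R) : place_over v ->
  exists g, [/\ g \is monic, irreducible_poly g, g %| psi f,
    (forall P, v (ev P) = polyav nF (size g).-1 g (psi P)) &
    local_degree v = (size g).-1].
Proof.
move=> pv; have [hv _] := pv; have [L [w [i c]]] := place_completion hv.
have [g [gm ig gf gE gd]] := completion_factor pv c; exists g; split=> //.
have ex : exists d, exists (L : fieldType) (w : L -> R) (i : {rmorphism K -> L}) (b : 'I_d -> L),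
    is_completion v w i /\ rat_basis w i b.
  by have [b hb] := (gd (size g).-1).2 erefl; exists (size g).-1, L, w, i, b.
have [L' [w' [i' [b [c' hb]]]]] := xgetPex 0%N ex.
have [g' [gm' ig' gf' gE' gd']] := completion_factor pv c'.
have dE : local_degree v = (size g').-1 by apply/gd'; exists b; exact: hb.
rewrite dE; suff -> : g = g' by [].
by apply: place_factor_inj => // P; rewrite -gE -gE'.
Qed.

Lemma polynorm_prod (s : seq {poly F}) (h : {poly F}) : (forall g, g \in s -> g != 0) ->
  polynorm (size (\prod_(g <- s) g)).-1 (\prod_(g <- s) g) h = \prod_(g <- s) polynorm (size g).-1 g h.
Proof.
elim: s => [|g s IH] sg; first by rewrite !big_nil size_poly1 /polynorm det_mx00.
have g0 : g != 0 by rewrite sg// mem_head.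
have s0 : \prod_(g <- s) g != 0.
  by rewrite prodf_seq_neq0; apply/allP => h' hs; rewrite sg// inE hs orbT.
rewrite !big_cons -IH => [|h' hs]; last by rewrite sg// inE hs orbT.
have e1 : size g = (size g).-1.+1 by rewrite prednK// size_poly_gt0.
have e2 : size (\prod_(g <- s) g) = (size (\prod_(g <- s) g)).-1.+1 by rewrite prednK// size_poly_gt0.
rewrite -(polynorm_mulmod _ e1 e2); congr (polynorm _ _ _).
by rewrite size_mul// {1}e1 {1}e2 addSn addnS.
Qed.

Lemma places_over_sum : exists s : seq (K -> R), [/\ uniq s, forall v, v \in s <-> place_over v &
  forall P, ev P != 0 ->
    \sum_(v <- s) (local_degree v)%:R * ln (v (ev P)) = ln (v0 (polynorm N f P))].
Proof.
have pfm : psi f \is monic by rewrite monic_map.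
have [t [t1 t2 t3]] := monic_factorization pfm.
have ut : uniq t by apply: uniq_factorization => //; rewrite -t3 separable_map.
have tf g : g \in t -> g %| psi f by move=> gt; rewrite t3 (big_rem g)//= dvdp_mulr.
have [vg hvg] : {vg : {poly F} -> (K -> R) & forall g, g \in t ->
    place_over (vg g) /\ forall P, vg g (ev P) = polyav nF (size g).-1 g (psi P)}.
  apply: (@choice _ _ (fun (g : {poly F}) (v : K -> R) => g \in t ->
    place_over v /\ forall P, v (ev P) = polyav nF (size g).-1 g (psi P))) => g.
  have [gt|ngt] := boolP (g \in t); last by exists (fun=> 0).
  by have [v hv] := factor_place (t2 _ gt) (tf _ gt); exists v.
have inj g g' : g \in t -> g' \in t -> vg g = vg g' -> g = g'.
  move=> gt gt' E; apply: place_factor_inj; rewrite ?t1//; do ?exact: t2.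
  by move=> P; rewrite -(hvg _ gt).2 -(hvg _ gt').2 E.
exists (map vg t); split.
- by rewrite map_inj_in_uniq.
- move=> v; split=> [/mapP [g gt ->]|pv]; first exact: (hvg _ gt).1.
  have [g [gm ig gf gE _]] := local_degree_factor pv.
  have gt : g \in t by apply: irreducible_dvd_prod => //; rewrite -t3.
  apply/mapP; exists g => //; apply/funext => y; have [P <-] := ev_surj y.
  by rewrite gE (hvg _ gt).2.
move=> P P0; rewrite big_map -jE -polynorm_map//.
have -> : polynorm N (psi f) (psi P) = \prod_(g <- t) polynorm (size g).-1 g (psi P).
  rewrite (_ : N = (size (psi f)).-1) ?size_map_poly ?fN//.
  rewrite [in LHS](_ : N = (size (\prod_(g <- t) g)).-1) -?t3 ?size_map_poly ?fN//.
  rewrite -(polynorm_prod (s := t)) -?t3 ?size_map_poly ?fN// => g /t1.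
  exact: monic_neq0.
have vgp g : g \in t -> 0 < vg g (ev P) by move=> gt; rewrite (av_gt0 (hvg _ gt).1.1).
have npos g : g \in t -> 0 < nF (polynorm (size g).-1 g (psi P)).
  move=> gt; have [gn n0] := irredp_degree (t2 _ gt).
  by rewrite -(polyavXn hF _ n0) exprn_gt0// -(hvg _ gt).2 vgp.
rewrite (av_prod hF) ln_prod_seq// big_seq [in RHS]big_seq; apply: eq_bigr => g gt.
have [gn n0] := irredp_degree (t2 _ gt).
have [g' [gm' ig' gf' gE' ->]] := local_degree_factor (hvg _ gt).1.
have <- : g = g'.
  apply: place_factor_inj => //; [exact: t1|exact: t2|] => Q.
  by rewrite -gE' (hvg _ gt).2.
by rewrite -(polyavXn hF _ n0) lnXn ?(hvg _ gt).2 ?mulr_natl// -(hvg _ gt).2 vgp.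
Qed.

End Places.

Section NumberFieldPresentation.
Variable K : fieldExtType rat.

Lemma annihilating_poly (y : K) : exists2 q : {poly rat}, q \is monic & root (map_poly (in_alg K) q) y.
Proof.
have /polyOver1P [q qE] := minPolyOver 1%AS y.
exists q; last by rewrite -qE root_minPoly.
by rewrite -(map_monic (in_alg K)) -qE monic_minPoly.
Qed.

Lemma number_field_presentation : exists (ev : {rmorphism {poly rat} -> K}) (f : {poly rat}),
  [/\ f \is monic, separable_poly f, forall y, exists P, ev P = y &
      forall P, (ev P == 0) = (f %| P)].
Proof.
have ch0 : [pchar K] =i pred0 := ftrans (pchar_lalg K) (pchar_num _).
have sep : separable 1%AS {:K}%AS.
  by apply/separableP => y _; apply: pcharf0_separable; exact: ch0.
have E := eq_adjoin_separable_generator sep (sub1v _).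
set th := separable_generator _ _ in E.
have /polyOver1P [f fE] := minPolyOver 1%AS th.
pose ev : {rmorphism {poly rat} -> K} := horner_eval th \o map_poly (in_alg K).
exists ev, f; split.
- by rewrite -(map_monic (in_alg K)) -fE monic_minPoly.
- by rewrite -(separable_map (in_alg K)) -fE; apply: pcharf0_separable; exact: ch0.
- move=> y; have : y \in <<1; th>>%VS by rewrite -E memvf.
  move=> /Fadjoin_polyP [p /polyOver1P [P ->] ->].
  by exists P.
- move=> P; rewrite -(dvdp_map (in_alg K)) -fE /ev /= /horner_eval.
  apply/idP/idP => [h|/dvdpP [q ->]]; last by rewrite hornerM minPolyxx mulr0.
  by apply: minPoly_dvdp => //; apply/polyOver1P; exists P.
Qed.

End NumberFieldPresentation.

Section StandardPlaces.
Variable R : realType.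

Definition totally_bounded_balls (F : fieldType) (v : F -> R) := forall M e : R, 0 < e ->
  exists s : seq F, forall x, v x <= M -> exists2 c, c \in s & v (x - c) < e.

Lemma totally_bounded_completion (F : fieldType) (v0 : rat -> R) (nF : F -> R)
    (j : {rmorphism rat -> F}) : is_absolute_value nF ->
  totally_bounded_balls v0 -> (forall q, nF (j q) = v0 q) ->
  (forall x (e : R), 0 < e -> exists q, nF (x - j q) < e) -> totally_bounded_balls nF.
Proof.
move=> hF tb jE dF M e e0; have e2 : 0 < e / 2 by rewrite divr_gt0.
have [s hs] := tb (M + e / 2) _ e2; exists (map j s) => x xM.
have [q hq] := dF x _ e2.
have qM : v0 q <= M + e / 2.
  rewrite -jE -(subrK x (j q)) (le_trans (avD hF _ _))// addrC lerD//.
  by rewrite (avBC hF) ltW.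
have [c cs hc] := hs q qM; exists (j c); first exact: map_f.
rewrite -(subrK (j q) x) -addrA (le_lt_trans (avD hF _ _))// [ltRHS]splitr ltrD//.
by rewrite -rmorphB jE.
Qed.

Variable K : fieldExtType rat.
Variables (ev : {rmorphism {poly rat} -> K}) (f : {poly rat}).
Hypotheses (fm : f \is monic) (sf : separable_poly f).
Hypothesis ev_surj : forall y, exists P, ev P = y.
Hypothesis ev_eq0 : forall P, (ev P == 0) = (f %| P).

Local Notation N := (size f).-1.

Let fN : size f = N.+1.
Proof. by rewrite prednK// size_poly_gt0 monic_neq0. Qed.

Lemma standard_places_sum (v0 : rat -> R) : is_absolute_value v0 -> totally_bounded_balls v0 ->
  exists s : seq (K -> R), [/\ uniq s, forall v, v \in s <-> place_over v0 v &
    forall P, ev P != 0 ->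
      \sum_(v <- s) (local_degree v)%:R * ln (v (ev P)) = ln (v0 (polynorm N f P))].
Proof.
move=> h0 tb; have [F [nF [j [hF jE dF cF]]]] := exists_completion h0.
have tbF := totally_bounded_completion hF tb jE dF.
exact: (places_over_sum hF cF tbF jE dF fm fN sf ev_surj ev_eq0).
Qed.

Lemma polynorm_ev_neq0 P : ev P != 0 -> polynorm N f P != 0.
Proof.
move=> P0; have [Q QE] := ev_surj (ev P)^-1.
have : f %| P * Q - 1 by rewrite -ev_eq0 rmorphB rmorphM rmorph1 QE divff// subrr.
move=> d; have : polynorm N f P * polynorm N f Q = 1.
  rewrite -polynormM// -(polynorm_mod fN) -[RHS](polynorm1 fN) -[RHS](polynorm_mod fN).
  by congr polynorm; apply/eqP; rewrite -subr_eq0 -modpN -modpD; exact: d.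
by move=> E; apply: contra_eq_neq E => ->; rewrite mul0r eq_sym oner_neq0.
Qed.

Definition standard_avs (B : nat) : seq (rat -> R) :=
  @real_abs R :: [seq @padic_abs R p | p <- iota 0 B.+1 & prime p].

Lemma standard_avsP B v0 : v0 \in standard_avs B ->
  is_absolute_value v0 /\ totally_bounded_balls v0.
Proof.
rewrite inE => /orP[/eqP ->|/mapP [p]].
  split; first exact: real_abs_is_av.
  by move=> M e; exact: real_abs_totally_bounded.
rewrite mem_filter => /andP[pp _] ->; split; first exact: padic_abs_is_av.
by move=> M e; exact: padic_abs_totally_bounded.
Qed.

Lemma padic_abs_self p : prime p -> padic_abs R p p%:R = p%:R^-1.
Proof. by move=> pp; have := padic_abs_natr_pexp R pp 1; rewrite !expr1. Qed.

Lemma padic_abs_natr p (m : nat) : prime p -> ~~ (p %| m)%N -> padic_abs R p m%:R = 1.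
Proof.
move=> pp pm; have m0 : m%:Z != 0 by apply: contraNneq pm => -[->].
have -> : (m%:R : rat) = m%:~R / 1%:~R by rewrite divr1 -pmulrn.
rewrite padic_abs_frac//= logn1 logn_coprime ?prime_coprime// subrr expr0z//.
Qed.

Lemma padic_abs_le1 p (q : rat) : prime p -> ~~ (p %| `|denq q|)%N -> padic_abs R p q <= 1.
Proof.
move=> pp pq; rewrite -[q]divq_num_den.
apply: le_trans (padic_abs_le (k := 0) R pp (negbT (denq_eq0 q)) _) _; first by rewrite dvd1n.
by rewrite logn_coprime ?prime_coprime// subrr expr0z.
Qed.

Lemma uniq_standard_avs B : uniq (standard_avs B).
Proof.
have plt p : prime p -> p%:R^-1 < 1 :> R.
  by move=> pp; rewrite invf_lt1 ?ltr1n ?prime_gt1// ltr0n prime_gt0.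
rewrite /= map_inj_in_uniq ?filter_uniq ?iota_uniq ?andbT//.
  apply/mapP => -[p]; rewrite mem_filter => /andP[pp _] E.
  have := congr1 (fun g => g p%:R) E; rewrite /= padic_abs_self// /real_abs normr_nat rmorph_nat.
  by move=> E'; have := plt _ pp; rewrite -E' ltNge ler1n prime_gt0.
move=> p p'; rewrite !mem_filter => /andP[pp _] /andP[pp' _] E.
apply/eqP/negPn/negP => pp'E.
have := congr1 (fun g => g p%:R) E; rewrite /= padic_abs_self// padic_abs_natr//.
  by move=> E'; have := plt _ pp; rewrite E' ltxx.
by rewrite dvdn_prime2// eq_sym.
Qed.

Lemma place_integral (y : K) : exists B0, forall p, prime p -> (B0 < p)%N ->
  forall v, place_over (@padic_abs R p) v -> v y <= 1.
Proof.
have [q qm rq] := annihilating_poly y.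
exists (\sum_(i < size q) `|denq q`_i|)%N => p pp Bp v [hv vq].
have qi (i : 'I_(size q)) : padic_abs R p q`_i <= 1.
  apply: padic_abs_le1 => //; apply/negP => /dvdn_leq.
  rewrite absz_gt0 denq_eq0 => /(_ isT); apply/negP; rewrite -ltnNge.
  by apply: leq_ltn_trans Bp; rewrite (bigD1 i)//= leq_addr.
have vn m : v m%:R <= 1.
  have -> : (m%:R : K) = ratr m%:R by rewrite -alg_num_field scaler_nat.
  by rewrite vq padic_abs_le1// pmulrn denq_int dvdn1 gtn_eqF// prime_gt1.
rewrite leNgt; apply/negP => vy.
have vsum (I : Type) (r : seq I) (g : I -> K) (M : R) : 0 <= M -> (forall i, v (g i) <= M) ->
    v (\sum_(i <- r) g i) <= M.
  move=> M0 gM; elim/big_rec : _ => [|i x _ hx]; first by rewrite (av0 hv).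
  by rewrite (le_trans (av_ultrametric hv vn _ _))// ge_max gM.
have q0 : (0 < size q)%N by rewrite size_poly_gt0 monic_neq0.
set n := (size q).-1.
have qn : size q = n.+1 by rewrite prednK.
have n0 : (0 < n)%N.
  rewrite lt0n; apply: contraTneq rq => n0.
  have /size_poly1P [c c0 ->] : size q == 1 by rewrite qn n0.
  by rewrite map_polyC /root hornerC fmorph_eq0.
have E : y ^+ n = - \sum_(i < n) (q`_i)%:A * y ^+ i.
  apply/eqP; rewrite -addr_eq0 addrC; move: rq; rewrite /root horner_coef size_map_poly qn.
  rewrite big_ord_recr /= !coef_map /=.
  have -> : q`_n = 1 by move: qm; rewrite monicE /lead_coef qn => /eqP.
  rewrite scale1r mul1r => /eqP E; apply/eqP; rewrite -[RHS]E; congr (_ + _).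
  by apply: eq_bigr => i _; rewrite coef_map.
have : v y ^+ n <= v y ^+ n.-1.
  rewrite -(avX hv) E (avN hv); apply: vsum => [|i]; first by rewrite exprn_ge0 ?(av_ge0 hv).
  rewrite (avM hv) alg_num_field vq (avX hv) -[leRHS]mul1r.
  apply: ler_pM; rewrite ?exprn_ge0 ?(av_ge0 hv) ?padic_abs_ge0//.
    have iq : (i < size q)%N by rewrite qn ltnS ltnW.
    exact: (qi (Ordinal iq)).
  by rewrite ler_weXn2l ?ltW// -ltnS prednK.
by rewrite ler_eXn2l// leqNgt prednK// leqnn.
Qed.

Lemma exists_place_lists : exists pl : nat -> seq (K -> R),
  [/\ forall B, uniq (pl B), forall B v, v \in pl B -> places v &
   forall y, y != 0 -> exists B0, forall B, (B0 <= B)%N ->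
     (forall v, places v -> v \notin pl B -> v y = 1) /\
     \sum_(v <- pl B) (local_degree v)%:R * ln (v y) = 0].
Proof.
have [sel hsel] : {sel : (rat -> R) -> seq (K -> R) & forall v0,
    is_absolute_value v0 /\ totally_bounded_balls v0 ->
    [/\ uniq (sel v0), forall v, v \in sel v0 <-> place_over v0 v &
    forall P, ev P != 0 ->
      \sum_(v <- sel v0) (local_degree v)%:R * ln (v (ev P)) = ln (v0 (polynorm N f P))]}.
  apply: (@choice _ _ (fun (v0 : rat -> R) (s : seq (K -> R)) =>
    is_absolute_value v0 /\ totally_bounded_balls v0 ->
    [/\ uniq s, forall v, v \in s <-> place_over v0 v &
    forall P, ev P != 0 ->
      \sum_(v <- s) (local_degree v)%:R * ln (v (ev P)) = ln (v0 (polynorm N f P))])) => v0.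
  have [[h tb]|nh] := pselect (is_absolute_value v0 /\ totally_bounded_balls v0).
    by have [s hs] := standard_places_sum h tb; exists s.
  by exists [::] => h; case: (nh h).
pose pl B := flatten (map sel (standard_avs B)).
have plP B v : v \in pl B -> exists2 v0, v0 \in standard_avs B & place_over v0 v.
  move=> /flattenP [s /mapP [v0 v0B ->] vs]; exists v0 => //.
  by have [_ + _] := hsel _ (standard_avsP v0B); move/(_ v) => <-.
exists pl; split.
- move=> B; suff H l : uniq l -> {subset l <= standard_avs B} -> uniq (flatten (map sel l)).
    exact: H (uniq_standard_avs B) _.
  elim: l => [|v0 l IH] //= /andP[v0l ul] lB.
  have v0B : v0 \in standard_avs B by apply: lB; rewrite mem_head.
  have [us sP _] := hsel _ (standard_avsP v0B).
  have lB' : {subset l <= standard_avs B} by move=> x xl; apply: lB; rewrite inE xl orbT.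
  rewrite cat_uniq us IH// andbT; apply/hasPn => v /flattenP [s /mapP [v1 v1l ->]].
  have [_ sP1 _] := hsel _ (standard_avsP (lB' _ v1l)).
  move=> /sP1 [_ v1E]; apply: contra v0l => /sP [_ v0E].
  by rewrite (_ : v0 = v1)//; apply/funext => q; rewrite -v0E v1E.
- move=> B v /plP [v0 v0B [hv vE]]; split=> //.
  move: v0B; rewrite inE => /orP[/eqP v0E|/mapP [p]].
    by left => q; rewrite vE v0E.
  rewrite mem_filter => /andP[pp _] v0E; right; exists p => // q.
  by rewrite vE v0E.
move=> y y0; have [P PE] := ev_surj y.
have P0 : ev P != 0 by rewrite PE.
have Nm0 := polynorm_ev_neq0 P0; set Nm := polynorm _ _ _ in Nm0.
have [B1 hB1] := place_integral y; have [B2 hB2] := place_integral y^-1.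
exists (maxn (maxn B1 B2) (maxn `|numq Nm| `|denq Nm|)) => B.
rewrite !geq_max => /andP[/andP[b1 b2] /andP[b3 b4]]; split.
  move=> v [hv hv0] vB.
  have notin v0 : v0 \in standard_avs B -> ~ place_over v0 v.
    move=> v0B pv; move/negP : vB; apply; apply/flattenP; exists (sel v0); first exact: map_f.
    by have [_ sP _] := hsel _ (standard_avsP v0B); apply/sP.
  case: hv0 => [vE|[p pp vE]]; first by case: (notin (@real_abs R)); rewrite ?mem_head.
  have pB : (B < p)%N.
    rewrite ltnNge; apply/negP => pB; case: (notin (@padic_abs R p)) => //.
    by rewrite inE map_f ?orbT// mem_filter pp mem_iota.
  have pv : place_over (@padic_abs R p) v by [].
  apply/le_anti; rewrite (hB1 p)//= ?(leq_ltn_trans b1)//.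
  have := hB2 p pp (leq_ltn_trans b2 pB) v pv.
  by rewrite (avV hv) invf_le1// (av_gt0 hv).
rewrite big_flatten big_map.
transitivity (\sum_(v0 <- standard_avs B) ln (v0 Nm)).
  rewrite big_seq [RHS]big_seq; apply: eq_bigr => v0 v0B.
  by have [_ _ +] := hsel _ (standard_avsP v0B); move=> /(_ _ P0); rewrite PE.
have sub n : (0 < n)%N -> (n <= B)%N -> {subset primes n <= [seq p <- iota 0 B.+1 | prime p]}.
  move=> n0 nB p; rewrite mem_primes mem_filter mem_iota => /and3P[-> _ pn] /=.
  by rewrite ltnS (leq_trans (dvdn_leq _ pn)).
rewrite big_cons big_map; apply: rat_product_formula => //.
- by rewrite filter_uniq ?iota_uniq.
- by apply/allP => p; rewrite mem_filter => /andP[].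
- by apply: sub; rewrite // absz_gt0 numq_eq0.
- by apply: sub; rewrite // absz_gt0 denq_eq0.
Qed.

End StandardPlaces.

(** * Heights of monomial images *)

Section HeightOver.
Variables (R : realType) (K : fieldExtType rat) (N : nat).
Implicit Types (z : 'rV[K]_N).

Local Notation affine z := (row_mx (1 : 'rV[K]_1) z).
Local Notation local_max v x := (\big[Num.max/0]_i v (x 0 i)).

Lemma local_max_affine (v : K -> R) z : is_absolute_value v ->
  [/\ 1 <= local_max v (affine z), forall j, v (z 0 j) <= local_max v (affine z) &
   forall T, 1 <= T -> (forall j, v (z 0 j) <= T) -> local_max v (affine z) <= T].
Proof.
move=> hv; split.
- rewrite (le_trans _ (le_bigmax _ _ (lshift N ord0)))// row_mxEl mxE /=.
  by rewrite (av1 hv).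
- by move=> j; rewrite (le_trans _ (le_bigmax _ _ (rshift 1 j)))// row_mxEr.
- move=> T T1 hT; apply/bigmax_leP; split=> [|i _]; first exact: le_trans T1.
  by rewrite mxE; case: splitP => [k _|k _] //; rewrite (ord1 k) mxE (av1 hv).
Qed.

Lemma exists_affine_places (s : seq K) : all (fun y => y != 0) s ->
  exists l : seq (K -> R), [/\ uniq l, forall v, v \in l -> places v,
    forall v y, places v -> v \notin l -> y \in s -> v y = 1 &
    forall y, y \in s -> \sum_(v <- l) (local_degree v)%:R * ln (v y) = 0].
Proof.
move=> /allP s0.
have [ev [f [fm sf ev_surj ev_eq0]]] := number_field_presentation K.
have [pl [pu pp pb]] := exists_place_lists R fm sf ev_surj ev_eq0.
suff [B0 hB] : exists B0, forall y, y \in s -> forall B, (B0 <= B)%N ->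
     (forall v, places v -> v \notin pl B -> v y = 1) /\
     \sum_(v <- pl B) (local_degree v)%:R * ln (v y) = 0.
  exists (pl B0); split => // [v|v y pv vl ys|y ys]; first exact: pp.
    by have [+ _] := hB y ys B0 (leqnn _); exact.
  by have [] := hB y ys B0 (leqnn _).
elim: s s0 => [|y s IH] s0; first by exists 0%N.
have [|B1 h1] := IH; first by move=> x xs; apply: s0; rewrite inE xs orbT.
have [B2 h2] := pb y (s0 y (mem_head _ _)).
exists (maxn B1 B2) => y'; rewrite inE => /orP[/eqP ->|y's] B; rewrite geq_max => /andP[b1 b2].
  exact: h2.
exact: h1.
Qed.

Lemma height_over_seq z (l : seq (K -> R)) : uniq l -> (forall v, v \in l -> places v) ->
  (forall v j, places v -> v \notin l -> v (z 0 j) = 1) ->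
  height_over R (affine z) =
  (\sum_(v <- l) (local_degree v)%:R * ln (local_max v (affine z))) / (\dim {:K})%:R.
Proof.
move=> lu lp l1; rewrite /height_over; congr (_ / _).
rewrite [in RHS]fsbig_seq//; apply: esym; apply: fsbig_widen => [v|v [pv vl]]; first exact: lp.
have [h1 _ h3] := local_max_affine z pv.1.
rewrite /= (_ : local_max v _ = 1) ?ln1 ?mulr0//.
apply/le_anti; rewrite h1 andbT h3// => j.
by rewrite l1//; apply/negP.
Qed.

Definition torus_monomial (A : 'M[int]_N) z : 'rV[K]_N := \row_i \prod_j z 0 j ^ A i j.

Lemma height_over_affine_ge0 z : (forall j, z 0 j != 0) -> 0 <= height_over R (affine z).
Proof.
move=> z0; rewrite /height_over mulr_ge0 ?invr_ge0//.
rewrite fsumr_ge0// => v [hv _]; rewrite mulr_ge0// ln_ge0//.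
by have [] := local_max_affine z hv.
Qed.

Lemma height_over_monomial (A : 'M[int]_N) (b : R) z : (forall j, z 0 j != 0) -> 0 <= b ->
  (forall i j, `|(A i j)%:~R| <= b) ->
  height_over R (affine (torus_monomial A z)) <= (2 * N%:R * b) * height_over R (affine z).
Proof.
move=> z0 b0 Ab.
have s0 : all (fun y => y != 0) [seq z 0 j | j <- enum 'I_N] by apply/allP => _ /mapP [j _ ->].
have [l [lu lp l1 lprod]] := exists_affine_places s0.
have zs j : z 0 j \in [seq z 0 j | j <- enum 'I_N] by apply/map_f; rewrite mem_enum.
have vz (v : K -> R) j : is_absolute_value v -> 0 < v (z 0 j) by move=> hv; rewrite (av_gt0 hv).
have vmono (v : K -> R) i : is_absolute_value v ->
    v (torus_monomial A z 0 i) = \prod_j v (z 0 j) ^ A i j.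
  by move=> hv; rewrite mxE (av_prod hv); apply: eq_bigr => j _; rewrite (avXz hv).
rewrite (height_over_seq lu lp) => [|v i pv vl]; last first.
  by rewrite (vmono _ _ pv.1) big1// => j _; rewrite (l1 _ _ pv vl)// exp1rz.
rewrite (height_over_seq lu lp) => [|v i pv vl]; last exact: l1.
rewrite mulrA ler_wpM2r ?invr_ge0//.
have step1 v : v \in l -> ln (local_max v (affine (torus_monomial A z))) <= b * \sum_j `|ln (v (z 0 j))|.
  move=> vl; have hv := (lp _ vl).1.
  have S0 : 0 <= b * \sum_j `|ln (v (z 0 j))| by rewrite mulr_ge0// sumr_ge0.
  have [h1 h2 h3] := local_max_affine (torus_monomial A z) hv.
  rewrite -ler_expR lnK ?posrE ?(lt_le_trans ltr01)//.
  apply: h3 => [|i]; first by rewrite -expR0 ler_expR.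
  have p0 : 0 < v (torus_monomial A z 0 i).
    by rewrite (vmono _ _ hv) prodr_gt0// => j _; rewrite exprz_gt0// vz.
  rewrite -[leLHS]lnK ?posrE// ler_expR (vmono _ _ hv) ln_prod_seq; last first.
    by move=> j _; rewrite exprz_gt0// vz.
  rewrite mulr_sumr; apply: ler_sum => j _; rewrite ln_exprz ?vz//.
  by rewrite (le_trans (ler_norm _))// normrM ler_wpM2r.
(* [|t| + t = 2 max(t, 0)], and the sum of the terms [t] vanishes. *)
have step2 j : \sum_(v <- l) (local_degree v)%:R * `|ln (v (z 0 j))| <=
    2 * \sum_(v <- l) (local_degree v)%:R * ln (local_max v (affine z)).
  have -> : \sum_(v <- l) (local_degree v)%:R * `|ln (v (z 0 j))| =
     \sum_(v <- l) ((local_degree v)%:R * `|ln (v (z 0 j))| + (local_degree v)%:R * ln (v (z 0 j))).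
    by rewrite big_split /= lprod ?addr0.
  rewrite mulr_sumr.
  rewrite big_seq [leRHS]big_seq; apply: ler_sum => v vl; have hv := (lp _ vl).1.
  rewrite -mulrDr mulrCA ler_wpM2l//.
  have [h1 h2 _] := local_max_affine z hv.
  have m0 : 0 <= ln (local_max v (affine z)) by rewrite ln_ge0.
  have mz : ln (v (z 0 j)) <= ln (local_max v (affine z)).
    by rewrite ler_ln ?posrE ?vz// (lt_le_trans ltr01).
  by case: (ger0P (ln (v (z 0 j)))) => h; lra.
apply: (@le_trans _ _ (\sum_(v <- l) (local_degree v)%:R * (b * \sum_j `|ln (v (z 0 j))|))).
  rewrite big_seq [leRHS]big_seq; apply: ler_sum => v vl.
  by rewrite ler_wpM2l// step1.
have -> : \sum_(v <- l) (local_degree v)%:R * (b * \sum_j `|ln (v (z 0 j))|) =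
    b * \sum_j \sum_(v <- l) (local_degree v)%:R * `|ln (v (z 0 j))|.
  rewrite exchange_big /= mulr_sumr; apply: eq_bigr => v _.
  by rewrite mulrCA mulr_sumr.
set X := \sum_(v <- l) _ in step2 *.
apply: (@le_trans _ _ (b * \sum_(j < N) 2 * X)).
  by rewrite ler_wpM2l//; apply: ler_sum => j _; exact: step2.
rewrite sumr_const card_ord -mulr_natl le_eqVlt; apply/orP; left; apply/eqP; ring.
Qed.

End HeightOver.

Section WeilHeight.
Variables (R : realType) (N : nat).
Implicit Types (P : 'rV[algC]_N).

Lemma affine_preimage (K : fieldExtType rat) (iota : {rmorphism K -> algC}) P (y : 'rV[K]_(1 + N)) :
  map_mx iota y = proj_coords P -> exists2 z, y = row_mx 1 z & map_mx iota z = P.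
Proof.
move=> E; exists (rsubmx y); last by rewrite map_rsubmx E row_mxKr.
rewrite -[LHS]hsubmxK; congr row_mx; apply: (map_mx_inj (f := iota)).
by rewrite map_lsubmx E row_mxKl map_mx1.
Qed.

Lemma exists_number_field P : exists (K : fieldExtType rat) (iota : {rmorphism K -> algC})
  (y : 'rV[K]_(1 + N)), map_mx iota y = proj_coords P.
Proof.
have [K [iota [s [sE _]]]] := num_field_exists [seq P 0 j | j <- enum 'I_N].
exists K, iota, (row_mx 1 (\row_j s`_j)).
rewrite map_row_mx map_mx1; congr row_mx; apply/rowP => j; rewrite !mxE.
rewrite -(nth_map _ 0); last by rewrite -(size_map iota) sE size_map size_enum_ord.
by rewrite sE (nth_map j) ?size_enum_ord// nth_ord_enum.
Qed.

Lemma torus_height_has_lbound P : in_torus P ->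
  has_lbound [set r | exists (K : fieldExtType rat) (iota : {rmorphism K -> algC})
                      (y : 'rV[K]_(1 + N)),
         map_mx iota y = proj_coords P /\ r = height_over R y].
Proof.
move=> P0; exists 0 => _ [K [iota [y [yE ->]]]].
have [z -> zE] := affine_preimage yE; apply: height_over_affine_ge0 => j.
by rewrite -(fmorph_eq0 iota); have := P0 j; rewrite -zE mxE.
Qed.

Lemma torus_height_ge0 P : in_torus P -> 0 <= torus_height R P.
Proof.
move=> P0; apply: lb_le_inf.
  by have [K [iota [y yE]]] := exists_number_field P; exists (height_over R y), K, iota, y.
move=> _ [K [iota [y [yE ->]]]].
have [z -> zE] := affine_preimage yE; apply: height_over_affine_ge0 => j.
by rewrite -(fmorph_eq0 iota); have := P0 j; rewrite -zE mxE.
Qed.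

Lemma torus_height_monomial (A : 'M[int]_N) (b : R) P : in_torus P -> 1 <= b ->
  (forall i j, `|(A i j)%:~R| <= b) ->
  torus_height R (monomial_map A P) <= (2 * N%:R + 1) * b * torus_height R P.
Proof.
move=> P0 b1 Ab; have b0 : 0 < b := lt_le_trans ltr01 b1.
have c0 : 0 < (2 * N%:R + 1) * b by rewrite mulr_gt0// ltr_wpDl// mulr_ge0.
rewrite mulrC -ler_pdivrMr//; apply: lb_le_inf.
  by have [K [iota [y yE]]] := exists_number_field P; exists (height_over R y), K, iota, y.
move=> _ [K [iota [y [yE ->]]]]; have [z -> zE] := affine_preimage yE.
have z0 j : z 0 j != 0 by rewrite -(fmorph_eq0 iota); have := P0 j; rewrite -zE mxE.
have h0 := height_over_affine_ge0 R z0.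
rewrite ler_pdivrMr//; apply: (@le_trans _ _ (2 * N%:R * b * height_over R (row_mx 1 z))); last first.
  by rewrite mulrC ler_wpM2l// ler_wpM2r ?lerDl// ltW.
apply: le_trans (height_over_monomial z0 (ltW b0) Ab); apply: ge_inf.
  apply: torus_height_has_lbound => i; rewrite mxE; apply/prodf_neq0 => j _.
  by rewrite expfz_neq0.
exists K, iota, (row_mx 1 (torus_monomial A z)); split=> //.
rewrite map_row_mx map_mx1; congr row_mx; apply/rowP => i; rewrite !mxE rmorph_prod.
by apply: eq_bigr => j _; rewrite -zE mxE fmorphXz.
Qed.

End WeilHeight.

(** * Degree of a monomial map *)

Section MonomialDivisors.
Variables (F : fieldType) (n : nat).
Implicit Types p q g : mpoly n F.

Lemma mpolyX_neq0 m : mpolyX F m != 0 :> mpoly n F.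
Proof. by rewrite -msupp_eq0 msuppX. Qed.

Lemma mlead0_const p : mlead p = @mnm0 n -> p = mpolyC n (mcoeff (@mnm0 n) p).
Proof.
have [->|p0] := eqVneq p 0; first by rewrite mcoeff0 mpolyC0.
by move=> l0; apply: msize1_polyC; rewrite -mlead_deg// l0 mdeg0.
Qed.

Lemma mlead0_unit p : p != 0 -> mlead p = @mnm0 n -> p \is a GRing.unit.
Proof.
move=> p0 /mlead0_const pE; rewrite unfold_in /= /mpoly_unit -pE eqxx /= unitfE.
by apply: contraNneq p0 => c0; rewrite pE c0 mpolyC0.
Qed.

Lemma unit_mlead p : p \is a GRing.unit -> mlead p = @mnm0 n.
Proof. by rewrite unfold_in /= => /andP[/eqP -> _]; rewrite mleadC. Qed.

Lemma monomial_divisor q g m : mpolyX F m = q * g -> g != 0 /\ lem (mlead g) m.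
Proof.
move=> E; have X0 := mpolyX_neq0 m.
have q0 : q != 0 by apply: contraNneq X0 => q0; rewrite E q0 mul0r.
have g0 : g != 0 by apply: contraNneq X0 => g0; rewrite E g0 mulr0.
split=> //.
have lead : m = mnm_add (mlead q) (mlead g) by rewrite -mleadM// -E mleadXm.
by rewrite lead; exact: lem_addl.
Qed.

(* If the monomials [m i] have no common variable, then [X^(m 0)] divides [f] *)
(* as soon as it divides every [f * X^(m i)].                                *)
Lemma monomial_ratio k (m : 'I_k.+1 -> multinom n) (f : 'I_k.+1 -> mpoly n F) :
  (forall j, exists i, m i j = 0%N) ->
  (forall i, f i * mpolyX F (m ord0) = f ord0 * mpolyX F (m i)) ->
  exists q, forall i, f i = q * mpolyX F (m i).
Proof.
move=> m0 fE.
have ge u : u \in msupp (f ord0) -> lem (m ord0) u.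
  move=> us; apply/mnm_lepP => j; have [i mij] := m0 j.
  have : mnm_add (m i) u \in msupp (f i * mpolyX F (m ord0)).
    by rewrite fE (perm_mem (msuppMX _ _)) map_f.
  rewrite (perm_mem (msuppMX _ _)) => /mapP [u' _ /mnmP /(_ j)].
  by rewrite !mnmDE mij add0n => ->; rewrite leq_addr.
pose q := \sum_(u <- msupp (f ord0)) mcoeff u (f ord0) *: mpolyX F (mnm_sub u (m ord0)).
have q0 : f ord0 = q * mpolyX F (m ord0).
  rewrite {1}[f ord0]mpolyE mulr_suml big_seq [RHS]big_seq; apply: eq_bigr => u us.
  by rewrite -scalerAl -mpolyXD submK// ge.
exists q => i; apply: (mulIf (mpolyX_neq0 (m ord0))).
by rewrite fE q0 -!mulrA [mpolyX F (m i) * _]mulrC.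
Qed.

End MonomialDivisors.

Section TorusDensity.
Variables (F : numFieldType) (N : nat).

Lemma base_expansion_inj K (a b : 'I_N -> nat) :
  (forall j, (a j < K)%N) -> (forall j, (b j < K)%N) ->
  (\sum_j a j * K ^ j = \sum_j b j * K ^ j)%N -> a =1 b.
Proof.
elim: N a b => [|k IH] a b ha hb; first by move=> _ [].
have h (c : 'I_k.+1 -> nat) : (\sum_j c j * K ^ j = c ord0 + K * \sum_(j < k) c (lift ord0 j) * K ^ j)%N.
  rewrite big_ord_recl expn0 muln1 big_distrr /=; congr addn; apply: eq_bigr => j _.
  by rewrite /bump /= add1n expnS mulnCA.
rewrite !h => E.
have K0 : (0 < K)%N by apply: leq_ltn_trans (ha ord0).
have E0 : a ord0 = b ord0.
  by have := congr1 (modn^~ K) E; rewrite /= ![(_ + K * _)%N]addnC ![(K * _)%N]mulnC !modnMDl !modn_small.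
move: E; rewrite E0 => /addnI /eqP; rewrite eqn_pmul2l// => /eqP E j.
case: (unliftP ord0 j) => [j' ->|-> //].
by apply: (IH (fun j => a (lift ord0 j)) (fun j => b (lift ord0 j))).
Qed.

Lemma poly_natr_roots (p : {poly F}) : (forall i, p.[i.+1%:R] = 0) -> p = 0.
Proof.
move=> h; apply: (@roots_geq_poly_eq0 _ _ [seq i.+1%:R | i <- iota 0 (size p)]).
- by apply/allP => _ /mapP [i _ ->]; apply/rootP.
- rewrite map_inj_uniq ?iota_uniq// => i i' /eqP.
  by rewrite eqr_nat => /eqP [].
- by rewrite size_map size_iota.
Qed.

(* Kronecker substitution: [P j = t ^ (D.+1 ^ j)] separates the monomials of  *)
(* degree [D].                                                               *)
Lemma torus_density D (G : mpoly (1 + N) F) : G \is ishomog1 D mdeg ->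
  (forall P : 'rV[F]_N, (forall j, P 0 j != 0) ->
     meval (fun k => (row_mx 1 P : 'rV_(1 + N)) 0 k) G = 0) -> G = 0.
Proof.
move=> /dhomogP homG h.
have hom m : m \in msupp G -> mdeg m = D by exact: homG.
pose wt (m : multinom (1 + N)) := (\sum_(j < N) m (rshift 1 j) * D.+1 ^ j)%N.
pose p : {poly F} := \sum_(m <- msupp G) mcoeff m G *: 'X^(wt m).
have deg (m : multinom (1 + N)) : mdeg m = (m (lshift N ord0) + \sum_j m (rshift 1 j))%N.
  by rewrite mdegE big_split_ord /= big_ord1.
have wt_inj m m' : m \in msupp G -> m' \in msupp G -> wt m = wt m' -> m = m'.
  move=> mG m'G /base_expansion_inj E.
  have lt m1 j : m1 \in msupp G -> (m1 (rshift 1 j) < D.+1)%N.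
    move=> /hom; rewrite deg (bigD1 j)//= ltnS => <-.
    by rewrite addnCA leq_addr.
  have {}E := E (fun j => lt _ j mG) (fun j => lt _ j m'G).
  apply/mnmP => k; case: (split_ordP k) => [i ->|j ->]; last exact: E.
  rewrite (ord1 i); have := hom _ mG; rewrite -(hom _ m'G) !deg.
  by under eq_bigr do rewrite E; move=> /addIn.
have p0 : p = 0.
  apply: poly_natr_roots => i; set t := i.+1%:R.
  have t0 : t != 0 :> F by rewrite pnatr_eq0.
  rewrite -(h (\row_j t ^+ (D.+1 ^ j))) => [|j]; last by rewrite mxE expf_neq0.
  rewrite /p horner_sum mevalE; apply: eq_bigr => m _.
  rewrite hornerZ hornerXn big_split_ord big_ord1 /=; congr (_ * _).
  rewrite row_mxEl mxE expr1n mul1r -prodrXr; apply: eq_bigr => j _.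
  by rewrite row_mxEr mxE -exprM mulnC.
apply/mpolyP => m; rewrite mcoeff0; apply/eqP; rewrite mcoeff_eq0; apply/negP => mG.
have := congr1 (fun p : {poly F} => p`_(wt m)) p0; rewrite /= coef0 coef_sum (bigD1_seq m)//=.
rewrite coefZ coefXn eqxx mulr1 big_seq_cond big1 ?addr0; last first.
  move=> m' /andP[m'G m'm]; rewrite coefZ coefXn; case: eqP => [/wt_inj E|]; last by rewrite mulr0.
  by rewrite (E mG m'G) eqxx in m'm.
by move/eqP; rewrite mcoeff_eq0 mG.
Qed.

End TorusDensity.

Section MonomialMapDegree.
Variables (N : nat) (A : 'M[int]_N).
Implicit Types i k : 'I_(1 + N).

(* Exponents of the projective map, all rows having sum zero, and the shifts *)
(* that clear the denominators.                                              *)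
Definition homog_exp i k : int :=
  match fintype.split i, fintype.split k with
  | inl _, _ => 0
  | inr i', inl _ => - \sum_j A i' j
  | inr i', inr k' => A i' k'
  end.

Definition exp_shift k : nat := \max_i `|(Num.min 0 (homog_exp i k))%R|%N.

Definition torus_degree : nat := \sum_k exp_shift k.

Definition homog_monomial i : multinom (1 + N) :=
  Multinom (mktuple (fun k => `|(homog_exp i k + (exp_shift k)%:Z)%R|%N)).

Lemma homog_exp_row0 k : homog_exp (lshift N ord0) k = 0.
Proof. by rewrite /homog_exp (unsplitK (inl _)). Qed.

Lemma homog_exp_col0 (i : 'I_N) : homog_exp (rshift 1 i) (lshift N ord0) = - \sum_j A i j.
Proof. by rewrite /homog_exp (unsplitK (inr _)) (unsplitK (inl _)). Qed.

Lemma homog_expE (i j : 'I_N) : homog_exp (rshift 1 i) (rshift 1 j) = A i j.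
Proof. by rewrite /homog_exp !(unsplitK (inr _)). Qed.

Lemma exp_shift_ge i k : - homog_exp i k <= (exp_shift k)%:Z.
Proof.
have : (`|(Num.min 0 (homog_exp i k))%R|%N <= exp_shift k)%N by exact: (leq_bigmax i).
by case: (leP 0 (homog_exp i k)) => h; lia.
Qed.

Lemma exp_shift_attained k : exists i, homog_exp i k + (exp_shift k)%:Z = 0.
Proof.
have [|i E] := @bigop.eq_bigmax _ (fun i => `|(Num.min 0 (homog_exp i k))%R|%N); first by rewrite card_ord.
have {}E : exp_shift k = `|(Num.min 0 (homog_exp i k))%R|%N := E.
have [h|h] := leP 0 (homog_exp i k); last first.
  by exists i; rewrite E min_r ?ltW//; lia.
by exists (lshift N ord0); rewrite homog_exp_row0 E min_l.
Qed.

Lemma homog_monomialE i k : (homog_monomial i k)%:Z = homog_exp i k + (exp_shift k)%:Z.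
Proof. by rewrite mnmE gez0_abs//; have := exp_shift_ge i k; lia. Qed.

Lemma homog_exp_sum i : \sum_k homog_exp i k = 0.
Proof.
case: (split_ordP i) => [j ->|j ->].
  by rewrite big1// => k _; rewrite (ord1 j) homog_exp_row0.
rewrite big_split_ord /= big_ord1 homog_exp_col0 addrC; apply/eqP; rewrite subr_eq0; apply/eqP.
by apply: eq_bigr => k _; rewrite homog_expE.
Qed.

Lemma mdeg_homog_monomial i : mdeg (homog_monomial i) = torus_degree.
Proof.
apply/eqP; rewrite -eqz_nat mdegE /torus_degree !(big_morph Posz PoszD (erefl _)); apply/eqP.
under eq_bigr do rewrite homog_monomialE.
by rewrite big_split /= homog_exp_sum add0r.
Qed.

Lemma meval_homog_monomial (P : 'rV[algC]_N) i : in_torus P ->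
  meval (fun k => proj_coords P 0 k) (mpolyX algC (homog_monomial i)) =
  (\prod_k proj_coords P 0 k ^+ exp_shift k) * proj_coords (monomial_map A P) 0 i.
Proof.
move=> P0; have x0 k : proj_coords P 0 k != 0.
  by rewrite mxE; case: fintype.split => j; rewrite ?(ord1 j) ?mxE ?oner_neq0.
rewrite mevalX -[RHS]mulrC.
have -> : proj_coords (monomial_map A P) 0 i = \prod_k proj_coords P 0 k ^ homog_exp i k.
  case: (split_ordP i) => [j ->|j ->].
    rewrite /proj_coords row_mxEl (ord1 j) mxE eqxx big1// => k _.
    by rewrite homog_exp_row0 expr0z.
  rewrite /proj_coords row_mxEr mxE big_split_ord big_ord1 row_mxEl mxE eqxx exp1rz /= mul1r.
  by apply: eq_bigr => k _; rewrite row_mxEr homog_expE.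
rewrite -big_split; apply: eq_bigr => k _.
by rewrite /= exprnP homog_monomialE expfzDr.
Qed.

Lemma torus_degree_ge (i j : 'I_N) : (`|A i j| <= torus_degree)%N.
Proof.
have h1 : (homog_monomial (rshift 1 i) (rshift 1 j) <= torus_degree)%N.
  by rewrite -(mdeg_homog_monomial (rshift 1 i)) mdegE (bigD1 (rshift 1 j))//= leq_addr.
have h2 : (exp_shift (rshift 1 j) <= torus_degree)%N.
  by rewrite /torus_degree (bigD1 (rshift 1 j))//= leq_addr.
have := homog_monomialE (rshift 1 i) (rshift 1 j); rewrite homog_expE.
have := exp_shift_ge (rshift 1 i) (rshift 1 j); rewrite homog_expE.
lia.
Qed.

Lemma torus_degree_le (b : nat) : (forall i j : 'I_N, (`|A i j| <= b)%N) -> (torus_degree <= 2 * N * b)%N.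
Proof.
move=> Ab; rewrite /torus_degree big_split_ord big_ord1 /= mul2n -addnn mulnDl.
have habs i k (m : nat) : `|homog_exp i k| <= m%:Z -> (`|(Num.min 0 (homog_exp i k))%R| <= m)%N.
  by case: (leP 0 (homog_exp i k)) => h; lia.
apply: leq_add.
  apply/bigmax_leqP => i _; apply: habs; case: (split_ordP i) => [j ->|j ->].
    by rewrite (ord1 j) homog_exp_row0.
  rewrite homog_exp_col0 normrN (le_trans (ler_norm_sum _ _ _))//.
  apply: (@le_trans _ _ (\sum_(k < N) b%:Z)); first by apply: ler_sum => k _; have := Ab j k; lia.
  by rewrite sumr_const card_ord -mulr_natl; lia.
rewrite -[X in (X * b)%N](card_ord N) -sum_nat_const; apply: leq_sum => j _.
apply/bigmax_leqP => i _; apply: habs; case: (split_ordP i) => [k ->|k ->].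
  by rewrite (ord1 k) homog_exp_row0.
by rewrite homog_expE; have := Ab k j; lia.
Qed.

Lemma homog_monomial_homog i : mpolyX algC (homog_monomial i) \is ishomog1 torus_degree mdeg.
Proof. by rewrite dhomogX; apply/eqP; exact: mdeg_homog_monomial. Qed.

Lemma homog_presentation :
  is_homogeneous_presentation (monomial_map A) torus_degree (fun i => mpolyX algC (homog_monomial i)).
Proof.
split.
- by move=> i; exact: homog_monomial_homog.
- move=> g hg.
  have [g0 _] : g != 0 /\ lem (mlead g) (homog_monomial ord0).
    by have [q qE] := hg ord0; apply: monomial_divisor qE.
  apply: mlead0_unit => //; apply/mnmP => k; have [i ik] := exp_shift_attained k.
  have [q qE] := hg i; have [_ /mnm_lepP /(_ k)] := monomial_divisor qE.
  have -> : homog_monomial i k = 0%N by have := homog_monomialE i k; lia.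
  by rewrite leqn0 mnm0E => /eqP.
- move=> P P0; exists (\prod_k proj_coords P 0 k ^+ exp_shift k) => i.
  exact: meval_homog_monomial.
Qed.

Lemma homog_presentation_degree d G :
  is_homogeneous_presentation (monomial_map A) d G -> d = torus_degree.
Proof.
case=> Gh Gu Gm.
have rel i : G i * mpolyX algC (homog_monomial ord0) = G ord0 * mpolyX algC (homog_monomial i).
  apply/eqP; rewrite -subr_eq0; apply/eqP; apply: (@torus_density _ _ (d + torus_degree)).
    by apply: rpredB; apply: dhomogM; rewrite ?Gh ?homog_monomial_homog.
  move=> P P0; have [c cE] := Gm P P0.
  rewrite mevalB !mevalM; rewrite -/(proj_coords P) !cE !meval_homog_monomial//; ring.
have cover k : exists i, homog_monomial i k = 0%N.
  have [i ik] := exp_shift_attained k; exists i.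
  by have := homog_monomialE i k; lia.
have [q qE] := @monomial_ratio _ _ N homog_monomial G cover rel.
have qu : q \is a GRing.unit by apply: Gu => i; exists (mpolyX algC (homog_monomial i)); rewrite qE mulrC.
have qC := mlead0_const (unit_mlead qu).
have q0 : q != 0 by apply: contraTneq qu => ->; rewrite unitr0.
have G0 : G ord0 != 0 by rewrite qE mulf_neq0// mpolyX_neq0.
apply: (dhomog_uniq G0 (Gh ord0)).
by rewrite qE qC mul_mpolyC dhomogZ// homog_monomial_homog.
Qed.

Lemma map_degree_monomial (f : 'rV[algC]_N -> 'rV[algC]_N) :
  (forall P, in_torus P -> f P = monomial_map A P) -> map_degree f = torus_degree.
Proof.
move=> fE.
have pE d G : is_homogeneous_presentation f d G <-> is_homogeneous_presentation (monomial_map A) d G.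
  by split=> -[h1 h2 h3]; split=> // P P0; have := h3 P P0; rewrite fE.
have ex : exists d, exists G, is_homogeneous_presentation f d G.
  by exists torus_degree; eexists; apply/pE; exact: homog_presentation.
by have [G /pE hG] := xgetPex 0%N ex; exact: homog_presentation_degree hG.
Qed.

End MonomialMapDegree.

(** * Growth of matrix powers *)

Section Binomial.
Variable R : realType.

Lemma binomial_lower n k : (2 * k <= n)%N -> (n ^ k <= 2 ^ k * k`! * 'C(n, k))%N.
Proof.
move=> kn; rewrite -mulnA [(k`! * _)%N]mulnC bin_ffact.
apply: (@leq_trans ((2 * (n - k)) ^ k)); first by case: (k) kn => // k' kn; rewrite leq_exp2r//; lia.
rewrite expnMn leq_mul2l; apply/orP; right.
have : forall t, (t <= k)%N -> ((n - k) ^ t <= n ^_ t)%N.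
  elim=> [|t IH] tk; first by rewrite expn0 ffactn0.
  rewrite expnSr ffactnSr leq_mul ?IH ?(ltnW tk)//; lia.
exact.
Qed.

Lemma bin_le_exp n k : ('C(n, k) <= n ^ k)%N.
Proof.
apply: (@leq_trans (n ^_ k)); first by rewrite -bin_ffact leq_pmulr// fact_gt0.
elim: k => [|k IH]; first by rewrite ffactn0 expn0.
by rewrite ffactnSr expnSr leq_mul// leq_subr.
Qed.

Lemma exp_poly_bounded (t : R) k : 0 <= t -> t < 1 ->
  exists C : R, forall n : nat, n%:R ^+ k * t ^+ n <= C.
Proof.
move=> t0 t1.
have [->|tn0] := eqVneq t 0.
  exists 1 => -[|n]; last by rewrite expr0n mulr0.
  by rewrite expr0 mulr1; case: k => [|k]; rewrite ?expr0// expr0n.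
have tp : 0 < t by rewrite lt0r tn0.
pose s := t^-1 - 1.
have s0 : 0 < s by rewrite subr_gt0 invf_gt1.
pose D : R := (2 ^ k * k`!)%:R.
have D0 : 0 <= D by [].
exists (D / s ^+ k + (2 * k)%:R ^+ k) => n.
have [kn|nk] := leqP (2 * k) n; last first.
  apply: ler_wpDl; first by rewrite divr_ge0// exprn_ge0// ltW.
  rewrite -[leRHS]mulr1; apply: ler_pM; rewrite ?exprn_ge0 ?exprn_ile1 ?(ltW t1)//.
  by rewrite lerXn2r ?nnegrE// ler_nat ltnW.
apply: ler_wpDr; first by rewrite exprn_ge0.
have h1 : 'C(n, k)%:R * s ^+ k <= t ^- n.
  have -> : t ^- n = (1 + s) ^+ n by rewrite addrC subrK exprVn.
  have kn' : (k < n.+1)%N by lia.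
  rewrite [leRHS]exprDn (bigD1 (Ordinal kn'))//=; rewrite expr1n mul1r mulr_natl lerDl sumr_ge0// => i _.
  by rewrite mulrn_wge0// mulr_ge0 ?exprn_ge0 ?ltW.
have h2 : n%:R ^+ k <= D * 'C(n, k)%:R.
  by rewrite -natrX -natrM ler_nat binomial_lower.
rewrite ler_pdivlMr ?exprn_gt0//.
apply: (@le_trans _ _ (D * 'C(n, k)%:R * t ^+ n * s ^+ k)).
  by do 2 (rewrite ler_wpM2r ?exprn_ge0 ?(ltW s0)//).
rewrite -[leRHS]mulr1 -!mulrA ler_wpM2l// [t ^+ n * _]mulrC mulrA.
by rewrite -ler_pdivlMr ?exprn_gt0// div1r.
Qed.

Lemma growth_upper_term (r rho : R) k l : 0 < r -> 0 < rho -> r < rho \/ r = rho /\ (k <= l)%N ->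
  exists2 K : R, 0 <= K &
    forall n, (0 < n)%N -> 'C(n, k)%:R * r ^+ (n - k) <= K * n%:R ^+ l * rho ^+ n.
Proof.
move=> r0 rho0 hr.
suff [K K0 hK] : exists2 K : R, 0 <= K &
    forall n, (0 < n)%N -> n%:R ^+ k * r ^+ n <= K * n%:R ^+ l * rho ^+ n.
  exists (K / r ^+ k) => [|n n0]; first by rewrite divr_ge0// exprn_ge0// ltW.
  have [kn|nk] := leqP k n; last first.
    by rewrite bin_small// mul0r !mulr_ge0 ?invr_ge0 ?exprn_ge0// ltW.
  rewrite exprB ?unitfE ?gt_eqF// mulrA.
  have -> : K / r ^+ k * n%:R ^+ l * rho ^+ n = K * n%:R ^+ l * rho ^+ n / r ^+ k by ring.
  rewrite ler_pM2r ?invr_gt0 ?exprn_gt0// (le_trans _ (hK n n0))//.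
  by rewrite ler_wpM2r ?exprn_ge0 ?(ltW r0)// -natrX ler_nat bin_le_exp.
case: hr => [rr|[-> kl]]; last first.
  exists 1 => // n n0; rewrite mul1r ler_wpM2r ?exprn_ge0 ?(ltW rho0)//.
  by rewrite ler_weXn2l ?ler1n.
have [K hK] : exists K : R, forall n : nat, n%:R ^+ k * (r / rho) ^+ n <= K.
  by apply: exp_poly_bounded; rewrite ?divr_ge0 ?(ltW r0) ?(ltW rho0)// ltr_pdivrMr ?mul1r.
exists `|K| => // n n0.
apply: (@le_trans _ _ (`|K| * rho ^+ n)).
  by rewrite -ler_pdivrMr ?exprn_gt0// -mulrA -expr_div_n (le_trans (hK n))// ler_norm.
rewrite ler_wpM2r ?exprn_ge0 ?(ltW rho0)// ler_peMr// exprn_ege1// ler1n//.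
Qed.

Lemma growth_lower_term (rho : R) l (b : nat -> R) : 0 < rho -> (forall k, 0 <= b k) -> 0 < b l ->
  exists2 c : R, 0 < c & exists n0, forall n, (n0 <= n)%N ->
    c * n%:R ^+ l * rho ^+ n + \sum_(k < l) 'C(n, k)%:R * rho ^+ (n - k) * b k
      <= 'C(n, l)%:R * rho ^+ (n - l) * b l.
Proof.
move=> rho0 b0 bl.
pose D : R := (2 ^ l * l`!)%:R.
have D0 : 0 < D by rewrite ltr0n muln_gt0 expn_gt0 fact_gt0.
pose c1 := b l / rho ^+ l / D.
have c10 : 0 < c1 by rewrite !divr_gt0// exprn_gt0.
pose s := \sum_(k < l) b k / rho ^+ k.
have s0 : 0 <= s by apply: sumr_ge0 => k _; rewrite divr_ge0// exprn_ge0// ltW.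
exists (c1 / 2); first by rewrite divr_gt0.
exists (maxn (2 * l) (Num.truncn (2 * s / c1)).+1) => n; rewrite geq_max => /andP[ln tn].
have n0 : (0 < n)%N by apply: leq_ltn_trans tn.
have np : 0 < n%:R :> R by rewrite ltr0n.
have sn : s <= c1 / 2 * n%:R.
  have : 2 * s / c1 <= n%:R by rewrite (le_trans (ltW (truncnS_gt _)))// ler_nat.
  by rewrite ler_pdivrMr// => h; rewrite mulrAC ler_pdivlMr// mulrC [c1 * _]mulrC.
have rp k : 0 < rho ^+ k by rewrite exprn_gt0.
apply: (@le_trans _ _ (c1 * n%:R ^+ l * rho ^+ n)); last first.
  rewrite exprB ?unitfE ?gt_eqF//; last by lia.
  have -> : c1 * n%:R ^+ l * rho ^+ n = n%:R ^+ l / D * (rho ^+ n / rho ^+ l * b l) by rewrite /c1; ring.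
  rewrite -[leRHS]mulrA ler_wpM2r ?mulr_ge0 ?invr_ge0 ?(ltW (rp _)) ?(ltW bl)//.
  by rewrite ler_pdivrMr// mulrC -natrX -natrM ler_nat binomial_lower.
have -> : c1 * n%:R ^+ l * rho ^+ n = c1 / 2 * n%:R ^+ l * rho ^+ n + c1 / 2 * n%:R ^+ l * rho ^+ n by field.
rewrite lerD2l.
apply: (@le_trans _ _ (n%:R ^+ l / n%:R * rho ^+ n * s)); last first.
  have -> : c1 / 2 * n%:R ^+ l * rho ^+ n = n%:R ^+ l / n%:R * rho ^+ n * (c1 / 2 * n%:R).
    by field; rewrite gt_eqF.
  by rewrite ler_wpM2l// !mulr_ge0 ?invr_ge0 ?exprn_ge0 ?(ltW rho0).
rewrite mulr_sumr; apply: ler_sum => k _.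
have kl := ltn_ord k.
rewrite exprB ?unitfE ?gt_eqF//; last by lia.
have -> : n%:R ^+ l / n%:R * rho ^+ n * (b k / rho ^+ k) = n%:R ^+ l / n%:R * (rho ^+ n / rho ^+ k * b k) by ring.
rewrite -mulrA ler_wpM2r ?mulr_ge0 ?invr_ge0 ?(ltW (rp _))//.
rewrite ler_pdivlMr// (le_trans (_ : _ <= n%:R ^+ k * n%:R))//.
  by rewrite ler_wpM2r// -natrX ler_nat bin_le_exp.
by rewrite -exprSr ler_weXn2l// ler1n.
Qed.

End Binomial.

Section Spectral.
Variables (C : numClosedFieldType) (N : nat) (M : 'M[C]_N.+1).

Lemma spectral_decomposition : exists (m : nat) (lam : 'I_m -> C) (E : 'I_m -> 'M[C]_N.+1),
  [/\ forall t, root (char_poly M) (lam t), 1%:M = \sum_t E t &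
      forall t, E t *m (M - (lam t)%:M) ^+ N.+1 = 0].
Proof.
have [r rE] := closed_field_poly_normal (char_poly M).
have {}rE : char_poly M = \prod_(z <- r) ('X - z%:P).
  by rewrite rE (monicP (char_poly_monic M)) scale1r.
pose s := undup r.
pose lam (t : 'I_(size s)) := s`_t.
have lamr (t : 'I_(size s)) : lam t \in r by rewrite -mem_undup mem_nth.
exists (size s), lam.
have cop : {in xpredT &, forall i j : 'I_(size s), j != i ->
    coprimep (('X - (lam i)%:P) ^+ N.+1) (('X - (lam j)%:P) ^+ N.+1)}.
  move=> i j _ _ ij; rewrite coprimep_expl// coprimep_expr// coprimep_XsubC root_XsubC.
  by rewrite nth_uniq ?undup_uniq.
have dv : mxminpoly M %| \prod_t ('X - (lam t)%:P) ^+ N.+1.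
  apply: dvdp_trans (mxminpoly_dvd_char M) _.
  have szr : size r = N.+1 by have := size_char_poly M; rewrite rE size_prod_XsubC => -[].
  rewrite rE prodrXl -szr.
  have : {subset r <= s} by move=> z; rewrite mem_undup.
  elim: (r) => [|z r' IH] sub; first by rewrite big_nil dvd1p.
  rewrite big_cons exprS dvdp_mul ?IH//; last by move=> x xr; apply: sub; rewrite inE xr orbT.
  have zs : z \in s by apply: sub; rewrite mem_head.
  have zi : (index z s < size s)%N by rewrite index_mem.
  by rewrite (bigD1 (Ordinal zi))//= /lam /= nth_index// dvdp_mulIl.
have : (1%:M <= \sum_t geigenspace M (lam t))%MS.
  by rewrite -(kermxpoly_prod M cop) (kermxpoly_min dv) submx_refl.
move=> /sub_sumsmxP [u uE]; exists (fun t => u t *m geigenspace M (lam t)); split=> // t.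
  by rewrite rE root_prod_XsubC.
by rewrite geigenspaceE -mulmxA mulmx_ker mulmx0.
Qed.

End Spectral.

Section MatrixGrowth.
Variables (R : realType) (C : numClosedFieldType) (v : C -> R).
Hypotheses (hv : is_absolute_value v) (vn : forall n, v n%:R = n%:R).

Definition mx_norm1 m n (X : 'M[C]_(m, n)) : R := \sum_i \sum_j v (X i j).

Lemma mx_norm1_ge0 m n (X : 'M[C]_(m, n)) : 0 <= mx_norm1 X.
Proof. by apply: sumr_ge0 => i _; apply: sumr_ge0 => j _; exact: (av_ge0 hv). Qed.

Lemma mx_norm1_ge m n (X : 'M[C]_(m, n)) i j : v (X i j) <= mx_norm1 X.
Proof.
rewrite /mx_norm1 (bigD1 i)//= (bigD1 j)//= -addrA lerDl addr_ge0//.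
  by apply: sumr_ge0 => ? _; exact: (av_ge0 hv).
by apply: sumr_ge0 => ? _; apply: sumr_ge0 => ? _; exact: (av_ge0 hv).
Qed.

Lemma mx_norm1_gt0 m n (X : 'M[C]_(m, n)) : X != 0 -> 0 < mx_norm1 X.
Proof.
move=> X0; rewrite lt0r mx_norm1_ge0 andbT; apply: contraNneq X0 => X0.
apply/eqP/matrixP => i j; rewrite mxE; apply/eqP; rewrite -(av_eq0 hv).
by apply/eqP/le_anti; rewrite (av_ge0 hv) andbT -X0 mx_norm1_ge.
Qed.

Lemma mx_norm1_sum m n (I : finType) (P : pred I) (X : I -> 'M[C]_(m, n)) :
  mx_norm1 (\sum_(t | P t) X t) <= \sum_(t | P t) mx_norm1 (X t).
Proof.
rewrite exchange_big /=; apply: ler_sum => i _; rewrite exchange_big /=; apply: ler_sum => j _.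
by rewrite summxE (av_sum hv).
Qed.

Lemma mx_norm1D m n (X Y : 'M[C]_(m, n)) : mx_norm1 (X + Y) <= mx_norm1 X + mx_norm1 Y.
Proof.
rewrite -big_split; apply: ler_sum => i _; rewrite -big_split; apply: ler_sum => j _.
by rewrite mxE (avD hv).
Qed.

Lemma mx_norm1N m n (X : 'M[C]_(m, n)) : mx_norm1 (- X) = mx_norm1 X.
Proof. by apply: eq_bigr => i _; apply: eq_bigr => j _; rewrite mxE (avN hv). Qed.

Lemma mx_norm1Z m n c (X : 'M[C]_(m, n)) : mx_norm1 (c *: X) = v c * mx_norm1 X.
Proof.
rewrite /mx_norm1 mulr_sumr; apply: eq_bigr => i _; rewrite mulr_sumr; apply: eq_bigr => j _.
by rewrite mxE (avM hv).
Qed.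

Lemma mx_norm1M m n p (X : 'M[C]_(m, n)) (Y : 'M[C]_(n, p)) :
  mx_norm1 (X *m Y) <= mx_norm1 X * mx_norm1 Y.
Proof.
apply: (@le_trans _ _ (\sum_i \sum_j \sum_k v (X i k) * v (Y k j))).
  apply: ler_sum => i _; apply: ler_sum => j _; rewrite mxE (le_trans (av_sum hv _ _ _))//.
  by apply: ler_sum => k _; rewrite (avM hv).
rewrite /mx_norm1 mulr_suml; apply: ler_sum => i _; rewrite exchange_big mulr_suml /=.
apply: ler_sum => k _; rewrite -mulr_sumr ler_wpM2l ?(av_ge0 hv)//.
rewrite [leRHS](bigD1 k)//= lerDl sumr_ge0// => ? _; apply: sumr_ge0 => ? _.
exact: (av_ge0 hv).
Qed.

Section Growth.
Variables (N : nat) (M : 'M[C]_N.+1).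
Hypothesis M0 : \det M != 0.

Lemma mul_exp_expansion (E : 'M[C]_N.+1) c n : E *m (M - c%:M) ^+ N.+1 = 0 ->
  E *m M ^+ n = \sum_(k < N.+1) (c ^+ (n - k) *+ 'C(n, k)) *: (E *m (M - c%:M) ^+ k).
Proof.
move=> E0; pose G k := (c ^+ (n - k) *+ 'C(n, k)) *: (E *m (M - c%:M) ^+ k).
have -> : E *m M ^+ n = \sum_(k < n.+1) G k.
  rewrite -{1}[M](subrK c%:M) addrC exprDn_comm; last first.
    by rewrite /GRing.comm; apply: esym; exact: comm_mx_scalar.
  rewrite mulmx_sumr; apply: eq_bigr => k _.
  rewrite /G -rmorphXn /= -[_%:M * _]/(_%:M *m _) mul_scalar_mx -scaler_nat scalerA -scalemxAr.
  by rewrite mulr_natl.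
have Ga i : (n.+1 <= i)%N -> G i = 0 by move=> ni; rewrite /G bin_small// mulr0n scale0r.
have Gb i : (N.+1 <= i)%N -> G i = 0.
  by move=> ni; rewrite /G -(subnKC ni) exprD -[X in _ *m X]/(_ *m _) mulmxA E0 mul0mx scaler0.
rewrite -!(big_mkord xpredT G).
have [nN|/ltnW Nn] := leqP n.+1 N.+1.
  rewrite [RHS](big_cat_nat _ nN)//= (_ : \sum_(n.+1 <= i < N.+1) G i = 0) ?addr0//.
  by rewrite big_nat big1// => i /andP[h _]; exact: Ga.
rewrite [LHS](big_cat_nat _ Nn)//= (_ : \sum_(N.+1 <= i < n.+1) G i = 0) ?addr0//.
by rewrite big_nat big1// => i /andP[h _]; exact: Gb.
Qed.

Lemma matrix_power_growth : exists (rho : R) (l : nat) (c K : R), [/\ 0 < rho, 0 < c,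
  forall n, (0 < n)%N -> mx_norm1 (M ^+ n) <= K * n%:R ^+ l * rho ^+ n &
  exists n0, forall n, (n0 <= n)%N -> c * n%:R ^+ l * rho ^+ n <= mx_norm1 (M ^+ n)].
Proof.
have [m [lam [E [rlam E1 E0]]]] := spectral_decomposition M.
(* rho is the largest |lam p.1| and l the largest p.2 with |lam p.1| = rho,    *)
(* both over the p with B p != 0.                                              *)
pose B (p : 'I_m * 'I_N.+1) := E p.1 *m (M - (lam p.1)%:M) ^+ p.2.
have lam0 t : 0 < v (lam t).
  rewrite (av_gt0 hv); apply: contra_neq M0 => l0.
  have /rootP := rlam t; rewrite l0 horner_coef0 char_poly_det => /eqP.
  by rewrite mulf_eq0 signr_eq0 /= => /eqP.
have [p0 Bp0] : exists p, B p != 0.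
  have [t Et] : exists t, E t != 0.
    apply: contrapT => H; have /eqP := oner_neq0 ('M[C]_N.+1); apply.
    rewrite -[1]/(1%:M) E1 big1// => t _; apply/eqP/negPn/negP => Et.
    by apply: H; exists t.
  by exists (t, ord0); rewrite /B expr0 mulmx1.
have [p1 Bp1 max1] := @arg_maxP _ _ _ p0 (fun p => B p != 0) (fun p => v (lam p.1)) Bp0.
set rho := v (lam p1.1) in max1.
have [p2 /andP[Bp2 /eqP rp2] max2] := @arg_maxnP _ p1 (fun p => (B p != 0) && (v (lam p.1) == rho))
  (fun p => p.2) (introT andP (conj Bp1 (eqxx _))).
set l := (nat_of_ord p2.2) in max2.
have rho0 : 0 < rho by exact: lam0.
pose coef n (p : 'I_m * 'I_N.+1) : R := 'C(n, p.2)%:R * v (lam p.1) ^+ (n - p.2).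
have term n (p : 'I_m * 'I_N.+1) : mx_norm1 ((lam p.1 ^+ (n - p.2) *+ 'C(n, p.2)) *: B p) = coef n p * mx_norm1 (B p).
  by rewrite mx_norm1Z -mulr_natl (avM hv) vn (avX hv).
have expand t n : E t *m M ^+ n = \sum_(k : 'I_N.+1) (lam t ^+ (n - k) *+ 'C(n, k)) *: B (t, k).
  exact: mul_exp_expansion.
have [K hK] : {K : 'I_m * 'I_N.+1 -> R & forall p n, (0 < n)%N ->
    coef n p * mx_norm1 (B p) <= K p * n%:R ^+ l * rho ^+ n}.
  apply: (@choice _ _ (fun (p : 'I_m * 'I_N.+1) (K : R) => forall n, (0 < n)%N ->
    coef n p * mx_norm1 (B p) <= K * n%:R ^+ l * rho ^+ n)) => p.
  have [Bp|Bp] := eqVneq (B p) 0.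
    exists 0 => n _; rewrite Bp /mx_norm1 !mul0r big1 ?mulr0// => i _.
    by rewrite big1// => j _; rewrite mxE (av0 hv).
  have hp : v (lam p.1) < rho \/ v (lam p.1) = rho /\ (p.2 <= l)%N.
    have := max1 p Bp; rewrite /= le_eqVlt => /orP[/eqP vr|]; [right|by left].
    by split=> //; apply: (max2 p); rewrite Bp vr eqxx.
  have [K K0 hK] := growth_upper_term (lam0 p.1) rho0 hp.
  exists (K * mx_norm1 (B p)) => n n0.
  have -> : K * mx_norm1 (B p) * n%:R ^+ l * rho ^+ n = K * n%:R ^+ l * rho ^+ n * mx_norm1 (B p) by ring.
  by rewrite ler_wpM2r ?mx_norm1_ge0// hK.
pose b k : R := if insub k is Some k' then mx_norm1 (B (p2.1, k')) else 0.
have bE (k : 'I_N.+1) : b k = mx_norm1 (B (p2.1, k)) by rewrite /b valK.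
have b0 k : 0 <= b k by rewrite /b; case: insub => [k'|//]; exact: mx_norm1_ge0.
have bl : 0 < b l by rewrite bE -surjective_pairing mx_norm1_gt0.
have [c c0 [n0 hc]] := growth_lower_term rho0 b0 bl.
have e0 : 0 < mx_norm1 (E p2.1).
  apply: mx_norm1_gt0; apply: contraNneq Bp2 => Ep; by rewrite /B Ep mul0mx.
exists rho, l, (c / mx_norm1 (E p2.1)), (\sum_p K p); split=> //.
- by rewrite divr_gt0.
- move=> n n1; rewrite -[M ^+ n]mul1mx E1 mulmx_suml (le_trans (mx_norm1_sum _ _))//.
  apply: (@le_trans _ _ (\sum_t \sum_k K (t, k) * n%:R ^+ l * rho ^+ n)).
    apply: ler_sum => t _; rewrite expand (le_trans (mx_norm1_sum _ _))//.
    by apply: ler_sum => k _; rewrite (term n (t, k)) hK.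
  rewrite pair_big /= !mulr_suml; apply: ler_sum => -[t k] _ //=.
exists n0 => n /hc h.
have -> : c / mx_norm1 (E p2.1) * n%:R ^+ l * rho ^+ n = c * n%:R ^+ l * rho ^+ n / mx_norm1 (E p2.1) by ring.
rewrite ler_pdivrMr//; apply: (@le_trans _ _ (mx_norm1 (E p2.1 *m M ^+ n))); last first.
  by rewrite mulrC mx_norm1M.
pose T (k : 'I_N.+1) := (lam p2.1 ^+ (n - k) *+ 'C(n, k)) *: B (p2.1, k).
have TE : E p2.1 *m M ^+ n = T p2.2 + \sum_(k | k != p2.2) T k by rewrite expand (bigD1 p2.2).
have nT (k : 'I_N.+1) : mx_norm1 (T k) = 'C(n, k)%:R * rho ^+ (n - k) * b k.
  by rewrite /T (term n (p2.1, k)) bE /coef /= rp2.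
have le1 : mx_norm1 (T p2.2) <= mx_norm1 (E p2.1 *m M ^+ n) + \sum_(k | k != p2.2) mx_norm1 (T k).
  have -> : T p2.2 = E p2.1 *m M ^+ n + \sum_(k | k != p2.2) - T k.
    by rewrite TE sumrN addrK.
  rewrite (le_trans (mx_norm1D _ _))// lerD2l (le_trans (mx_norm1_sum _ _))//.
  by apply: ler_sum => k _; rewrite mx_norm1N.
have le2 : \sum_(k | k != p2.2) mx_norm1 (T k) = \sum_(k < l) 'C(n, k)%:R * rho ^+ (n - k) * b k.
  rewrite (big_ord_widen N.+1 (fun k => 'C(n, k)%:R * rho ^+ (n - k) * b k)); last exact: ltnW (ltn_ord p2.2).
  rewrite (bigID (fun k : 'I_N.+1 => (k < l)%N)) /= [X in _ + X]big1 ?addr0; last first.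
    move=> k /andP[kp kl]; rewrite nT bE (_ : B (p2.1, k) = 0).
      by rewrite /mx_norm1 big1 ?mulr0// => i _; rewrite big1// => j _; rewrite mxE (av0 hv).
    apply/eqP/negPn/negP => Bk; have := max2 (p2.1, k); rewrite Bk rp2 eqxx /= => /(_ isT) lk.
    by move: kp; rewrite -val_eqE /= eqn_leq lk leqNgt kl.
  apply: eq_big => [k|k _]; last exact: nT.
  by case: (ltnP k l) => kl; rewrite ?andbF// andbT -val_eqE /= ltn_eqF.
by move: h le1; rewrite -le2 (nT p2.2) -/l; lra.
Qed.

End Growth.
End MatrixGrowth.

(** * Dynamical degree and canonical height *)

Section GrowthInvariants.
Variables (R : realType) (d : nat -> R) (rho c K : R) (l : nat).
Hypotheses (rho0 : 0 < rho) (c0 : 0 < c).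
Hypothesis dle : forall n, (0 < n)%N -> d n <= K * n%:R ^+ l * rho ^+ n.
Hypothesis dge : exists n0, forall n, (n0 <= n)%N -> c * n%:R ^+ l * rho ^+ n <= d n.

Lemma powR_root (x : R) n : 0 <= x -> (0 < n)%N -> (x ^+ n) `^ n%:R^-1 = x.
Proof.
move=> x0 n0; rewrite -powR_mulrn// -powRrM divff ?powRr1//.
by rewrite pnatr_eq0 -lt0n.
Qed.

Lemma exp_dominates_poly (B t : R) k : 1 < t ->
  exists n0, forall n, (n0 <= n)%N -> B * n%:R ^+ k <= t ^+ n.
Proof.
move=> t1; have tp : 0 < t := lt_trans ltr01 t1.
have [D hD] : exists D : R, forall n : nat, n%:R ^+ k.+1 * t^-1 ^+ n <= D.
  by apply: exp_poly_bounded; rewrite ?invr_ge0 ?(ltW tp)// invf_lt1.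
have D0 : 0 <= D.
  by have := hD 0%N; rewrite expr0n mul0r.
exists (Num.truncn (`|B| * D)).+1 => n hn.
have n0 : (0 < n)%N by apply: leq_ltn_trans hn.
have np : 0 < n%:R :> R by rewrite ltr0n.
have BD : `|B| * D <= n%:R by rewrite (le_trans (ltW (truncnS_gt _)))// ler_nat.
apply: (@le_trans _ _ (`|B| * n%:R ^+ k)); first by rewrite ler_wpM2r ?exprn_ge0// ler_norm.
have := hD n; rewrite exprVn ler_pdivrMr ?exprn_gt0// exprSr => h.
rewrite -(ler_pM2r np) -mulrA (le_trans (ler_wpM2l _ h))// mulrA mulrC.
by rewrite ler_wpM2l// exprn_ge0// ltW.
Qed.

Lemma growth_root_limit : (fun n => d n `^ n%:R^-1) @ \oo --> rho.
Proof.
apply/cvgrPdist_le => e e0.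
pose s := Num.min (e / rho) (2^-1).
have s0 : 0 < s by rewrite lt_min divr_gt0//= invr_gt0.
have s1 : s <= 2^-1 by rewrite ge_min lexx orbT.
have se : rho * s <= e by rewrite mulrC -ler_pdivlMr// ge_min lexx.
have t1 : 1 < 1 + s by rewrite ltrDl.
have t2 : 1 < (1 - s)^-1 by rewrite invf_gt1; lra.
have [n1 h1] := exp_dominates_poly K l t1; have [n2 h2] := exp_dominates_poly c^-1 0 t2.
have [n3 h3] := dge.
exists (maxn 1 (maxn n1 (maxn n2 n3))) => // n /=; rewrite !geq_max => /and4P[n0 n1n n2n n3n].
have rn k : 0 < rho ^+ k by rewrite exprn_gt0.
have up : d n <= (rho * (1 + s)) ^+ n.
  by rewrite (le_trans (dle n0))// exprMn mulrC ler_wpM2l// ?(ltW (rn _))// h1.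
have lo : (rho * (1 - s)) ^+ n <= d n.
  rewrite (le_trans _ (h3 n n3n))// exprMn mulrC ler_wpM2r ?(ltW (rn _))//.
  apply: (@le_trans _ _ c); last by rewrite ler_peMr ?(ltW c0)// exprn_ege1// ler1n.
  have := h2 n n2n; rewrite expr0 mulr1 exprVn lef_pV2 ?posrE// exprn_gt0//; lra.
have b1 : d n `^ n%:R^-1 <= rho * (1 + s).
  rewrite -[leRHS](@powR_root _ n)//; last by rewrite mulr_ge0 ?(ltW rho0)//; lra.
  apply: ge0_ler_powR; rewrite ?nnegrE ?invr_ge0//; last by rewrite exprn_ge0// mulr_ge0 ?(ltW rho0)//; lra.
  by rewrite (le_trans _ lo)// exprn_ge0// mulr_ge0 ?(ltW rho0)//; lra.
have b2 : rho * (1 - s) <= d n `^ n%:R^-1.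
  rewrite -[leLHS](@powR_root _ n)//; last by rewrite mulr_ge0 ?(ltW rho0)//; lra.
  apply: ge0_ler_powR; rewrite ?nnegrE ?invr_ge0//; first by rewrite exprn_ge0// mulr_ge0 ?(ltW rho0)//; lra.
  by rewrite (le_trans _ lo)// exprn_ge0// mulr_ge0 ?(ltW rho0)//; lra.
by rewrite ler_norml; apply/andP; split; lra.
Qed.

Lemma growth_exponent_inf :
  inf [set x : R | 0 <= x /\
    (ereal_sup [set (d n / (n%:R `^ x * rho ^+ n))%:E | n in [set n | (1 <= n)%N]] < +oo)%E] = l%:R.
Proof.
set S := [set x | _].
have lS : S l%:R.
  split=> //; apply: (@le_lt_trans _ _ K%:E); last exact: ltry.
  apply: ge_ereal_sup => _ [n /= n0 <-]; rewrite lee_fin powR_mulrn//.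
  by rewrite ler_pdivrMr ?mulr_gt0 ?exprn_gt0 ?ltr0n// mulrA dle.
apply/le_anti/andP; split.
  by apply: ge_inf => //; exists 0 => x [].
apply: lb_le_inf; first by exists l%:R.
move=> x [x0]; rewrite leNgt; set s := ereal_sup _ => sfin; apply/negP => xl.
have [B hB] : exists B : R, forall n, (0 < n)%N -> d n / (n%:R `^ x * rho ^+ n) <= B.
  have ub n : (0 < n)%N -> ((d n / (n%:R `^ x * rho ^+ n))%:E <= s)%E.
    by move=> n0; apply: ereal_sup_ubound; exists n.
  move: sfin ub; case: s => [B|//|] _ ub; first by exists B => n /ub; rewrite lee_fin.
  by exists 0 => n /ub.
have [n0 hn0] := dge.
pose y := l%:R - x; have y0 : 0 < y by rewrite subr_gt0.
pose T := (`|B| / c + 1) `^ y^-1.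
pose n := maxn (maxn 1 n0) (Num.truncn T).+1.
have n1 : (0 < n)%N by rewrite /n -maxnA leq_max.
have nn0 : (n0 <= n)%N by rewrite /n !leq_max leqnn orbT.
have nT : T <= n%:R.
  by rewrite (le_trans (ltW (truncnS_gt _)))// ler_nat /n leq_maxr.
have np : 0 < n%:R :> R by rewrite ltr0n.
have : `|B| / c + 1 <= n%:R `^ y.
  have {1}-> : `|B| / c + 1 = T `^ y.
    by rewrite /T -powRrM mulVf ?gt_eqF// powRr1// addr_ge0// divr_ge0// ltW.
  by apply: ge0_ler_powR; rewrite ?nnegrE ?(ltW y0)// powR_ge0.
have := hB n n1; rewrite ler_pdivrMr ?mulr_gt0 ?powR_gt0 ?exprn_gt0// => h1.
have := le_trans (hn0 n nn0) h1; rewrite mulrA ler_pM2r ?exprn_gt0//.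
have -> : n%:R ^+ l = n%:R `^ y * n%:R `^ x.
  rewrite -powRD ?subrK ?powR_mulrn//.
  by apply/implyP => _; rewrite gt_eqF.
rewrite mulrA ler_pM2r ?powR_gt0// => h2 h3.
have : c * (`|B| / c + 1) <= `|B|.
  by rewrite (le_trans (ler_wpM2l (ltW c0) h3))// (le_trans h2)// ler_norm.
by rewrite mulrDr mulr1 mulrC divfK ?gt_eqF// gerDl leNgt c0.
Qed.

End GrowthInvariants.

Section LimsupBound.
Variable R : realType.

Lemma limn_esup_bound (u : nat -> R) (B : R) : (forall n, 0 <= u n) ->
  (forall n, (0 < n)%N -> u n <= B) ->
  (limn_esup (fun n => (u n)%:E) <= B%:E)%E /\ limn_esup (fun n => (u n)%:E) \is a fin_num.
Proof.
move=> u0 uB.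
have le : (limn_esup (fun n => (u n)%:E) <= B%:E)%E.
  apply: (@le_trans _ _ (ereal_sup [set (u n)%:E | n in [set n | (0 < n)%N]])); last first.
    by apply: ge_ereal_sup => _ [n /= n0 <-]; rewrite lee_fin uB.
  apply: ereal_inf_lbound; exists [set n | (0 < n)%N] => //.
  by exists 1%N.
have ge : (0%:E <= limn_esup (fun n => (u n)%:E))%E.
  apply: le_ereal_inf_tmp => _ [V [n0 _ hV] <-].
  apply: (@le_trans _ _ (u n0)%:E); first by rewrite lee_fin.
  by apply: ereal_sup_ubound; exists n0 => //; apply: hV => /=.
by split=> //; rewrite ge0_fin_numE// (le_lt_trans le)// ltry.
Qed.

End LimsupBound.

Section MonomialIterates.
Variable N : nat.
Implicit Types (A B : 'M[int]_N.+1) (P : 'rV[algC]_N.+1).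

Lemma in_torus_monomial A P : in_torus P -> in_torus (monomial_map A P).
Proof.
move=> P0 i; rewrite mxE; apply/prodf_neq0 => j _.
by rewrite expfz_neq0.
Qed.

Lemma exprz_sum (x : algC) (I : finType) (f : I -> int) : x != 0 ->
  x ^ (\sum_i f i) = \prod_i x ^ f i.
Proof.
move=> x0; elim/big_rec2 : _ => [|i y z _ <-]; first by rewrite expr0z.
by rewrite expfzDr.
Qed.

Lemma prod_exprz (I : finType) (x : I -> algC) (k : int) :
  (\prod_i x i) ^ k = \prod_i x i ^ k.
Proof.
elim/big_rec2 : _ => [|i y z _ <-]; first by rewrite exp1rz.
by rewrite expfzMl.
Qed.

Lemma monomial_map_comp A B P : in_torus P ->
  monomial_map A (monomial_map B P) = monomial_map (A *m B) P.
Proof.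
move=> P0; apply/rowP => i; rewrite !mxE.
under eq_bigr => j _ do rewrite mxE prod_exprz.
rewrite exchange_big /=; apply: eq_bigr => k _; rewrite mxE exprz_sum//.
by apply: eq_bigr => j _; rewrite exprz_exp mulrC.
Qed.

Lemma iter_monomial_map A P n : in_torus P -> iter n (monomial_map A) P = monomial_map (A ^+ n) P.
Proof.
move=> P0; elim: n => [|n IH]; last by rewrite iterS IH monomial_map_comp// exprS.
apply/rowP => i; rewrite mxE (bigD1 i)//= mxE eqxx big1 => [|j ji]; first by rewrite mulr1.
by rewrite mxE eq_sym (negPf ji).
Qed.

Variable R : realType.

Lemma matrix_entry_growth A : \det A != 0 -> exists (rho : R) (l : nat) (c K : R), [/\ 0 < rho, 0 < c,
  forall n, (0 < n)%N -> (\sum_i \sum_j `|(A ^+ n) i j|)%N%:R <= K * n%:R ^+ l * rho ^+ n &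
  exists n0, forall n, (n0 <= n)%N -> c * n%:R ^+ l * rho ^+ n <= (\sum_i \sum_j `|(A ^+ n) i j|)%N%:R].
Proof.
move=> detA; pose v := @ComplexField.Normc.normc R.
have hv : is_absolute_value (v : R[i] -> R).
  split=> [x|x|x y|x y].
  - by case: x => a b; exact: sqrtr_ge0.
  - split=> [/ComplexField.Normc.eq0_normc//|->]; exact: ComplexField.Normc.normc0.
  - exact: ComplexField.Normc.normcM.
  - exact: (le_normcD (x : Rcomplex R) y).
have vn n : v n%:R = n%:R by rewrite [LHS](normcMn (1 : Rcomplex R)) ComplexField.Normc.normc1.
have vz (z : int) : v z%:~R = `|z|%N%:R.
  case: z => k; first exact: vn.
  by rewrite NegzE rmorphN (avN hv) [LHS]vn.
pose M : 'M[R[i]]_N.+1 := map_mx intr A.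
have M0 : \det M != 0 by rewrite det_map_mx intr_eq0.
have ME n : mx_norm1 v (M ^+ n) = (\sum_i \sum_j `|(A ^+ n) i j|)%N%:R.
  rewrite natr_sum; apply: eq_bigr => i _; rewrite natr_sum; apply: eq_bigr => j _.
  by rewrite /M -rmorphXn mxE vz.
have [rho [l [c [K [h1 h2 h3 h4]]]]] := matrix_power_growth hv vn M0.
exists rho, l, c, K; split=> //.
  by move=> n n0; rewrite -ME h3.
by have [n0 h] := h4; exists n0 => n hn; rewrite -ME h.
Qed.

End MonomialIterates.

Lemma torus_height_point (R : realType) (P : 'rV[algC]_0) : torus_height R P = 0.
Proof.
have P0 : in_torus P by case.
apply/le_anti; rewrite torus_height_ge0// andbT.
have [K [iota [y yE]]] := exists_number_field P.
have [z yz zE] := affine_preimage yE.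
apply: (@le_trans _ _ (height_over R y)).
  by apply: ge_inf; [exact: torus_height_has_lbound|exists K, iota, y].
by rewrite yz (height_over_seq (l := [::]))// ?big_nil ?mul0r// => v [].
Qed.

Theorem proposition25 (R : realType) (N : nat) (A : 'M[int]_N)
    (detA : \det A != 0)
    (hA : 0 < spectral_radius R A \/ (0 < jordan_index R A)%N) :
  exists C : R, forall P : 'rV[algC]_N, in_torus P ->
    (canonical_height R (monomial_map A) P <= (C * torus_height R P)%:E)%E
    /\ canonical_height R (monomial_map A) P \is a fin_num.
Proof.
case: N A detA hA => [|N] A detA _.
  exists 0 => P P0; rewrite mul0r /canonical_height.
  apply: (@limn_esup_bound R (fun n => _ * torus_height R (iter n (monomial_map A) P))) => n;
  by rewrite torus_height_point mulr0.
have [rho [l [c [K [rho0 c0 up lo]]]]] := matrix_entry_growth R detA.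
pose S n := (\sum_i \sum_j `|(A ^+ n) i j|)%N.
have Sge n i j : (`|(A ^+ n) i j| <= S n)%N.
  by rewrite /S (bigD1 i)//= (bigD1 j)//= -addnA leq_addr.
have S1 n : (0 < S n)%N.
  rewrite lt0n; apply/negP => /eqP S0.
  have An0 : A ^+ n = 0.
    apply/matrixP => i j; rewrite mxE; apply/eqP; rewrite -absz_eq0 -leqn0 -S0.
    exact: Sge.
  have : \det (A ^+ n) != 0.
    elim: (n) => [|m IH]; first by rewrite expr0 det1 oner_neq0.
    by rewrite exprS det_mulmx mulf_neq0.
  by rewrite An0 det0 eqxx.
pose d n : R := (torus_degree (A ^+ n))%:R.
have dE n : (map_degree (iter n (monomial_map A)))%:R = d n.
  congr (_%:R); apply: map_degree_monomial => P P0; exact: iter_monomial_map.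
have dK n : (0 < n)%N -> d n <= (2 * N.+1)%:R * K * n%:R ^+ l * rho ^+ n.
  move=> n0; rewrite -!mulrA mulrA; apply: (@le_trans _ _ ((2 * N.+1)%:R * (S n)%:R)).
    by rewrite -natrM ler_nat; apply: torus_degree_le => i j.
  by rewrite -mulrA ler_wpM2l// mulrA; exact: up.
pose q : R := (N.+1 * N.+1)%:R.
have q0 : 0 < q by rewrite ltr0n.
have dc : exists n0, forall n, (n0 <= n)%N -> c / q * n%:R ^+ l * rho ^+ n <= d n.
  have [n0 hn0] := lo; exists n0 => n hn.
  rewrite -!mulrA [q^-1 * _]mulrC !mulrA ler_pdivrMr// (le_trans (hn0 n hn))//.
  rewrite -natrM ler_nat; apply: (@leq_trans (\sum_(i < N.+1) \sum_(j < N.+1) torus_degree (A ^+ n))).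
    by apply: leq_sum => i _; apply: leq_sum => j _; exact: torus_degree_ge.
  by rewrite !sum_nat_const !card_ord mulnA mulnC.
have cq0 : 0 < c / q by rewrite divr_gt0.
have dyn : dynamical_degree R (monomial_map A) = rho.
  apply: cvg_lim => //; rewrite (_ : (fun n => _) = fun n => d n `^ n%:R^-1).
    exact: (growth_root_limit rho0 cq0 dK dc).
  by apply/funext => n; rewrite dE.
have expo : degree_growth_exponent R (monomial_map A) = l%:R.
  rewrite /degree_growth_exponent dyn -(growth_exponent_inf rho0 cq0 dK dc).
  congr (inf _); apply/funext => x; congr (_ /\ (ereal_sup _ < _)%E).
  by congr (image _ _); apply/funext => n; rewrite dE.
exists ((2 * N.+1%:R + 1) * K) => P P0; rewrite /canonical_height dyn expo.
have hP := torus_height_ge0 R P0.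
have iP n : in_torus (iter n (monomial_map A) P).
  by rewrite iter_monomial_map//; exact: in_torus_monomial.
have cn : 0 <= (2 * N.+1%:R + 1 : R) by rewrite addr_ge0// mulr_ge0.
apply: (@limn_esup_bound R (fun n => n%:R `^ (- l%:R) * rho ^- n * torus_height R (iter n (monomial_map A) P))) => n.
  by rewrite !mulr_ge0 ?powR_ge0 ?torus_height_ge0// invr_ge0 exprn_ge0// ltW.
move=> n0; rewrite powRN powR_mulrn// -invfM mulrC ler_pdivrMr; last first.
  by rewrite mulr_gt0 ?exprn_gt0 ?ltr0n.
rewrite iter_monomial_map//; apply: (@le_trans _ _ ((2 * N.+1%:R + 1) * (S n)%:R * torus_height R P)).
  apply: torus_height_monomial => //; first by rewrite ler1n.
  by move=> i j; rewrite -intr_norm -natr_absz ler_nat.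
rewrite [leRHS](_ : _ = (2 * N.+1%:R + 1) * (K * n%:R ^+ l * rho ^+ n) * torus_height R P); last by ring.
by rewrite ler_wpM2r// ler_wpM2l//; exact: up.
Qed.
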